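(* Let $p$ be a continuous probability density supported on a compact set $\mathcal{X}\subset\mathbb{R}^D$ with $\inf_{\mathbf{x}\in\mathcal{X}}p(\mathbf{x})\ge\delta$ for some constant $\delta>0$, and let $\mathbf{X}\sim p$. Call a map $\Psi:\mathbb{R}^D\to\mathbb{R}^D$ a marginal Gaussianization layer if for each coordinate $i=1,\dots,D$ there are an integer $N_i\ge1$ and constants $\mu_{ij}\in\mathbb{R}$, $\sigma_{ij}>0$ ($j=1,\dots,N_i$) such that $$\Psi_i(\mathbf{x})=\Phi^{-1}\!\left(\frac{1}{N_i}\sum_{j=1}^{N_i}\sigma\!\left(\frac{x_i-\mu_{ij}}{\sigma_{ij}}\right)\right),$$ where $x_i$ is the $i$-th coordinate of $\mathbf{x}$. Then there exist a sequence of marginal Gaussianization layers $\Psi^{(1)},\Psi^{(2)},\dots$ and a sequence of $D\times D$ orthogonal (rotation) matrices $R^{(1)},R^{(2)},\dots$ such that the random vectors $$\mathbf{X}^{(k)}=\Psi^{(k)}\big(R^{(k)}\,\Psi^{(k-1)}\big(R^{(k-1)}\cdots\Psi^{(1)}(R^{(1)}\mathbf{X})\big)\big)$$ converge in distribution to $\mathcal{N}(\mathbf{0},\mathbf{I}_D)$ as $k\to\infty$.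
   Context: $\sigma(t)=1/(1+e^{-t})$ is the sigmoid function; $\Phi$ is the CDF of the univariate standard normal distribution and $\Phi^{-1}$ its inverse; $\mathcal{N}(\mathbf{0},\mathbf{I}_D)$ is the $D$-dimensional standard Gaussian. *)

(* Defs.v *)
From HB Require Import structures.
From mathcomp Require Import all_boot all_order all_algebra.
From mathcomp Require Import all_classical all_reals all_analysis.
Set Implicit Arguments. Unset Strict Implicit. Unset Printing Implicit Defensive.
Import Order.TTheory GRing.Theory Num.Theory.
Import numFieldNormedType.Exports.
Local Open Scope classical_set_scope.
Local Open Scope ring_scope.

Section defs.
Context {R : realType}.

Definition sigmoid (t : R) : R := (1 + expR (- t))^-1.

Definition Phi (t : R) : R := fine (normal_prob 0 1 `]-oo, t]).

(** Inverse of Phi (Phi is a bijection R -> (0,1); only used on (0,1)). *)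
Definition Phiinv (u : R) : R := xget 0 [set t | Phi t = u].

(** Lebesgue integral over R^D (column vectors), as iterated
    one-dimensional Lebesgue integrals (Fubini/Tonelli). *)
Fixpoint intRD (n : nat) : ('cV[R]_n -> \bar R) -> \bar R :=
  match n with
  | 0 => fun f => f 0
  | n'.+1 => fun f =>
      (\int[lebesgue_measure]_(x in [set: R])
          intRD (fun v : 'cV[R]_n' => f (col_mx (x%:M : 'cV[R]_1) v)))%E
  end.

Definition std_gauss_density (D : nat) (z : 'cV[R]_D) : R :=
  \prod_(i < D) normal_pdf 0 1 (z i 0).

Definition marginal_gaussianization_layer (D : nat)
    (Psi : 'cV[R]_D -> 'cV[R]_D) : Prop :=
  forall i : 'I_D, exists N : nat, (0 < N)%N /\
    exists (mu s : nat -> R), (forall j, (j < N)%N -> 0 < s j) /\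
      forall x : 'cV[R]_D,
        Psi x i 0 = Phiinv (N%:R^-1 * \sum_(j < N) sigmoid ((x i 0 - mu j) / s j)).

Definition orthogonal_mx (D : nat) (Q : 'M[R]_D) : Prop := Q^T *m Q = 1%:M.

(** flow Psi Q k x = Psi_k (Q_k ( ... Psi_1 (Q_1 x))) with 0-based sequences:
    flow 0 x = x, flow (k+1) x = Psi k (Q k *m flow k x). *)
Fixpoint flow (D : nat) (Psi : nat -> 'cV[R]_D -> 'cV[R]_D)
    (Q : nat -> 'M[R]_D) (k : nat) (x : 'cV[R]_D) : 'cV[R]_D :=
  match k with
  | 0 => x
  | k'.+1 => Psi k' (Q k' *m flow Psi Q k' x)
  end.

End defs.

(* Main.v *)
Require Import Defs.
From HB Require Import structures.
From mathcomp Require Import all_boot all_order all_algebra.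
From mathcomp Require Import all_classical all_reals all_analysis.
From mathcomp Require Import measurable_realfun ring lra.
Set Implicit Arguments. Unset Strict Implicit. Unset Printing Implicit Defensive.
Import Order.TTheory GRing.Theory Num.Theory.
Import numFieldNormedType.Exports.
Local Open Scope classical_set_scope.
Local Open Scope ring_scope.

(** The relative entropy J of a law with respect to the standard Gaussian is used
    as a Lyapunov function, in its Donsker-Varadhan form: J is the supremum of
    E (ln w) over continuous w > 0 of Gaussian mean at most 1.  Rotations preserve
    J.  A layer whose i-th coordinate is Phiinv o G_i, where G_i is a logistic
    mixture with density q_i, carries w to w o Psi * prod_i (q_i / phi), which has
    the same Gaussian mean; hence the layer lowers J by the mean of
    sum_i ln (q_i / phi).  Initially J is finite, since p is bounded by a multiple
    of the Gaussian density.  Choosing nearly optimal steps, the best possible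
    decrease tends to 0.  As logistic mixtures approximate every density
    exp h * phi from below on compact sets, and every unit vector is a row of an
    admissible rotation, all one-dimensional projections converge to the
    Gaussian, and the Cramer-Wold argument concludes. *)

(** * Iterated integrals *)

(** The laws of the iterates are handled only as positive linear functionals on continuous
    functions, and the dual formula for J asks for nothing more: upper bounds on J come from
    composing test functions with a step, and J >= 0 comes from the test function 1. The iterates
    live on compact images of X whose size is not controlled in k, so a mixture approximating exp h
    * phi there depends on k. This is harmless because near-optimality bounds the gains of all steps
    at stage k at once, by a number that tends to 0: the chosen gains sum to at most the initial J.
    Hence, whenever the Gaussian mean of exp h is at most 1, the mean of h under each projection is
    asymptotically at most 0. Applying this to d h - c with d small, where c is d times the Gaussian
    mean of h plus O(d^2), and dividing by d turns the inequality into convergence of means, h and -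
    h giving the two directions. The tightness that Cramer-Wold requires is itself read off from the
    projections. *)

Section intRD_theory.
Context {R : realType}.
Implicit Types n : nat.

Definition coord_measurable d (T : measurableType d) n (u : T -> 'cV[R]_n) :=
  forall i, measurable_fun setT (fun t => u t i 0).

(** Borel measurability on column vectors, tested along coordinatewise
    measurable maps so that no sigma-algebra on matrices is needed. *)
Definition vec_measurable n (f : 'cV[R]_n -> \bar R) :=
  forall (d : measure_display) (T : measurableType d) (u : T -> 'cV[R]_n),
    coord_measurable u -> measurable_fun setT (f \o u).

Definition vcons n (x : R) (v : 'cV[R]_n) : 'cV[R]_n.+1 :=
  col_mx (x%:M : 'cV[R]_1) v.

Lemma vcons0 n x (v : 'cV[R]_n) : vcons x v 0 0 = x.
Proof. by rewrite mxE; case: splitP => // j _; rewrite (ord1 j) mxE mulr1n. Qed.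

Lemma vconsS n x (v : 'cV[R]_n) i : vcons x v (lift 0 i) 0 = v i 0.
Proof.
rewrite mxE; case: splitP => [j|k /=]; first by rewrite (ord1 j).
by rewrite /bump leq0n !add1n => -[ik]; congr (v _ _); exact/val_inj.
Qed.

Lemma vcons_eta n (z : 'cV[R]_n.+1) :
  z = vcons (z 0 0) (\col_i z (lift 0 i) 0).
Proof.
apply/matrixP => i j; rewrite (ord1 j).
by have [k ->|->] := unliftP 0 i; rewrite ?vconsS ?vcons0 ?mxE.
Qed.

Lemma intRDS n (f : 'cV[R]_n.+1 -> \bar R) :
  intRD f = (\int[lebesgue_measure]_x intRD (fun v => f (vcons x v)))%E.
Proof. by []. Qed.

Lemma coord_measurable_vcons d (T : measurableType d) n (a : T -> R)
  (u : T -> 'cV[R]_n) : measurable_fun setT a -> coord_measurable u ->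
  coord_measurable (fun t => vcons (a t) (u t)).
Proof.
move=> ma mu i; have [k ->|->] := unliftP 0 i.
  by under eq_fun do rewrite vconsS; exact: mu.
by under eq_fun do rewrite vcons0.
Qed.

Lemma eq_intRD n (f g : 'cV[R]_n -> \bar R) : f =1 g -> intRD f = intRD g.
Proof. by move=> /funext ->. Qed.

Lemma open_rat_cover n (O : set 'cV[R]_n) (x : 'cV[R]_n) : open O -> O x ->
  exists (q : 'cV[rat]_n) (k : nat),
    ball (map_mx ratr q : 'cV[R]_n) k.+1%:R^-1 `<=` O /\ ball (map_mx ratr q : 'cV[R]_n) k.+1%:R^-1 x.
Proof.
move=> oO Ox; have /nbhs_ballP[e /= e0 eO] : nbhs x O by exact: open_nbhs_nbhs.
have e20 : 0 < e / 2 by rewrite divr_gt0.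
have [k _ kE] : \forall k \near \oo, (k.+1%:R^-1 : R) < e / 2.
  by near=> k; near: k; exact: near_infty_natSinv_lt (PosNum e20).
have {kE} ke : (k.+1%:R^-1 : R) < e / 2 by apply: kE => /=.
have /choice[q qE] : forall i, exists q : rat, `|ratr q - x i 0| < k.+1%:R^-1.
  move=> i.
  have : x i 0 - k.+1%:R^-1 < x i 0 + k.+1%:R^-1.
    by rewrite ltrD2l gtrN// invr_gt0.
  by move=> /rat_in_itvoo[q]; rewrite in_itv/= => h; exists q; rewrite ltr_distl.
exists (\col_i q i), k; split.
  move=> y [_ By]; apply: eO; split => // i j; rewrite (ord1 j).
  have h1 : `|ratr (q i) - y i 0| < k.+1%:R^-1 by have := By i 0; rewrite !mxE.
  have h2 : `|x i 0 - ratr (q i)| < k.+1%:R^-1 by rewrite distrC; exact: qE.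
  rewrite /ball/=.
  rewrite (_ : x i 0 - y i 0 = (x i 0 - ratr (q i)) + (ratr (q i) - y i 0)); last lra.
  apply: (le_lt_trans (ler_normD _ _)); rewrite (splitr e) ltrD//; exact: lt_trans ke.
split; first by rewrite invr_gt0.
by move=> i j; rewrite (ord1 j) !mxE /ball/=; exact: qE.
Unshelve. all: by end_near. Qed.

(** Balls are cubes, so an open set is a countable union of cubes with rational centre and radius
    [k.+1%:R^-1]; the preimage of a cube is a finite intersection of preimages of intervals. *)
Lemma coord_measurable_open d (T : measurableType d) n (u : T -> 'cV[R]_n)
  (O : set 'cV[R]_n) : coord_measurable u -> open O -> measurable (u @^-1` O).
Proof.
move=> mu oO.
pose B (qk : 'cV[rat]_n * nat) : set 'cV[R]_n :=
  ball (map_mx ratr qk.1 : 'cV[R]_n) (qk.2.+1%:R^-1 : R).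
rewrite (_ : u @^-1` O = \bigcup_qk
    (if pselect (B qk `<=` O) then u @^-1` B qk else set0)); last first.
  apply/seteqP; split=> [t /= Ot|t [qk _]]; last first.
    by case: pselect => //= BO; exact: BO.
  have [q [k [BO Bx]]] := open_rat_cover oO Ot.
  by exists (q, k) => //; case: pselect.
apply: countable_bigcupT_measurable; first exact: countableP.
move=> [q k]; case: pselect => BO /=; last exact: measurable0.
rewrite (_ : u @^-1` _ = \bigcap_(i in [set: 'I_n])
    ((fun t => u t i 0) @^-1` ball (ratr (q i 0) : R) (k.+1%:R^-1 : R))); last first.
  apply/seteqP; split=> [t [_ Bt] i _|t Bt].
    by have := Bt i 0; rewrite mxE.
  split; first by rewrite /= invr_gt0.
  by move=> i j; rewrite (ord1 j) mxE; exact: Bt.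
apply: fin_bigcap_measurable; first exact: finite_finset.
move=> i _; rewrite -[X in measurable X]setTI; apply: mu => //.
exact: measurable_ball.
Qed.

Lemma continuous_vec_measurable n (f : 'cV[R]_n -> R) :
  continuous f -> vec_measurable (EFin \o f).
Proof.
move=> cf d T u mu; apply/measurable_EFinP.
move=> _; apply: (measurability _ (RGenOpens.measurableE R)) => //= _ [_ [a [b ->] <-]].
rewrite setTI; apply: (@coord_measurable_open _ _ _ u (f @^-1` `]a, b[%classic)) => //.
by move/continuousP: cf; apply; exact: interval_open.
Qed.

(** Serves the density [p], which may jump down to 0 on leaving its compact support and is therefore
    only upper semicontinuous. *)
Lemma usc_vec_measurable n (f : 'cV[R]_n -> R) :
  (forall a, open (f @^-1` `]-oo, a[)) -> vec_measurable (EFin \o f).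
Proof.
move=> uf d T u mu; apply/measurable_EFinP.
move=> _; apply: (measurability _ (RGenCInfty.measurableE R)) => //= _ [_ [a ->] <-].
rewrite setTI -setCitvl preimage_setC; apply: measurableC.
exact: (@coord_measurable_open _ _ _ u (f @^-1` `]-oo, a[%classic)).
Qed.

Definition joint_measurable d (T : measurableType d) n (F : T -> 'cV[R]_n -> \bar R) :=
  forall (d' : measure_display) (S : measurableType d') (a : S -> T)
    (u : S -> 'cV[R]_n), measurable_fun setT a -> coord_measurable u ->
    measurable_fun setT (fun s => F (a s) (u s)).

(** The parameter space is generalised in the induction: the first integration variable moves into
    it, giving [T * R], and Tonelli is applied to the positive and negative parts of the inner
    integral. *)
Lemma joint_measurable_intRD n d (T : measurableType d)
  (F : T -> 'cV[R]_n -> \bar R) :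
  joint_measurable F -> measurable_fun setT (fun t => intRD (F t)).
Proof.
elim: n d T F => [|n IH] d T F mF.
  by apply: (mF _ T id (fun=> 0)) => // i; exact: measurable_cst.
pose F2 (tx : T * R) := intRD (fun v : 'cV[R]_n => F tx.1 (vcons tx.2 v)).
have mF2 : measurable_fun setT F2.
  apply: IH => d' S a u ma mu; apply: mF.
    exact: measurableT_comp.
  by apply: coord_measurable_vcons => //; exact: measurableT_comp.
rewrite (_ : (fun t => _) = (fun t =>
   \int[lebesgue_measure]_x (F2^\+ (t, x)) -
   \int[lebesgue_measure]_x (F2^\- (t, x)))%E); last first.
  by apply/funext => t; rewrite intRDS integralE; congr (_ - _)%E; apply: eq_integral => x _; rewrite ?funeposE ?funenegE.
apply: emeasurable_funB.
- apply: (@measurable_fun_fubini_tonelli_F _ _ _ _ _ (@lebesgue_measure R) (F2^\+)%E) => //.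
  exact: measurable_funepos.
- apply: (@measurable_fun_fubini_tonelli_F _ _ _ _ _ (@lebesgue_measure R) (F2^\-)%E) => //.
  exact: measurable_funeneg.
Qed.

Lemma vec_measurable_slice n (f : 'cV[R]_n.+1 -> \bar R) x :
  vec_measurable f -> vec_measurable (fun v => f (vcons x v)).
Proof.
move=> mf d T u mu; apply: (mf _ _ (fun t => vcons x (u t))).
by apply: coord_measurable_vcons.
Qed.

Lemma vec_measurable_joint n (f : 'cV[R]_n.+1 -> \bar R) :
  vec_measurable f -> joint_measurable (fun x v => f (vcons x v)).
Proof. by move=> mf d S a u ma mu; apply: mf; exact: coord_measurable_vcons. Qed.

Lemma measurable_intRD_slice n (f : 'cV[R]_n.+1 -> \bar R) : vec_measurable f ->
  measurable_fun setT (fun x => intRD (fun v => f (vcons x v))).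
Proof. by move=> mf; apply/joint_measurable_intRD/vec_measurable_joint. Qed.

Lemma intRD_ge0 n (f : 'cV[R]_n -> \bar R) : (forall v, 0 <= f v)%E ->
  (0 <= intRD f)%E.
Proof.
elim: n f => [|n IH] f f0; first exact: f0.
by rewrite intRDS; apply: integral_ge0 => x _; exact: IH.
Qed.

Lemma le_intRD n (f g : 'cV[R]_n -> \bar R) : vec_measurable f ->
  vec_measurable g -> (forall v, 0 <= f v)%E -> (forall v, f v <= g v)%E ->
  (intRD f <= intRD g)%E.
Proof.
elim: n f g => [|n IH] f g mf mg f0 fg; first exact: fg.
rewrite !intRDS; apply: ge0_le_integral => //.
- by move=> x _; exact: intRD_ge0.
- exact: measurable_intRD_slice.
- exact: measurable_intRD_slice.
- by move=> x _; apply: IH => //; exact: vec_measurable_slice.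
Qed.

End intRD_theory.

(** * Integrals of functions dominated by the Gaussian density *)

Section dominated.
Context {R : realType}.
Implicit Types n : nat.
Notation phi := (@normal_pdf R 0 1).

Lemma phi_gt0 (x : R) : 0 < phi x.
Proof.
by rewrite normal_pdfE ?oner_eq0// mulr_gt0 ?normal_peak_gt0 ?oner_eq0 ?expR_gt0.
Qed.

Lemma gdens_gt0 n (v : 'cV[R]_n) : 0 < std_gauss_density v.
Proof. by apply: prodr_gt0 => i _; exact: phi_gt0. Qed.

Lemma gdens_vcons n x (v : 'cV[R]_n) :
  std_gauss_density (vcons x v) = phi x * std_gauss_density v.
Proof.
rewrite /std_gauss_density big_ord_recl vcons0; congr (_ * _).
by apply: eq_bigr => i _; rewrite vconsS.
Qed.

Lemma vec_measurable_real n (f : 'cV[R]_n -> R) :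
  vec_measurable (EFin \o f) <->
  (forall (d : measure_display) (T : measurableType d) (u : T -> 'cV[R]_n),
    coord_measurable u -> measurable_fun setT (f \o u)).
Proof.
by split=> mf d T u mu; [apply/measurable_EFinP|apply/measurable_EFinP];
  exact: mf.
Qed.

Lemma vec_measurableD n (f g : 'cV[R]_n -> R) : vec_measurable (EFin \o f) ->
  vec_measurable (EFin \o g) -> vec_measurable (EFin \o (f \+ g)).
Proof.
move=> /vec_measurable_real mf /vec_measurable_real mg.
apply/vec_measurable_real => d T u mu.
by apply: measurable_funD; [exact: mf|exact: mg].
Qed.

Lemma vec_measurableM n (f g : 'cV[R]_n -> R) : vec_measurable (EFin \o f) ->
  vec_measurable (EFin \o g) -> vec_measurable (EFin \o (f \* g)).
Proof.
move=> /vec_measurable_real mf /vec_measurable_real mg.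
apply/vec_measurable_real => d T u mu.
by apply: measurable_funM; [exact: mf|exact: mg].
Qed.

Lemma vec_measurable_cst n (c : R) :
  vec_measurable (fun _ : 'cV[R]_n => c%:E).
Proof. by move=> d T u mu; exact: measurable_cst. Qed.

Lemma vec_measurable_gdens n :
  vec_measurable (EFin \o (@std_gauss_density R n)).
Proof.
apply/vec_measurable_real => d T u mu.
rewrite /std_gauss_density; apply: measurable_prod => i _.
by apply: measurableT_comp; [exact: measurable_normal_pdf|exact: mu].
Qed.

(** Linearity needs integrability at every level of the iterated integral. A bound by a multiple of
    the Gaussian density passes to each slice, with constant [c * phi x], so the inner integrals are
    finite for every value of the outer variables and no null sets arise. *)
Definition gauss_dominated n (c : R) (f : 'cV[R]_n -> R) :=
  vec_measurable (EFin \o f) /\ forall v, `|f v| <= c * std_gauss_density v.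

Lemma gauss_dominated_slice n c (f : 'cV[R]_n.+1 -> R) x :
  gauss_dominated c f -> gauss_dominated (c * phi x) (fun v => f (vcons x v)).
Proof.
move=> [mf cf]; split; first exact: vec_measurable_slice mf.
by move=> v; rewrite -mulrA -gdens_vcons.
Qed.

Lemma gauss_dominated_ge0 n c (f : 'cV[R]_n -> R) : gauss_dominated c f -> 0 <= c.
Proof.
move=> [_ /(_ 0)] /(le_trans (normr_ge0 _)).
by rewrite pmulr_lge0// gdens_gt0.
Qed.

Lemma integral_cphi (c : R) : 0 <= c ->
  (\int[lebesgue_measure]_x (c * phi x)%:E = c%:E)%E.
Proof.
move=> c0; under eq_integral do rewrite EFinM.
rewrite ge0_integralZl ?lee_fin//; last 2 first.
- by apply/measurable_EFinP; exact: measurable_normal_pdf.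
- by move=> x _; rewrite lee_fin normal_pdf_ge0.
by rewrite integral_normal_pdf mule1.
Qed.

Lemma gauss_dominated_norm n c (f : 'cV[R]_n -> R) : gauss_dominated c f ->
  (`|intRD (EFin \o f)| <= c%:E)%E.
Proof.
elim: n c f => [|n IH] c f df.
  have [_ /(_ 0)] := df.
  by rewrite /std_gauss_density big_ord0 mulr1 /= lee_fin.
have c0 := gauss_dominated_ge0 df.
have mf := measurable_intRD_slice df.1.
rewrite intRDS; apply: (le_trans (le_abse_integral _ _ _)) => //.
rewrite -(integral_cphi c0); apply: ge0_le_integral => //.
- exact: measurableT_comp.
- apply/measurable_EFinP; apply: measurable_funM => //.
  exact: measurable_normal_pdf.
- by move=> x _; apply: IH; exact: gauss_dominated_slice.
Qed.

Lemma gauss_dominated_fin n c (f : 'cV[R]_n -> R) : gauss_dominated c f ->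
  intRD (EFin \o f) \is a fin_num.
Proof.
move=> /gauss_dominated_norm h.
by rewrite -abse_fin_num ge0_fin_numE// (le_lt_trans h)// ltry.
Qed.

Lemma gauss_dominated_integrable n c (f : 'cV[R]_n.+1 -> R) :
  gauss_dominated c f -> lebesgue_measure.-integrable setT
    (fun x : R => intRD (EFin \o (fun v => f (vcons x v)))).
Proof.
move=> df; have c0 := gauss_dominated_ge0 df.
apply/integrableP; split; first exact: measurable_intRD_slice df.1.
apply: (@le_lt_trans _ _ c%:E); last by rewrite ltry.
rewrite -(integral_cphi c0); apply: ge0_le_integral => //.
- by apply: measurableT_comp => //; exact: measurable_intRD_slice df.1.
- apply/measurable_EFinP; apply: measurable_funM => //.
  exact: measurable_normal_pdf.
- move=> x _; apply: gauss_dominated_norm; exact: gauss_dominated_slice.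
Qed.

Lemma gauss_dominatedD n c e (f g : 'cV[R]_n -> R) : gauss_dominated c f ->
  gauss_dominated e g -> gauss_dominated (c + e) (f \+ g).
Proof.
move=> [mf cf] [mg eg]; split; first exact: vec_measurableD.
by move=> v; rewrite mulrDl (le_trans (ler_normD _ _))// lerD.
Qed.

Lemma gauss_dominatedZ n c a (f : 'cV[R]_n -> R) : gauss_dominated c f ->
  gauss_dominated (`|a| * c) (fun v => a * f v).
Proof.
move=> [mf cf]; split.
  by apply: (@vec_measurableM _ (cst a)) => //; exact: vec_measurable_cst.
by move=> v; rewrite normrM -mulrA ler_wpM2l.
Qed.

Lemma intRDD n c e (f g : 'cV[R]_n -> R) : gauss_dominated c f ->
  gauss_dominated e g ->
  intRD (EFin \o (f \+ g)) = (intRD (EFin \o f) + intRD (EFin \o g))%E.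
Proof.
elim: n c e f g => [//|n IH] c e f g df dg.
rewrite !intRDS -integralD//; last 2 first.
- exact: gauss_dominated_integrable df.
- exact: gauss_dominated_integrable dg.
apply: eq_integral => x _.
by apply: (IH _ _ _ _ (gauss_dominated_slice x df) (gauss_dominated_slice x dg)).
Qed.

Lemma intRDZ n c a (f : 'cV[R]_n -> R) : gauss_dominated c f ->
  intRD (EFin \o (fun v => a * f v)) = (a%:E * intRD (EFin \o f))%E.
Proof.
elim: n c f => [//|n IH] c f df.
rewrite !intRDS -integralZl//; last exact: gauss_dominated_integrable df.
apply: eq_integral => x _; exact: (IH _ _ (gauss_dominated_slice x df)).
Qed.

Lemma gauss_dominated_gdens n : gauss_dominated 1 (@std_gauss_density R n).
Proof.
split; first exact: vec_measurable_gdens.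
by move=> v; rewrite mul1r gtr0_norm// gdens_gt0.
Qed.

Lemma intRD_gdens n : intRD (EFin \o (@std_gauss_density R n)) = 1%E.
Proof.
elim: n => [|n IH]; first by rewrite /= /std_gauss_density big_ord0.
rewrite intRDS -[RHS](@integral_normal_pdf R 0 1); apply: eq_integral => x _.
rewrite (_ : (fun v => _) = EFin \o (fun v => phi x * std_gauss_density v)).
  by rewrite (intRDZ _ (gauss_dominated_gdens n)) IH mule1.
by apply/funext => v /=; rewrite gdens_vcons.
Qed.

(** [0] when the iterated integral is infinite. *)
Definition RintRD n (f : 'cV[R]_n -> R) : R := fine (intRD (EFin \o f)).

Lemma EFin_RintRD n c (f : 'cV[R]_n -> R) : gauss_dominated c f ->
  (RintRD f)%:E = intRD (EFin \o f).
Proof. by move=> df; rewrite fineK//; exact: gauss_dominated_fin df. Qed.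

Lemma RintRDD n c e (f g : 'cV[R]_n -> R) : gauss_dominated c f ->
  gauss_dominated e g -> RintRD (f \+ g) = RintRD f + RintRD g.
Proof.
move=> df dg; apply: EFin_inj.
rewrite EFinD (EFin_RintRD df) (EFin_RintRD dg) -(intRDD df dg).
exact: EFin_RintRD (gauss_dominatedD df dg).
Qed.

Lemma RintRDZ n c a (f : 'cV[R]_n -> R) : gauss_dominated c f ->
  RintRD (fun v => a * f v) = a * RintRD f.
Proof.
move=> df; apply: EFin_inj; rewrite EFinM (EFin_RintRD df) -(intRDZ _ df).
exact: EFin_RintRD (gauss_dominatedZ a df).
Qed.

Lemma RintRD_ge0 n (f : 'cV[R]_n -> R) : (forall v, 0 <= f v) -> 0 <= RintRD f.
Proof. by move=> f0; apply/fine_ge0/intRD_ge0 => v; rewrite lee_fin. Qed.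

Lemma le_RintRD n c e (f g : 'cV[R]_n -> R) : gauss_dominated c f ->
  gauss_dominated e g -> (forall v, f v <= g v) -> RintRD f <= RintRD g.
Proof.
move=> df dg fg; have dNf := gauss_dominatedZ (-1) df.
rewrite -subr_ge0 -mulN1r -(RintRDZ _ df) -(RintRDD dg dNf).
by apply: RintRD_ge0 => v /=; rewrite mulN1r subr_ge0.
Qed.

Lemma RintRD_gdens n : RintRD (@std_gauss_density R n) = 1.
Proof. by rewrite /RintRD intRD_gdens. Qed.

End dominated.

(** * Change of variables on the line *)

Section weighted_pushforward.
Context d1 d2 (T1 : measurableType d1) (T2 : measurableType d2) (R : realType).
Local Open Scope ereal_scope.

(** The proofs are arguments so that the measure structure can be inferred. *)
Definition wpush (mu : {measure set T1 -> \bar R}) (a : T1 -> T2) (q : T1 -> R)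
    (ma : measurable_fun setT a) (mq : measurable_fun setT q)
    (q0 : forall x, (0 <= q x)%R) (A : set T2) : \bar R :=
  \int[mu]_(x in a @^-1` A) (q x)%:E.

Variables (mu : {measure set T1 -> \bar R}) (a : T1 -> T2) (q : T1 -> R).
Hypotheses (ma : measurable_fun setT a) (mq : measurable_fun setT q).
Hypothesis q0 : forall x, (0 <= q x)%R.

Let mpre A : measurable A -> measurable (a @^-1` A).
Proof. by move=> mA; rewrite -[X in measurable X]setTI; exact: ma. Qed.

Let wpush_set0 : wpush mu ma mq q0 set0 = 0.
Proof. by rewrite /wpush preimage_set0 integral_set0. Qed.

Let wpush_ge0 A : 0 <= wpush mu ma mq q0 A.
Proof. by apply: integral_ge0 => x _; rewrite lee_fin. Qed.

Let wpush_sigma_additive : semi_sigma_additive (wpush mu ma mq q0).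
Proof.
move=> A mA tA mUA; rewrite /wpush preimage_bigcup ge0_integral_bigcup//.
- apply: is_cvg_ereal_nneg_natsum_cond => n _ _.
  by apply: integral_ge0 => x _; rewrite lee_fin.
- by move=> k; exact: mpre.
- by apply: measurable_funTS; exact/measurable_EFinP.
- by move=> x _; rewrite lee_fin.
- move=> i j _ _ [x [/= Ai Aj]]; apply: (tA i j) => //; by exists (a x).
Qed.

HB.instance Definition _ := isMeasure.Build _ _ _ (wpush mu ma mq q0)
  wpush_set0 wpush_ge0 wpush_sigma_additive.

Import HBNNSimple.

(** Both sides are limits along simple approximations of [f], by monotone convergence; for a simple
    function the identity is the definition of [wpush], summed over finitely many values. *)
Lemma ge0_integral_wpush (f : T2 -> \bar R) : measurable_fun setT f ->
  (forall y, 0 <= f y) ->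
  \int[wpush mu ma mq q0]_y f y = \int[mu]_x (f (a x) * (q x)%:E).
Proof.
move=> mf f0; pose f_ := nnsfun_approx measurableT mf.
have mfa n : measurable_fun setT (fun x => (f_ n (a x) * q x)%:E).
  apply/measurable_EFinP; apply: measurable_funM => //.
  by apply: measurableT_comp => //; exact: measurable_funP.
transitivity (limn (fun n => \int[wpush mu ma mq q0]_x (f_ n x)%:E)).
  rewrite -monotone_convergence//.
  - apply: eq_integral => y _; apply/esym/cvg_lim => //.
    exact: cvg_nnsfun_approx.
  - by move=> n; exact/measurable_EFinP/measurable_funP.
  - by move=> n y _; rewrite lee_fin.
  - by move=> y _ m n mn; rewrite lee_fin; exact/lefP/nd_nnsfun_approx.
transitivity (limn (fun n => \int[mu]_x (f_ n (a x) * q x)%:E)); last first.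
  rewrite -monotone_convergence//.
  - apply: eq_integral => x _; apply/cvg_lim => //.
    under eq_fun do rewrite EFinM.
    apply: cvgeZr => //; exact: cvg_nnsfun_approx.
  - by move=> n x _; rewrite lee_fin mulr_ge0.
  - move=> x _ m n mn; rewrite lee_fin ler_wpM2r//.
    exact/lefP/nd_nnsfun_approx.
congr (limn _); apply/funext => n.
transitivity (\sum_(k \in range (f_ n)) k%:E * wpush mu ma mq q0 (f_ n @^-1` [set k])).
  by rewrite integralT_nnsfun sintegralE.
have kq0 (k : R) x : (0 <= k * (\1_(f_ n @^-1` [set k]) (a x) * q x))%R.
  rewrite indicE; case: (boolP (a x \in _)) => [/[1!inE] /= <-|_].
    by rewrite !mulr_ge0.
  by rewrite mul0r mulr0.
have mkq (k : R) : measurable_fun setT (fun x => \1_(f_ n @^-1` [set k]) (a x) * q x)%R.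
  apply: measurable_funM => //; apply: measurableT_comp => //.
under [RHS]eq_integral => x _.
  rewrite fimfunE mulrC mulr_fsumr.
  under eq_fsbigr do rewrite mulrCA [(q x * _)%R]mulrC.
  rewrite -fsumEFin//; over.
rewrite /= ge0_integral_fsum//.
- apply: eq_fsbigr => k /[!inE] -[y _ yk].
  have k0 : (0 <= k)%R by rewrite -yk.
  under eq_integral do rewrite EFinM.
  rewrite ge0_integralZl//; last 2 first.
  + exact/measurable_EFinP.
  + by move=> x _; rewrite lee_fin mulr_ge0.
  congr (_ * _); rewrite /wpush integral_mkcond; apply: eq_integral => x _.
  rewrite patchE indicE; case: (boolP (a x \in _)) => [|]; rewrite ?inE ?notin_setE/= => fk.
    by rewrite mem_set// mul1r.
  by rewrite memNset// mul0r.
- move=> k; apply/measurable_EFinP; exact: measurable_funM.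
- by move=> k x _; rewrite lee_fin.
Qed.

End weighted_pushforward.

Section affine_substitution.
Context {R : realType}.
Local Notation mu := (@lebesgue_measure R).
Local Open Scope ereal_scope.

(** The image of the measure [|a| dx] under the affine map gives every interval []c, d]] its length,
    so it is Lebesgue measure by uniqueness. *)
Lemma ge0_integral_affine (f : R -> \bar R) (a b : R) : a != 0%R ->
  measurable_fun setT f -> (forall x, 0 <= f x) ->
  \int[mu]_x (f (a * x + b)%R * `|a|%:E) = \int[mu]_x f x.
Proof.
move=> a0 mf f0.
have ma : measurable_fun setT (fun x : measurableTypeR R =>
    (a * x + b)%R : measurableTypeR R).
  by apply: measurable_funD => //; exact: measurable_funM.
have mq : measurable_fun setT (fun _ : measurableTypeR R => `|a|%R) by [].
have q0 : forall _ : measurableTypeR R, (0 <= `|a|)%R by [].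
rewrite -(@ge0_integral_wpush _ _ _ _ _ mu _ _ ma mq q0 f mf f0).
apply: eq_measure_integral => //= A mA _; apply/esym.
apply: lebesgue_measure_unique => //= _ [[c d] /= cd <-].
rewrite /wpush integral_cst/=; last first.
  by rewrite -[X in measurable X]setTI; exact: ma.
have [an|ap|/eqP] := ltgtP a 0%R; last by rewrite (negbTE a0).
(* A decreasing map turns a left-open interval into a right-open one; the length is the same. *)
- rewrite (_ : _ @^-1` _ = `[((d - b) / a)%R, ((c - b) / a)%R[%classic); last first.
    apply/seteqP; split=> x /=; rewrite !in_itv/= => /andP[h1 h2].
      by rewrite ler_ndivrMr// ltr_ndivlMr//; clear -h1 h2; apply/andP; split; lra.
    move: h1 h2; rewrite ler_ndivrMr// ltr_ndivlMr// => h1 h2.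
    by clear -h1 h2; apply/andP; split; lra.
  rewrite !lebesgue_measure_itv/= !lte_fin ltr_ndivrMr// divfK//.
  rewrite ltrD2r; case: ifPn => // _; last by rewrite mule0.
  by rewrite -!EFinB -EFinM ltr0_norm// -mulrBl mulNr mulrC divfK//; congr EFin; clear -a0; lra.
- rewrite (_ : _ @^-1` _ = `]((c - b) / a)%R, ((d - b) / a)%R]%classic); last first.
    apply/seteqP; split=> x /=; rewrite !in_itv/= => /andP[h1 h2].
      by rewrite ltr_pdivrMr// ler_pdivlMr//; clear -h1 h2; apply/andP; split; lra.
    move: h1 h2; rewrite ltr_pdivrMr// ler_pdivlMr// => h1 h2.
    by clear -h1 h2; apply/andP; split; lra.
  rewrite !lebesgue_measure_itv/= !lte_fin ltr_pdivrMr// divfK//.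
  rewrite ltrD2r; case: ifPn => // _; last by rewrite mule0.
  by rewrite -!EFinB -EFinM gtr0_norm// -mulrBl mulrC divfK//; congr EFin; clear -a0; lra.
Qed.

End affine_substitution.

(** * The standard normal distribution function and its inverse *)

Section normal_cdf.
Context {R : realType}.
Notation phi := (@normal_pdf R 0 1).
Notation P := (@normal_prob R 0 1).
Implicit Types a b t u : R.

Lemma EFin_Phi t : (Phi t)%:E = P `]-oo, t].
Proof. by rewrite /Phi fineK// fin_num_measure. Qed.

Lemma Phi_sub a b : a <= b -> P `]a, b] = (Phi b - Phi a)%:E.
Proof.
move=> ab; rewrite EFinB !EFin_Phi.
have -> : `]-oo, b]%classic = `]-oo, a]%classic `|` `]a, b]%classic :> set R.
  by apply/seteqP; split=> x /=; rewrite !in_itv/=; case: (leP x a) => /= h1;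
    [left|right => //|move=> _; exact: le_trans h1 ab|case=> // /andP[]].
rewrite measureU//; last first.
  apply/seteqP; split=> x //= []; rewrite !in_itv/= => xa /andP[ax _].
  by rewrite ltNge xa in ax.
by rewrite addeAC subee ?add0e// fin_num_measure.
Qed.

Lemma Phi_lt a b : a < b -> Phi a < Phi b.
Proof.
move=> ab; rewrite -subr_gt0 -lte_fin -Phi_sub ?ltW//.
(* A positive lower bound of the density on []a, b]], where [|x| <= |a| + |b|]. *)
pose c := normal_peak 1 * expR (- (`|a| + `|b|) ^+ 2 / 2) : R.
have c0 : 0 < c by rewrite mulr_gt0 ?expR_gt0 ?normal_peak_gt0 ?oner_eq0.
apply: (@lt_le_trans _ _ (\int[lebesgue_measure]_(x in `]a, b]) c%:E)%E).
  rewrite integral_cst//= lebesgue_measure_itv/= lte_fin ab.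
  by rewrite -EFinB -EFinM lte_fin mulr_gt0// subr_gt0.
apply: ge0_le_integral => //=.
- by move=> x _; rewrite lee_fin ltW.
- by apply: measurable_funTS; apply/measurable_EFinP; exact: measurable_normal_pdf.
move=> x; rewrite in_itv/= => /andP[ax xb].
rewrite lee_fin normal_pdfE ?oner_eq0// ler_wpM2l ?normal_peak_ge0//.
rewrite ler_expR subr0 expr1n; apply: ler_wpM2r; first by rewrite invr_ge0.
rewrite lerN2 -[leLHS]real_normK ?num_real// lerXn2r ?nnegrE ?addr_ge0//.
rewrite ler_norml.
have := ler_norm b; have := ler_norm (- a); rewrite normrN => h1 h2.
have := normr_ge0 a; have := normr_ge0 b => h3 h4.
by apply/andP; split; lra.
Qed.

Lemma Phi_lipschitz a b : a <= b -> Phi b - Phi a <= normal_peak 1 * (b - a).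
Proof.
move=> ab; rewrite -lee_fin -Phi_sub//.
apply: (@le_trans _ _ (\int[lebesgue_measure]_(x in `]a, b]) (normal_peak 1)%:E)%E).
  apply: ge0_le_integral => //=.
  - by move=> x _; rewrite lee_fin normal_pdf_ge0.
  - by apply: measurable_funTS; apply/measurable_EFinP; exact: measurable_normal_pdf.
  by move=> x _; rewrite lee_fin normal_pdf_ub ?oner_eq0.
rewrite integral_cst//= lebesgue_measure_itv/= lte_fin.
case: ifPn; first by rewrite -EFinB -EFinM.
by rewrite mule0 lee_fin mulr_ge0 ?normal_peak_ge0 ?subr_ge0.
Qed.

Lemma Phi_mono : {mono (@Phi R) : a b / a <= b}.
Proof. by apply: le_mono => a b; exact: Phi_lt. Qed.

Lemma Phi_inj : injective (@Phi R).
Proof. exact: inc_inj Phi_mono. Qed.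

Lemma Phi_continuous : continuous (@Phi R).
Proof.
move=> a; apply/cvgrPdist_lt => e e0.
have p0 : 0 < normal_peak (1 : R) by rewrite normal_peak_gt0 ?oner_eq0.
have : 0 < e / normal_peak 1 by rewrite divr_gt0.
move=> d0; near=> b.
have ab : `|a - b| < e / normal_peak 1.
  by near: b; apply: cvgr_dist_lt.
move: ab; rewrite ltr_pdivlMr//; apply: le_lt_trans.
have [h|/ltW h] := leP a b.
  rewrite distrC (distrC a) (ger0_norm (_ : 0 <= b - a)) ?subr_ge0//.
  by rewrite ger0_norm ?subr_ge0 ?Phi_mono// mulrC Phi_lipschitz.
rewrite (ger0_norm (_ : 0 <= a - b)) ?subr_ge0//.
by rewrite ger0_norm ?subr_ge0 ?Phi_mono// mulrC Phi_lipschitz.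
Unshelve. all: by end_near. Qed.

(** Seen as a random variable under the normal law, the identity has distribution function [Phi];
    this gives access to the limits at both infinities. *)
Let idR : measurableTypeR R -> R := idfun.
#[local] HB.instance Definition _ :=
  @isMeasurableFun.Build _ _ _ _ idR (@measurable_id _ _ setT).

Let cdf_idR : cdf (idR : {RV P >-> R}) = EFin \o (@Phi R).
Proof. by apply/funext => t; rewrite /= EFin_Phi. Qed.

Lemma Phi_gt u : u < 1 -> exists t, u < Phi t.
Proof.
move=> u1; have := @cvg_cdfy1 _ _ _ _ (idR : {RV P >-> R}).
rewrite cdf_idR => /fine_cvg h; near (pinfty_nbhs R) => t.
by exists t; near: t; exact: (cvgr_gt _ h).
Unshelve. all: by end_near. Qed.

Lemma Phi_lt_ex u : 0 < u -> exists t, Phi t < u.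
Proof.
move=> u1; have := @cvg_cdfNy0 _ _ _ _ (idR : {RV P >-> R}).
rewrite cdf_idR => /fine_cvg h; near (ninfty_nbhs R) => t.
by exists t; near: t; exact: (cvgr_lt _ h).
Unshelve. all: by end_near. Qed.

Lemma Phi_01 t : 0 < Phi t < 1.
Proof.
apply/andP; split.
  apply: (@le_lt_trans _ _ (Phi (t - 1))); last by rewrite Phi_lt// gtrBl.
  exact/fine_ge0.
apply: (@lt_le_trans _ _ (Phi (t + 1))); first by rewrite Phi_lt// ltrDl.
by rewrite -lee_fin EFin_Phi; exact: probability_le1.
Qed.

Lemma PhiinvK u : 0 < u < 1 -> Phi (Phiinv u) = u.
Proof.
move=> /andP[u0 u1]; have [a au] := Phi_lt_ex u0; have [b bu] := Phi_gt u1.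
have ab : a <= b by rewrite -Phi_mono ltW// (lt_trans au).
have [||t _ tE] := @IVT R (@Phi R) a b u ab.
- by apply: continuous_subspaceT; exact: Phi_continuous.
- by rewrite ge_min le_max (ltW au) (ltW bu) orbT.
by rewrite /Phiinv; apply: (@xgetPex _ 0 [set t | Phi t = u]); exists t.
Qed.

Lemma PhiK t : Phiinv (Phi t) = t.
Proof. by apply: Phi_inj; rewrite PhiinvK// Phi_01. Qed.

End normal_cdf.

(** Surjectivity onto the open unit interval stands for the limits at infinity. Together with
    [q > 0] it makes [Phiinv \o G] an increasing bijection of the line. *)
Definition smooth_cdf (R : realType) (G q : R -> R) :=
  [/\ forall x : R, is_derive x 1 G (q x), continuous q, forall x, 0 < q x,
      forall x, 0 < G x < 1 & forall u, 0 < u < 1 -> exists x, G x = u].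

Section gaussianization.
Context {R : realType}.
Variables G q : R -> R.
Hypothesis Gq : smooth_cdf G q.
Notation phi := (@normal_pdf R 0 1).
Notation mu := (@lebesgue_measure R).
Let tau x := Phiinv (G x).

Let G_continuous : continuous G.
Proof.
case: Gq => dG _ _ _ _ x.
by apply: differentiable_continuous; apply/derivable1_diffP; case: (dG x).
Qed.

Let G_sub a b : a < b -> exists2 c, c \in `]a, b[ & G b - G a = q c * (b - a).
Proof.
case: Gq => dG _ _ _ _ ab; apply: (MVT ab (fun x _ => dG x)).
exact: continuous_subspaceT.
Qed.

Let G_lt a b : a < b -> G a < G b.
Proof.
case: Gq => _ _ q0 _ _ ab; have [c _ E] := G_sub ab.
by rewrite -subr_gt0 E mulr_gt0// subr_gt0.
Qed.

Let Phi_tau x : Phi (tau x) = G x.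
Proof. by case: Gq => _ _ _ G01 _; rewrite PhiinvK. Qed.

Let tau_mono : {mono tau : a b / a <= b}.
Proof.
by move=> a b; rewrite -Phi_mono !Phi_tau; apply: (le_mono (f := G)).
Qed.

Let tau_surj t : exists x, tau x = t.
Proof.
case: Gq => _ _ _ _ Gs; have [x E] := Gs _ (Phi_01 t).
by exists x; rewrite /tau E PhiK.
Qed.

(** An increasing surjection of the line is continuous: the levels [tau x - e] and [tau x + e] are
    attained, at points on either side of [x]. *)
Lemma gaussianize_continuous : continuous (fun x => Phiinv (G x)).
Proof.
rewrite -/tau => x; apply/cvgrPdist_lt => e e0.
have [a aE] := tau_surj (tau x - e); have [b bE] := tau_surj (tau x + e).
have ax : a < x by rewrite -(leW_mono tau_mono) aE gtrBl.
have xb : x < b by rewrite -(leW_mono tau_mono) bE ltrDl.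
near=> y; rewrite distrC ltr_distl -aE -bE !(leW_mono tau_mono).
by apply/andP; split; near: y; [exact: lt_nbhsr|exact: lt_nbhsl].
Unshelve. all: by end_near. Qed.

Let q_integral a b : a <= b -> (\int[mu]_(x in `]a, b]) (q x)%:E = (G b - G a)%:E)%E.
Proof.
rewrite le_eqVlt => /predU1P[->|ab].
  by rewrite set_itvoc0 integral_set0 subrr.
case: Gq => dG cq _ _ _.
rewrite integral_itv_obnd_cbnd; last first.
  by apply: measurable_funTS; apply/measurable_EFinP; exact: continuous_measurable_fun.
rewrite (@continuous_FTC2 _ q G)//.
- exact: continuous_subspaceT.
- split.
  + by move=> x _; case: (dG x).
  + by apply: cvg_at_right_filter; exact: G_continuous.
  + by apply: cvg_at_left_filter; exact: G_continuous.
- by move=> x _; rewrite derive1E; case: (dG x).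
Qed.

(** Both sides integrate [f] against a measure: the image of [q dx] under [tau], and [phi dx]. Each
    gives []a, b]] the mass [Phi b - Phi a], so they coincide; [Phiinv] is never differentiated. *)
Lemma ge0_integral_gaussianize (f : R -> \bar R) : measurable_fun setT f ->
  (forall x, 0 <= f x)%E ->
  (\int[mu]_x (f (Phiinv (G x)) * (q x)%:E) = \int[mu]_x (f x * (phi x)%:E))%E.
Proof.
case: Gq => dG cq q0 _ _ mf f0.
have mt : measurable_fun setT (tau : measurableTypeR R -> measurableTypeR R).
  by apply: continuous_measurable_fun; exact: gaussianize_continuous.
have mq : measurable_fun setT (q : measurableTypeR R -> R).
  exact: continuous_measurable_fun.
have q0' (x : measurableTypeR R) : 0 <= q x by exact: ltW.
have mid : measurable_fun setT (idfun : measurableTypeR R -> measurableTypeR R).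
  exact: measurable_id.
have mphi : measurable_fun setT (phi : measurableTypeR R -> R).
  exact: measurable_normal_pdf.
have phi0 (x : measurableTypeR R) : 0 <= phi x by exact: normal_pdf_ge0.
have := @ge0_integral_wpush _ _ _ _ _ mu _ _ mt mq q0' f mf f0.
have := @ge0_integral_wpush _ _ _ _ _ mu _ _ mid mphi phi0 f mf f0.
rewrite /tau => <- <-; apply: eq_measure_integral => A mA _.
have wE a b : a <= b -> wpush mu mt mq q0' `]a, b] = (Phi b - Phi a)%:E.
  move=> ab; rewrite /wpush.
  have [x xa] := tau_surj a; have [y yb] := tau_surj b.
  rewrite (_ : _ @^-1` _ = `]x, y]%classic); last first.
    by apply/seteqP; split=> z /=; rewrite !in_itv/= -xa -yb
      (leW_mono tau_mono) tau_mono.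
  rewrite q_integral; last by rewrite -tau_mono xa yb.
  by rewrite -!Phi_tau xa yb.
apply: (@measure_unique _ R (measurableTypeR R) (@ocitv R)
  (fun k : nat => `]- k%:R, k%:R]%classic) _ _ _ _
  (wpush mu mt mq q0') (wpush mu mid mphi phi0)) => //.
- move=> X Y; exact: ocitvI.
- by move=> k; exact: is_ocitv.
- exact: bigcup_itvT.
- move=> _ [[a b] /= _ <-].
  have [ab|ab] := leP a b; last first.
    by rewrite set_itv_ge ?bnd_simp -?leNgt ?ltW// !measure0.
  by rewrite wE// /wpush preimage_id -Phi_sub.
- by move=> k; rewrite [X in (X < _)%E](wE (- k%:R) k%:R) ?ltry// ge0_cp.
Qed.

End gaussianization.

(** * Invariance of the Gaussian *)

Section vec_measurable_closure.
Context {R : realType}.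
Implicit Types m n : nat.

Lemma vec_measurable_comp m n (f : 'cV[R]_m -> \bar R) (T : 'cV[R]_n -> 'cV[R]_m) :
  vec_measurable f -> (forall i, vec_measurable (fun v => (T v i 0)%:E)) ->
  vec_measurable (f \o T).
Proof.
move=> mf mT d S u mu; apply: (mf _ _ (T \o u)) => i.
by have /vec_measurable_real := mT i; exact.
Qed.

Lemma vec_measurable_coord n (i : 'I_n) (g : R -> R) : measurable_fun setT g ->
  vec_measurable (fun v : 'cV[R]_n => (g (v i 0))%:E).
Proof.
by move=> mg d T u mu; apply/measurable_EFinP; exact: measurableT_comp.
Qed.

Lemma vec_measurable_mulmx m n (f : 'cV[R]_m -> \bar R) (Q : 'M[R]_(m, n)) :
  vec_measurable f -> vec_measurable (fun v => f (Q *m v)).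
Proof.
move=> mf; apply: (vec_measurable_comp (T := mulmx Q)) => // i d T u mu.
apply/measurable_EFinP; under eq_fun do rewrite mxE.
by apply: measurable_sum => j; apply: measurable_funM => //; exact: mu.
Qed.

Lemma vec_measurableMe n (f : 'cV[R]_n -> \bar R) (g : 'cV[R]_n -> R) :
  vec_measurable f -> vec_measurable (EFin \o g) ->
  vec_measurable (fun v => f v * (g v)%:E)%E.
Proof.
by move=> mf mg d T u mu; apply: emeasurable_funM; [exact: mf|exact: mg].
Qed.

Lemma vec_measurable_prod n (q : 'I_n -> R -> R) :
  (forall i, measurable_fun setT (q i)) ->
  vec_measurable (fun v : 'cV[R]_n => (\prod_i q i (v i 0))%:E).
Proof.
move=> mq d T u mu; apply/measurable_EFinP; apply: measurable_prod => i _.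
by apply: measurableT_comp; [exact: mq|exact: mu].
Qed.

Lemma ge0_intRDZr n (f : 'cV[R]_n -> \bar R) c : vec_measurable f ->
  (forall v, 0 <= f v)%E -> 0 <= c ->
  intRD (fun v => f v * c%:E)%E = (intRD f * c%:E)%E.
Proof.
elim: n f => [//|n IH] f mf f0 c0.
rewrite !intRDS -ge0_integralZr//; last 2 first.
- exact: measurable_intRD_slice.
- by move=> x _; exact: intRD_ge0.
by apply: eq_integral => x _; apply: IH => //; exact: vec_measurable_slice.
Qed.

End vec_measurable_closure.

Section gaussian_invariance.
Context {R : realType}.
Notation phi := (@normal_pdf R 0 1).
Notation mu := (@lebesgue_measure R).

(** Induction on the dimension: the substitution on the line treats the first coordinate, the
    induction hypothesis treats the others with the first one frozen. *)
Lemma intRD_gaussianize n (G q : 'I_n -> R -> R) (f : 'cV[R]_n -> \bar R) :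
  (forall i, smooth_cdf (G i) (q i)) -> vec_measurable f ->
  (forall v, 0 <= f v)%E ->
  intRD (fun v => f (\col_i Phiinv (G i (v i 0%R)))%R * (\prod_i q i (v i 0))%R%:E)%E =
  intRD (fun v => f v * (std_gauss_density v)%:E)%E.
Proof.
elim: n G q f => [|n IH] G q f Gq mf f0.
  by rewrite /= /std_gauss_density !big_ord0; congr (f _ * _)%E; apply/matrixP => -[].
have mq i : measurable_fun setT (q i).
  by case: (Gq i) => _ cq _ _ _; exact: continuous_measurable_fun.
have q0 i x : 0 <= q i x by case: (Gq i) => _ _ q0 _ _; exact: ltW.
have mK : measurable_fun setT (fun y => intRD (fun v : 'cV[R]_n =>
    f (vcons y v) * (std_gauss_density v)%:E)%E).
  apply: joint_measurable_intRD => d S a u ma mu; apply: emeasurable_funM.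
    by apply: mf; exact: coord_measurable_vcons.
  exact: vec_measurable_gdens mu.
rewrite !intRDS.
(* [K y] integrates over the other coordinates when the first one, already transformed, equals
   [y]. *)
pose K y := intRD (fun v : 'cV[R]_n => f (vcons y v) * (std_gauss_density v)%:E)%E.
have K0 y : (0 <= K y)%E.
  by apply: intRD_ge0 => v; rewrite mule_ge0// lee_fin ltW// gdens_gt0.
transitivity (\int[mu]_x (K x * (phi x)%:E))%E; last first.
  apply: eq_integral => x _; rewrite -ge0_intRDZr.
  - by apply: eq_intRD => v; rewrite gdens_vcons mulrC EFinM muleA.
  - by apply: vec_measurableMe; [exact: vec_measurable_slice|exact: vec_measurable_gdens].
  - by move=> v; rewrite mule_ge0// lee_fin ltW// gdens_gt0.
  - exact: normal_pdf_ge0.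
rewrite -(ge0_integral_gaussianize (Gq ord0) mK K0).
apply: eq_integral => x _.
rewrite /K -(IH (fun i => G (lift 0 i)) (fun i => q (lift 0 i)) (fun v => f (vcons _ v)))//;
  last exact: vec_measurable_slice.
rewrite -ge0_intRDZr//.
- apply: eq_intRD => v; rewrite big_ord_recl vcons0 mulrC EFinM muleA.
  congr (f _ * _ * _)%E.
    apply/matrixP => i j; rewrite (ord1 j) mxE.
    by have [k ->|->] := unliftP 0 i; rewrite ?vconsS ?vcons0 ?mxE// vconsS.
  by congr EFin; apply: eq_bigr => i _; rewrite vconsS.
- apply: vec_measurableMe; last exact: (vec_measurable_prod (fun i => mq (lift 0 i))).
  apply: (vec_measurable_comp (f := fun v => f (vcons _ v)) (T := fun v =>
     \col_i Phiinv (G (lift 0 i) (v i 0)))); first exact: vec_measurable_slice.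
  move=> i; under eq_fun do rewrite mxE.
  apply: (vec_measurable_coord i (g := fun x => Phiinv (G (lift 0 i) x))).
  by apply: continuous_measurable_fun; exact: gaussianize_continuous (Gq _).
- by move=> v; rewrite mule_ge0// lee_fin prodr_ge0.
Qed.

(** If [c != 0], two affine substitutions in a single variable suffice: [y' = - s x + c y] at fixed
    [x], then, after Tonelli, [(x + s y') / c] at fixed [y'], which equals [c x + s y]. The factors
    [|c|] and [|c^-1|] cancel. If [c = 0], the map exchanges the variables up to signs. *)
Lemma ge0_integral_rotation (c s : R) (H : R * R -> \bar R) :
  c ^+ 2 + s ^+ 2 = 1 -> measurable_fun setT H -> (forall z, 0 <= H z)%E ->
  (\int[mu]_x \int[mu]_y H (c * x + s * y, - s * x + c * y)%R =
   \int[mu]_x \int[mu]_y H (x, y))%E.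
Proof.
move=> cs1 mH H0.
have mHl (a b a' b' : R) : measurable_fun setT
    (fun z : R * R => H (a * z.1 + b * z.2, a' * z.1 + b' * z.2)).
  by apply: measurableT_comp => //; apply/measurable_fun_pairP; split => /=;
    apply: measurable_funD; apply: measurable_funM.
have [c0|c0] := eqVneq c 0.
  have s21 : s ^+ 2 = 1 by rewrite -cs1 c0 expr0n/= add0r.
  have ns1 : `|s| = 1.
    by apply/eqP; rewrite -sqrp_eq1// real_normK ?num_real// s21.
  have s0 : s != 0 by rewrite -normr_eq0 ns1 oner_eq0.
  transitivity (\int[mu]_x \int[mu]_y H (y, - s * x)%R)%E.
    apply: eq_integral => x _.
    rewrite -(@ge0_integral_affine _ (fun y => H (y, - s * x)) s 0)//; last first.
      by apply: measurableT_comp => //; apply/measurable_fun_pairP.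
    apply: eq_integral => y _; rewrite ns1 mule1 c0.
    by rewrite !mul0r add0r !addr0.
  rewrite (fubini_tonelli (m1 := mu) (m2 := mu)
     (fun z : R * R => H (z.2, - s * z.1)))//; last first.
    have := mHl 0 1 (- s) 0; congr measurable_fun; apply/funext => z.
    by rewrite !mul0r !addr0 add0r mul1r.
  apply: eq_integral => y _; rewrite /fubini_G/=.
  rewrite -[RHS](@ge0_integral_affine _ (fun x => H (y, x)) (- s) 0) ?oppr_eq0//.
    by apply: eq_integral => x _; rewrite normrN ns1 mule1 addr0.
  by apply: measurableT_comp.
have ncV : (`|c^-1|%:E * `|c|%:E = 1%:E :> \bar R)%E.
  by rewrite -EFinM -normrM mulVf// normr1.
pose K (z : R * R) := (H (c^-1 * z.1 + s / c * z.2, z.2)%R * `|c^-1|%:E)%E.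
have mK : measurable_fun setT K.
  apply: emeasurable_funM => //.
  have := mHl c^-1 (s / c) 0 1; congr measurable_fun; apply/funext => z.
  by rewrite mul0r add0r mul1r.
have K0 z : (0 <= K z)%E by rewrite mule_ge0.
transitivity (\int[mu]_x \int[mu]_y K (x, y))%E.
  apply: eq_integral => x _.
  rewrite -[RHS](@ge0_integral_affine _ (fun y => K (x, y)) c (- s * x))//; last first.
    exact: measurableT_comp.
  apply: eq_integral => y _; rewrite /K/= -muleA ncV mule1; congr (H (_, _)).
    have -> : c * x + s * y = (c ^+ 2 * x + c * s * y) / c by field.
    have -> : c ^+ 2 = 1 - s ^+ 2 by rewrite -cs1; ring.
    by field.
  by rewrite addrC.
rewrite (fubini_tonelli (m1 := mu) (m2 := mu) K)// [RHS](fubini_tonelli (m1 := mu) (m2 := mu) H)//.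
apply: eq_integral => y _; rewrite /fubini_G /K/=.
rewrite -[RHS](@ge0_integral_affine _ (fun x => H (x, y)) c^-1 (s / c * y)) ?invr_eq0//.
by apply: measurableT_comp.
Qed.

(** Established below for products of plane rotations and, in dimension one, signs; these matrices
    already realise every unit vector as a first row. *)
Definition gauss_invariant n (Q : 'M[R]_n) :=
  forall f : 'cV[R]_n -> \bar R, vec_measurable f -> (forall v, 0 <= f v)%E ->
  intRD (fun v => f (Q *m v) * (std_gauss_density v)%:E)%E =
  intRD (fun v => f v * (std_gauss_density v)%:E)%E.

Lemma gauss_invariantM n (Q1 Q2 : 'M[R]_n) : gauss_invariant Q1 ->
  gauss_invariant Q2 -> gauss_invariant (Q1 *m Q2).
Proof.
move=> i1 i2 f mf f0; rewrite -(i1 f mf f0).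
rewrite -[RHS](i2 (fun v => f (Q1 *m v)))//; last exact: vec_measurable_mulmx.
by apply: eq_intRD => v; rewrite mulmxA.
Qed.

Lemma orthogonal_mxM n (Q1 Q2 : 'M[R]_n) : orthogonal_mx Q1 ->
  orthogonal_mx Q2 -> orthogonal_mx (Q1 *m Q2).
Proof.
by move=> o1 o2; rewrite /orthogonal_mx trmx_mul mulmxA -(mulmxA Q2^T) o1 mulmx1.
Qed.

Definition lift1_mx n (Q : 'M[R]_n) : 'M[R]_n.+1 :=
  block_mx (1%:M : 'M[R]_1) 0 0 Q.

Lemma lift1_mx_vcons n (Q : 'M[R]_n) x v :
  lift1_mx Q *m vcons x v = vcons x (Q *m v).
Proof.
by rewrite /lift1_mx /vcons (@mul_block_col _ 1 n 1 n) !mul0mx mul1mx addr0 add0r.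
Qed.

Lemma mulmx_eq1 n (Q : 'M[R]_n) : (forall v : 'cV[R]_n, Q *m v = v) -> Q = 1%:M.
Proof.
move=> h; apply/matrixP => i j; have := congr1 (fun M : 'cV[R]_n => M i 0) (h (delta_mx j 0)).
by rewrite -colE !mxE eqxx andbT.
Qed.

Lemma lift1_mx_orthogonal n (Q : 'M[R]_n) : orthogonal_mx Q ->
  orthogonal_mx (lift1_mx Q).
Proof.
move=> oQ; apply: mulmx_eq1 => v; rewrite [v]vcons_eta -mulmxA lift1_mx_vcons.
have -> : (lift1_mx Q)^T = lift1_mx Q^T.
  by rewrite /lift1_mx (@tr_block_mx _ 1 n 1 n) !trmx0 trmx1.
by rewrite lift1_mx_vcons mulmxA oQ mul1mx.
Qed.

Lemma lift1_mx_invariant n (Q : 'M[R]_n) : gauss_invariant Q ->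
  gauss_invariant (lift1_mx Q).
Proof.
move=> iQ f mf f0; rewrite !intRDS; apply: eq_integral => x _.
have mfx : vec_measurable (fun v => f (vcons x v) * (phi x)%:E)%E.
  by apply: vec_measurableMe; [exact: vec_measurable_slice|exact: vec_measurable_cst].
have fx0 v : (0 <= f (vcons x v) * (phi x)%:E)%E.
  by rewrite mule_ge0// lee_fin normal_pdf_ge0.
transitivity (intRD (fun v => f (vcons x (Q *m v)) * (phi x)%:E * (std_gauss_density v)%:E)%E).
  by apply: eq_intRD => v; rewrite lift1_mx_vcons gdens_vcons EFinM muleA.
rewrite (iQ _ mfx fx0).
by apply: eq_intRD => v; rewrite gdens_vcons EFinM muleA.
Qed.

Definition givens_mx n (c s : R) : 'M[R]_n.+2 :=
  block_mx (c%:M : 'M[R]_1) (row_mx (s%:M : 'M[R]_1) 0 : 'M[R]_(1, 1 + n))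
    (col_mx ((- s)%:M : 'M[R]_1) 0 : 'M[R]_(1 + n, 1)) (block_mx (c%:M : 'M[R]_1) 0 0 1%:M).

Lemma givens_mx_vcons n c s x y (v : 'cV[R]_n) :
  givens_mx n c s *m vcons x (vcons y v) =
  vcons (c * x + s * y) (vcons (- s * x + c * y) v).
Proof.
rewrite /givens_mx /vcons (@mul_block_col _ 1 (1 + n) 1 (1 + n)).
rewrite (@mul_row_col _ 1 1 n) mul0mx addr0 (@mul_col_mx _ 1 n).
rewrite (@mul_block_col _ 1 n 1 n) !mul0mx mul1mx addr0 add0r.
by rewrite (@add_col_mx _ 1 n) add0r -!scalar_mxM -!raddfD.
Qed.

Lemma givens_mx_orthogonal n c s : c ^+ 2 + s ^+ 2 = 1 ->
  orthogonal_mx (givens_mx n c s).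
Proof.
move=> cs1; apply: mulmx_eq1 => v.
rewrite [v]vcons_eta; set w := (X in vcons _ X); rewrite [w]vcons_eta.
rewrite -mulmxA givens_mx_vcons.
have -> : (givens_mx n c s)^T = givens_mx n c (- s).
  rewrite /givens_mx (@tr_block_mx _ 1 (1 + n) 1 (1 + n)) (@tr_block_mx _ 1 n 1 n).
  by rewrite (@tr_row_mx _ 1 1 n) (@tr_col_mx _ 1 n 1) !tr_scalar_mx !trmx0 opprK.
have E (t : R) : t = (c ^+ 2 + s ^+ 2) * t by rewrite cs1 mul1r.
rewrite givens_mx_vcons; congr (vcons _ (vcons _ _)); rewrite [RHS]E; ring.
Qed.

Lemma phi_rotation (c s x y : R) : c ^+ 2 + s ^+ 2 = 1 ->
  phi (c * x + s * y) * phi (- s * x + c * y) = phi x * phi y.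
Proof.
move=> cs1; rewrite !normal_pdfE ?oner_eq0// /normal_fun !subr0.
rewrite mulrACA [RHS]mulrACA -!expRD; congr (_ * expR _).
rewrite -!mulrDl; congr (_ * _); rewrite -!opprD; congr (- _).
have -> : x ^+ 2 + y ^+ 2 = (c ^+ 2 + s ^+ 2) * (x ^+ 2 + y ^+ 2).
  by rewrite cs1 mul1r.
by ring.
Qed.

Lemma givens_mx_invariant n c s : c ^+ 2 + s ^+ 2 = 1 ->
  gauss_invariant (givens_mx n c s).
Proof.
move=> cs1 f mf f0.
pose H (z : R * R) := intRD (fun v : 'cV[R]_n => f (vcons z.1 (vcons z.2 v)) *
   (std_gauss_density (vcons z.1 (vcons z.2 v)))%:E)%E.
have mH : measurable_fun setT H.
  apply: joint_measurable_intRD => d S a u ma mu.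
  have mv : coord_measurable (fun s => vcons (a s).1 (vcons (a s).2 (u s))).
    by do 2 ! [apply: coord_measurable_vcons; first exact: measurableT_comp].
  by apply: emeasurable_funM; [exact: mf|exact: vec_measurable_gdens mv].
have H0 z : (0 <= H z)%E.
  by apply: intRD_ge0 => v; rewrite mule_ge0// lee_fin ltW// gdens_gt0.
rewrite intRDS [RHS]intRDS.
under eq_integral do rewrite intRDS; under [RHS]eq_integral do rewrite intRDS.
rewrite -[RHS](ge0_integral_rotation cs1 mH H0).
apply: eq_integral => x _; apply: eq_integral => y _.
apply: eq_intRD => v; rewrite givens_mx_vcons; congr (_ * _%:E)%E.
by rewrite !gdens_vcons !mulrA/= phi_rotation.
Qed.

Lemma scalar_mx1_invariant (c : R) : c ^+ 2 = 1 ->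
  gauss_invariant (c%:M : 'M[R]_1).
Proof.
move=> c1 f mf f0; rewrite !intRDS /=.
have nc : `|c| = 1.
  by apply/eqP; rewrite -sqrp_eq1// real_normK ?num_real// c1.
have c0 : c != 0 by rewrite -normr_eq0 nc oner_eq0.
rewrite -[RHS](@ge0_integral_affine _ _ c 0)//.
- apply: eq_integral => x _; rewrite nc mule1 addr0.
  congr (f _ * _%:E)%E.
    rewrite [LHS]vcons_eta mxE big_ord1 vcons0 mxE mulr1n.
    by congr vcons; apply/matrixP => -[].
  rewrite !gdens_vcons; congr (_ * _).
  by rewrite !normal_pdfE ?oner_eq0// /normal_fun !subr0 exprMn c1 mul1r.
- apply: emeasurable_funM.
    apply: mf => i; have := @coord_measurable_vcons R _ _ _ id (fun=> 0).
    by apply => //= j; exact: measurable_cst.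
  apply: (vec_measurable_gdens (u := fun x => vcons x 0)) => i.
  have := @coord_measurable_vcons R _ _ _ id (fun=> 0).
  by apply => //= j; exact: measurable_cst.
- by move=> x; rewrite mule_ge0// lee_fin ltW// gdens_gt0.
Qed.

(** Write [t = (t 0, r u)] with [u] a unit vector in one dimension less. A rotation of the last
    coordinates makes the component along [u] the second coordinate, and a plane rotation with
    [c = t 0], [s = r] combines it with the first. *)
Lemma exists_invariant_row n (t : 'cV[R]_n.+1) : \sum_i t i 0 ^+ 2 = 1 ->
  exists Q : 'M[R]_n.+1, [/\ orthogonal_mx Q, gauss_invariant Q &
    forall v : 'cV[R]_n.+1, (Q *m v) 0 0 = \sum_i t i 0 * v i 0].
Proof.
elim: n t => [|n IH] t t1.
  rewrite big_ord1 in t1; exists (t 0 0)%:M; split.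
  - by rewrite /orthogonal_mx tr_scalar_mx -scalar_mxM -expr2 t1.
  - exact: scalar_mx1_invariant.
  - by move=> v; rewrite mul_scalar_mx mxE big_ord1.
pose w : 'cV[R]_n.+1 := \col_i t (lift 0 i) 0.
pose r := Num.sqrt (\sum_i w i 0 ^+ 2).
have r2 : r ^+ 2 = \sum_i w i 0 ^+ 2.
  by rewrite sqr_sqrtr// sumr_ge0// => i _; rewrite sqr_ge0.
have cs1 : t 0 0 ^+ 2 + r ^+ 2 = 1.
  by rewrite r2 -t1 [RHS]big_ord_recl; congr (_ + _); apply: eq_bigr => i _; rewrite mxE.
have [u u1 wu] : exists2 u : 'cV[R]_n.+1, \sum_i u i 0 ^+ 2 = 1 & w = r *: u.
  have [r0|r0] := eqVneq r 0.
    (* When the tail of [t] vanishes its direction is arbitrary; a basis vector is taken. *)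
    exists (\col_i (i == 0)%:R).
      rewrite big_ord_recl big1 ?addr0 ?mxE ?eqxx ?expr1n// => i _.
      by rewrite mxE expr0n.
    rewrite r0 scale0r; apply/matrixP => i j; rewrite (ord1 j) [RHS]mxE; apply/eqP.
    move: r2; rewrite r0 expr0n => /esym/eqP.
    rewrite psumr_eq0 => [/allP/(_ i)|k _]; last exact: sqr_ge0.
    by rewrite mem_index_enum sqrf_eq0/= => /(_ isT).
  exists (r^-1 *: w); last by rewrite scalerA mulfV// scale1r.
  under eq_bigr do rewrite mxE exprMn.
  by rewrite -mulr_sumr -r2 -exprMn mulVf// expr1n.
have [Q [oQ iQ rQ]] := IH u u1.
exists (givens_mx n (t 0 0) r *m lift1_mx Q); split.
- by apply: orthogonal_mxM; [exact: givens_mx_orthogonal|exact: lift1_mx_orthogonal].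
- by apply: gauss_invariantM; [exact: givens_mx_invariant|exact: lift1_mx_invariant].
- move=> v; rewrite [v in LHS]vcons_eta -mulmxA lift1_mx_vcons.
  set y := \col_i _; rewrite [Q *m y]vcons_eta givens_mx_vcons vcons0 rQ.
  rewrite [RHS]big_ord_recl; congr (_ + _); rewrite mulr_sumr; apply: eq_bigr => i _.
  have := congr1 (fun M : 'cV[R]_n.+1 => M i 0) wu; rewrite /w /y !mxE => ->.
  by rewrite mulrA.
Qed.

End gaussian_invariance.

(** * Logistic mixtures *)

Lemma continuous_sumr (R : realType) (T : topologicalType) (I : Type) (r : seq I)
  (P : pred I) (F : I -> T -> R) : (forall i, continuous (F i)) ->
  continuous (fun x => \sum_(i <- r | P i) F i x).
Proof. by move=> cF; apply: continuous_big => //; exact: add_continuous. Qed.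

Lemma continuous_prodr (R : realType) (T : topologicalType) (I : Type) (r : seq I)
  (P : pred I) (F : I -> T -> R) : (forall i, continuous (F i)) ->
  continuous (fun x => \prod_(i <- r | P i) F i x).
Proof. by move=> cF; apply: continuous_big => //; exact: mul_continuous. Qed.

Section logistic.
Context {R : realType}.
Implicit Types t x y : R.
Notation sigmoid := (@sigmoid R).

Definition dsigmoid t := sigmoid t * (1 - sigmoid t).

Let den_gt0 t : 0 < 1 + expR (- t).
Proof. by rewrite addr_gt0 ?expR_gt0. Qed.

Lemma sigmoid_01 t : 0 < sigmoid t < 1.
Proof.
rewrite /sigmoid invr_gt0 den_gt0/= invf_lt1 ?den_gt0//.
by rewrite ltrDl expR_gt0.
Qed.

Lemma sigmoid_le x y : x <= y -> sigmoid x <= sigmoid y.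
Proof.
by move=> xy; rewrite lef_pV2 ?posrE ?den_gt0// lerD2l ler_expR lerN2.
Qed.

Lemma sigmoidN t : sigmoid (- t) = 1 - sigmoid t.
Proof.
rewrite /sigmoid opprK expRN; have e0 := expR_gt0 t.
by field; rewrite !gt_eqF//= ?addr_gt0.
Qed.

Lemma dsigmoid_gt0 t : 0 < dsigmoid t.
Proof. by have /andP[h1 h2] := sigmoid_01 t; rewrite mulr_gt0// subr_gt0. Qed.

Lemma dsigmoid_le1 t : dsigmoid t <= 1.
Proof.
by have /andP[h1 h2] := sigmoid_01 t; rewrite mulr_ile1 ?subr_ge0 ?ltW// gtrBl.
Qed.

Lemma is_derive_sigmoid t : is_derive t 1 sigmoid (dsigmoid t).
Proof.
have d1 : is_derive t 1 (fun y => 1 + expR (- y)) (- expR (- t)).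
  have dE : is_derive t 1 (expR \o -%R) (expR (- t) * - 1).
    exact: is_derive1_comp.
  have := is_deriveD (is_derive_cst (1 : R) t 1) dE.
  by rewrite add0r mulrN1.
have n0 : 1 + expR (- t) != 0 by rewrite gt_eqF.
have := @is_deriveV R (fun y => 1 + expR (- y)) t _ 1 n0 d1.
congr is_derive; rewrite /dsigmoid /sigmoid scalerN/= -scaleNr opprK /GRing.scale/=.
have e0 := den_gt0 t; field; by rewrite gt_eqF.
Qed.

Lemma continuous_sigmoid : continuous sigmoid.
Proof.
move=> t; apply: differentiable_continuous; apply/derivable1_diffP.
by case: (is_derive_sigmoid t).
Qed.

Lemma continuous_dsigmoid : continuous dsigmoid.
Proof.
move=> t; apply: cvgM; first exact: continuous_sigmoid.
by apply: cvgB; [exact: cvg_cst|exact: continuous_sigmoid].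
Qed.

Lemma sigmoid_lipschitz x y : `|sigmoid x - sigmoid y| <= `|x - y|.
Proof.
wlog xy : x y / y < x.
  move=> wl; have [|yx|->] := ltgtP y x; first exact: wl.
    by rewrite distrC (distrC x); exact: wl.
  by rewrite !subrr.
have [c _ ->] := MVT xy (fun t _ => is_derive_sigmoid t)
  (continuous_subspaceT continuous_sigmoid).
rewrite normrM ler_piMl// ger0_norm ?dsigmoid_le1//; exact/ltW/dsigmoid_gt0.
Qed.

(** The difference factors through [sigmoid x - sigmoid y], and the cofactor
    [1 - sigmoid x - sigmoid y] lies between -1 and 1. *)
Lemma dsigmoid_lipschitz x y : `|dsigmoid x - dsigmoid y| <= `|x - y|.
Proof.
have -> : dsigmoid x - dsigmoid y =
    (sigmoid x - sigmoid y) * (1 - sigmoid x - sigmoid y).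
  by rewrite /dsigmoid; ring.
rewrite normrM (le_trans _ (sigmoid_lipschitz x y))// ler_piMr//.
have /andP[x0 x1] := sigmoid_01 x; have /andP[y0 y1] := sigmoid_01 y.
by rewrite ler_norml; apply/andP; split; lra.
Qed.

Lemma sigmoid_tail t : 0 < t -> 1 - sigmoid t <= t^-1.
Proof.
move=> t0; rewrite -sigmoidN /sigmoid opprK lef_pV2 ?posrE ?addr_gt0 ?expR_gt0//.
by have := expR_ge1Dx t; lra.
Qed.

(** By evenness [t > 0] may be assumed; then [dsigmoid t <= 1 - sigmoid t = (1 + expR t)^-1], and
    [expR t = expR (t / 2) ^+ 2 >= t ^+ 2 / 4]. *)
Lemma dsigmoid_tail t : t != 0 -> dsigmoid t <= 4 / t ^+ 2.
Proof.
have E u : dsigmoid (- u) = dsigmoid u.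
  by rewrite /dsigmoid sigmoidN; ring.
wlog t0 : t / 0 < t.
  move=> wl tn0; have [t0|t0|/eqP] := ltgtP t 0; last by rewrite (negbTE tn0).
    by rewrite -E -sqrrN; apply: wl; rewrite ?oppr_eq0// oppr_gt0.
  exact: wl.
move=> _; apply: (@le_trans _ _ (1 - sigmoid t)).
  have /andP[h1 h2] := sigmoid_01 t.
  by rewrite ler_piMl ?subr_ge0// ltW.
rewrite -sigmoidN /sigmoid opprK -[leRHS]invrK lef_pV2 ?posrE ?addr_gt0 ?expR_gt0//;
  last by rewrite invr_gt0 divr_gt0// exprn_gt0.
rewrite invf_div (le_trans _ (_ : expR t <= _))// ?lerDr//.
have : expR t = expR (t / 2) ^+ 2 by rewrite -expRM_natl; congr expR; field.
move=> ->; have h := expR_ge1Dx (t / 2).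
apply: (@le_trans _ _ ((1 + t / 2) ^+ 2)); first by nra.
by rewrite lerXn2r ?nnegrE ?expR_ge0// addr_ge0// divr_ge0// ltW.
Qed.

Definition lmix_cdf N (m s : nat -> R) x : R :=
  N%:R^-1 * \sum_(j < N) sigmoid ((x - m j) / s j).

Definition lmix_pdf N (m s : nat -> R) x : R :=
  N%:R^-1 * \sum_(j < N) (dsigmoid ((x - m j) / s j) / s j).

Lemma smooth_cdf_lmix N (m s : nat -> R) : (0 < N)%N ->
  (forall j, (j < N)%N -> 0 < s j) -> smooth_cdf (lmix_cdf N m s) (lmix_pdf N m s).
Proof.
move=> N0 s0; have N0' : (0 : R) < N%:R by rewrite ltr0n.
have mean_lt (F G : 'I_N -> R) : (forall j, F j < G j) ->
    N%:R^-1 * \sum_j F j < N%:R^-1 * \sum_j G j.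
  move=> FG; rewrite ltr_pM2l ?invr_gt0//; apply: ltr_sum => //.
  by apply/hasP; exists (Ordinal N0) => //; rewrite mem_index_enum.
have mean_cst (c : R) : N%:R^-1 * \sum_(j < N) c = c.
  by rewrite sumr_const card_ord -(mulr_natl c) mulrA mulVf ?mul1r// gt_eqF.
have caff j : continuous (fun x => (x - m j) / s j).
  move=> x; apply: cvgM; last exact: cvg_cst.
  by apply: cvgB; [exact: cvg_id|exact: cvg_cst].
have cont : continuous (lmix_cdf N m s).
  move=> x; apply: cvgM; first exact: cvg_cst.
  apply: (continuous_sumr (F := fun (j : 'I_N) x => sigmoid ((x - m j) / s j))) => j y.
  by apply: (@continuous_comp _ _ _ (fun x => (x - m j) / s j) sigmoid);
    [exact: caff|exact: continuous_sigmoid].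
split.
- move=> x; rewrite /lmix_cdf /lmix_pdf.
  have d1 (j : 'I_N) : is_derive x 1 (fun x => sigmoid ((x - m j) / s j))
      (dsigmoid ((x - m j) / s j) / s j).
    have da : is_derive x 1 (fun x => (x - m j) / s j) (s j)^-1.
      have := is_deriveZ (s j)^-1 (is_deriveB (is_derive_id x 1) (is_derive_cst (m j) x 1)).
      rewrite subr0 /GRing.scale/= mulr1; congr is_derive; apply/funext => y.
      exact: mulrC.
    have := @is_derive1_comp _ sigmoid (fun x => (x - m j) / s j) x _ _ (is_derive_sigmoid _) da.
    by rewrite mulrC.
  have := is_deriveZ (N%:R^-1) (is_derive_sum d1).
  congr is_derive; apply/funext => y.
  by rewrite /GRing.scale/= fct_sumE.
- move=> x; apply: cvgM; first exact: cvg_cst.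
  apply: (continuous_sumr (F := fun (j : 'I_N) x => dsigmoid ((x - m j) / s j) / s j)) => j y.
  apply: cvgM; last exact: cvg_cst.
  by apply: (@continuous_comp _ _ _ (fun x => (x - m j) / s j) dsigmoid);
    [exact: caff|exact: continuous_dsigmoid].
- move=> x; rewrite -[ltLHS](mean_cst 0); apply: mean_lt => j.
  by rewrite divr_gt0 ?dsigmoid_gt0// s0.
- move=> x; apply/andP; split.
    rewrite -[ltLHS](mean_cst 0); apply: mean_lt => j.
    by have /andP[] := sigmoid_01 ((x - m j) / s j).
  rewrite -[ltRHS](mean_cst 1); apply: mean_lt => j.
  by have /andP[] := sigmoid_01 ((x - m j) / s j).
move=> u /andP[u0 u1]; pose l := ln (u / (1 - u)).
have sl : sigmoid l = u.
  rewrite /sigmoid expRN lnK ?posrE ?divr_gt0 ?subr_gt0//.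
  have -> : 1 + (u / (1 - u))^-1 = u^-1; last by rewrite invrK.
  by rewrite invf_div; field; rewrite gt_eqF.
(* Component [j] takes the value [u] at [m j + s j * l]. Hence all components are at most [u] at
   [- b] and at least [u] at [b], and the intermediate value theorem applies to their average. *)
pose b := \sum_(j < N) `|m j + s j * l|.
have bj (j : 'I_N) : `|m j + s j * l| <= b.
  by rewrite /b (bigD1 j)//= lerDl sumr_ge0.
have [|||x _ xE] := @IVT R (lmix_cdf N m s) (- b) b u.
- by rewrite ge0_cp// sumr_ge0.
- exact: continuous_subspaceT.
- rewrite ge_min le_max; apply/andP; split; apply/orP; [left|right].
    rewrite -[leRHS](mean_cst u) ler_wpM2l ?invr_ge0 ?(ltW N0')//; apply: ler_sum => j _.
    rewrite -sl; apply: sigmoid_le; rewrite ler_pdivrMr ?s0//.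
    by have := bj j; rewrite ler_norml => /andP[h1 h2]; lra.
  rewrite -[leLHS](mean_cst u) ler_wpM2l ?invr_ge0 ?(ltW N0')//; apply: ler_sum => j _.
  rewrite -sl; apply: sigmoid_le; rewrite ler_pdivlMr ?s0//.
  by have := bj j; rewrite ler_norml => /andP[h1 h2]; lra.
by exists x.
Qed.

End logistic.

(** * Approximation of densities from below by logistic mixtures *)

Section logistic_approximation.
Context {R : realType}.
Implicit Types x y h d t u e a b : R.
Notation mu := (@lebesgue_measure R).
Notation sigmoid := (@sigmoid R).

Definition logistic_kernel h t : R := dsigmoid (t / h) / h.

Lemma logistic_kernel_ge0 h t : 0 < h -> 0 <= logistic_kernel h t.
Proof. by move=> h0; rewrite divr_ge0 ?ltW ?dsigmoid_gt0. Qed.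

Lemma logistic_kernel_le h t : 0 < h -> logistic_kernel h t <= h^-1.
Proof. by move=> h0; rewrite ler_piMl ?invr_ge0 ?(ltW h0)// dsigmoid_le1. Qed.

Lemma logistic_kernel_lipschitz h t u : 0 < h -> logistic_kernel h t <= logistic_kernel h u + `|t - u| / h ^+ 2.
Proof.
move=> h0; rewrite -lerBlDl -mulrBl expr2 invfM mulrA ler_pM2r ?invr_gt0//.
rewrite (le_trans (ler_norm _))// (le_trans (dsigmoid_lipschitz _ _))//.
by rewrite -mulrBl normrM (gtr0_norm (_ : 0 < h^-1)) ?invr_gt0.
Qed.

Lemma logistic_kernel_tail h t e : 0 < h -> 0 < e -> e <= `|t| -> logistic_kernel h t <= 4 * h / e ^+ 2.
Proof.
move=> h0 e0 et; have t0 : t != 0 by rewrite -normr_gt0 (lt_le_trans e0).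
rewrite /logistic_kernel ler_pdivrMr// (le_trans (dsigmoid_tail _))//.
  by rewrite mulf_neq0// invr_eq0 gt_eqF.
have -> : 4 / (t / h) ^+ 2 = 4 * h / t ^+ 2 * h by field; rewrite t0 gt_eqF.
rewrite ler_pM2r// ler_pM2l ?mulr_gt0//.
rewrite lef_pV2 ?posrE ?(exprn_gt0 _ e0)//; last by rewrite exprn_even_gt0.
by rewrite -[leRHS]real_normK ?num_real// lerXn2r ?nnegrE// ltW.
Qed.

Lemma logistic_kernel_mvt h a b : 0 < h -> a < b -> exists2 c, a <= c <= b &
  sigmoid (b / h) - sigmoid (a / h) = logistic_kernel h c * (b - a).
Proof.
move=> h0 ab.
have abh : a / h < b / h by rewrite ltr_pM2r ?invr_gt0.
have [c] := MVT abh (fun t _ => is_derive_sigmoid t)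
  (continuous_subspaceT continuous_sigmoid).
rewrite in_itv/= ltr_pdivrMr// ltr_pdivlMr// => /andP[ac cb] ->.
exists (c * h); first by rewrite !ltW.
by rewrite /logistic_kernel mulfK ?gt_eqF// -mulrBl mulrA mulrAC.
Qed.

Lemma lmix_pdf_seq (ys : seq R) h x :
  lmix_pdf (size ys) (nth 0 ys) (fun=> h) x =
  (size ys)%:R^-1 * \sum_(y <- ys) logistic_kernel h (x - y).
Proof. by congr (_ * _); rewrite (big_nth 0) big_mkord. Qed.

(** A layer only allows equal weights [1/N], so centre [y l] is repeated [n l] times with [n l] the
    integer part of [N * a l]. Each rounding loses at most [1/N] times a kernel value, and the
    kernel is at most [h^-1]. *)
Lemma lmix_weights M (a y : 'I_M -> R) h (N : nat) : 0 < h -> (0 < N)%N ->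
  (forall l, 0 <= a l) -> \sum_l a l <= 1 ->
  exists m, forall x,
    \sum_l a l * logistic_kernel h (x - y l) - M%:R / (N%:R * h) <= lmix_pdf N m (fun=> h) x.
Proof.
move=> h0 N0 a0 a1; pose n l := Num.truncn (N%:R * a l).
have NR0 : (0 : R) < N%:R by rewrite ltr0n.
have nE l : (n l)%:R <= N%:R * a l < (n l)%:R + 1.
  by rewrite natr1; apply: truncn_itv; rewrite mulr_ge0.
have nN : (\sum_l n l <= N)%N.
  rewrite -(ler_nat R) natr_sum (le_trans (_ : _ <= \sum_l N%:R * a l))//.
    by apply: ler_sum => l _; have /andP[] := nE l.
  by rewrite -mulr_sumr ler_piMr.
pose zs := flatten [seq nseq (n l) (y l) | l <- enum 'I_M].
have szs : size zs = (\sum_l n l)%N.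
  rewrite size_flatten /shape -map_comp sumnE big_map big_enum/=.
  by apply: eq_bigr => l _; rewrite /= size_nseq.
(* The missing copies are centred at 0, where they can only increase the mixture. *)
pose ys := zs ++ nseq (N - \sum_l n l) 0.
have sys : size ys = N by rewrite size_cat size_nseq szs subnKC.
exists (nth 0 ys) => x; rewrite -sys lmix_pdf_seq sys big_cat/=.
rewrite lerBlDr.
have -> : \sum_(z <- zs) logistic_kernel h (x - z) = \sum_l (n l)%:R * logistic_kernel h (x - y l).
  rewrite big_flatten/= big_map big_enum/=; apply: eq_bigr => l _.
  by rewrite mulr_natl; elim: (n l) => [|k IH]; rewrite ?big_nil//= big_cons IH mulrS.
apply: (@le_trans _ _ (N%:R^-1 * \sum_l ((n l)%:R + 1) * logistic_kernel h (x - y l))).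
  rewrite mulr_sumr; apply: ler_sum => l _.
  rewrite [leRHS]mulrA ler_wpM2r ?logistic_kernel_ge0// ler_pdivlMl//.
  by have /andP[_ /ltW] := nE l.
rewrite (eq_bigr (fun l => (n l)%:R * logistic_kernel h (x - y l) + logistic_kernel h (x - y l)));
  last by move=> l _; rewrite mulrDl mul1r.
rewrite big_split/= !mulrDr -addrA lerD2l (le_trans (_ : _ <= M%:R / (N%:R * h)))//.
  rewrite ler_pdivrMl// (_ : N%:R * _ = M%:R * h^-1); last first.
    by field; rewrite !gt_eqF.
  rewrite (le_trans (ler_sum _ (fun l _ => logistic_kernel_le (x - y l) h0)))//.
  by rewrite sumr_const card_ord mulr_natl.
rewrite lerDr mulr_ge0 ?invr_ge0 ?(ltW NR0)// sumr_ge0// => z _; exact: logistic_kernel_ge0.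
Qed.

(** On a cell of length [d] starting at [z], the Lipschitz bound gives [f >= f z - L * d]. This
    lower Riemann estimate bounds the total weight of the mixture built next. *)
Lemma integral_grid_ge (f : R -> R) (L a d : R) m : measurable_fun setT f ->
  (forall x, 0 <= f x) -> (forall x y, f x <= f y + L * `|x - y|) -> 0 <= L -> 0 <= d ->
  ((\sum_(l < m) (d * f (a + l%:R * d) - L * d ^+ 2))%:E <=
   \int[mu]_(x in `]a, (a + m%:R * d)%R]) (f x)%:E)%E.
Proof.
move=> mf f0 fL L0 d0; elim: m => [|m IH].
  by rewrite big_ord0 mul0r addr0 set_itvoc0 integral_set0.
have h1 : a <= a + m%:R * d by rewrite lerDl mulr_ge0.
have h2 : a + m%:R * d <= a + m.+1%:R * d by rewrite lerD2l ler_wpM2r// ler_nat.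
have -> : `]a, a + m.+1%:R * d]%classic =
    `]a, a + m%:R * d]%classic `|` `]a + m%:R * d, a + m.+1%:R * d] :> set R.
  apply/seteqP; split=> x /=; rewrite !in_itv/=.
    by move=> /andP[ax xm]; have [?|?] := leP x (a + m%:R * d); [left|right];
      rewrite ?ax.
  by case=> /andP[ax xm]; [rewrite ax (le_trans xm)|rewrite (le_lt_trans h1 ax)].
rewrite ge0_integral_setU//=; last 3 first.
- by apply: measurable_funTS; exact/measurable_EFinP.
- by move=> x _; rewrite lee_fin.
- apply/disj_setPS => x []; rewrite /= !in_itv/= => /andP[_ h3] /andP[h4 _].
  by move: (le_lt_trans h3 h4); rewrite ltxx.
rewrite big_ord_recr/= EFinD leeD//.
set z := a + m%:R * d.
(* If the constant is not positive, the new summand is at most 0 and nonnegativity of the integral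
   is enough; otherwise nonnegative integrands are compared. *)
have [c0|c0] := leP (f z - L * d) 0.
  apply: (@le_trans _ _ 0%E); last by apply: integral_ge0 => x _; rewrite lee_fin.
  by rewrite lee_fin; nra.
apply: (@le_trans _ _ (\int[mu]_(x in `]z, (a + m.+1%:R * d)%R]) (f z - L * d)%:E)%E).
  rewrite integral_cst//= lebesgue_measure_itv/= lte_fin.
  have E : a + m.+1%:R * d - z = d by rewrite /z -natr1; ring.
  case: ifPn => [_|]; first by rewrite -EFinB E -EFinM lee_fin; nra.
  rewrite -leNgt -subr_le0 E => d0'.
  have -> : d = 0 by apply/eqP; rewrite eq_le d0 d0'.
  by rewrite mule0 mul0r expr0n mulr0 subrr.
apply: ge0_le_integral => //=.
- by move=> x _; rewrite lee_fin ltW.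
- by apply: measurable_funTS; exact/measurable_EFinP.
move=> x; rewrite in_itv/= => /andP[zx xz]; rewrite lee_fin lerBlDr.
rewrite (le_trans (fL z x))// lerD2l ler_wpM2l// ler_norml.
move: zx xz; rewrite /z -natr1 mulrDl mul1r; set w := m%:R * d => zx xz; apply/andP; split; lra.
Qed.

Lemma exists_small (C e : R) : 0 <= C -> 0 < e -> exists2 t : R, 0 < t <= 1 & C * t <= e.
Proof.
move=> C0 e0; exists (Num.min 1 (e / (C + 1))).
  by rewrite lt_min ge_min lexx ltr01/= andbT divr_gt0// ltr_wpDl.
apply: (@le_trans _ _ (C * (e / (C + 1)))).
  by rewrite ler_wpM2l// ge_min lexx orbT.
by rewrite mulrA ler_pdivrMr ?ltr_wpDl//; nra.
Qed.

(** Riemann sums of the convolution of [f] with a narrow logistic kernel. Only a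
    lower bound is claimed, so the weights may be rounded down to multiples of
    [1/N] and the missing mass put anywhere. *)
Lemma lmix_approx (f : R -> R) (F L A e : R) :
  (forall x, 0 <= f x <= F) -> (forall x y, f x <= f y + L * `|x - y|) ->
  measurable_fun setT f -> 0 <= L -> 0 <= A -> 0 < e ->
  (\int[mu]_x (f x)%:E <= 1)%E ->
  exists N m s, [/\ (0 < N)%N, forall j : nat, 0 < s j &
    forall x, `|x| <= A -> f x - e <= lmix_pdf N m s x].
Proof.
move=> f0F fL mf L0 A0 e0 f1.
have F0 : 0 <= F by have /andP[/le_trans h /h] := f0F 0.
have f0 x : 0 <= f x by have /andP[] := f0F x.
have fF x : f x <= F by have /andP[] := f0F x.
(* The margin 1 keeps every [|x| <= A] at distance at least 1 from both ends of the grid on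
   [[- B, B]], so the kernel centred at [x] has mass at most [2 * h] outside it. *)
pose B := A + 1; have B0 : 0 < B by rewrite ltr_wpDl.
have e50 : 0 < e / 5 by rewrite divr_gt0.
(* The parameters are fixed in the order [w], [h], [d], [N], each costing at most [e / 5]. Within
   distance [w] the function varies by at most [L * w]. *)
have [w /andP[w0 w1] we] := exists_small L0 e50.
have w20 : 0 < w ^+ 2 by rewrite exprn_gt0.
(* The term [2 * F] pays for the kernel mass off the grid. The other term pays for centres farther
   than [w] from [x]: the kernel tail gives [16 * h * d / w ^+ 2] per cell, and the cells have total
   length [2 * B]. *)
have [h /andP[h0 h1] he] := @exists_small (2 * F + 32 * F * B / w ^+ 2) (e / 5)
  (addr_ge0 (mulr_ge0 (ler0n _ 2) F0) (divr_ge0 (mulr_ge0 (mulr_ge0 (ler0n _ 32) F0) (ltW B0)) (ltW w20))) e50.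
(* The first term pays for replacing the kernel mass of a cell by [d] times a kernel value, the
   second for the normalisation [c] below. *)
pose C := 2 * B * F / h ^+ 2 + F * (2 * B * L).
have C0 : 0 <= C.
  rewrite addr_ge0//; first by rewrite divr_ge0 ?sqr_ge0// !mulr_ge0// ltW.
  by rewrite !mulr_ge0// ltW.
have [d0 /andP[d00 d01] de] := exists_small C0 e50.
(* Also requiring [d <= w / 2] ensures that a cell with [|x - y l| > w] stays at distance at least
   [w / 2] from [x]. *)
have m0 : 0 < Num.min d0 (w / 2) by rewrite lt_min d00 divr_gt0.
pose M := (Num.truncn (2 * B / Num.min d0 (w / 2))).+1.
have M0 : (0 : R) < M%:R by rewrite ltr0n.
pose d := 2 * B / M%:R.
have dgt0 : 0 < d by rewrite divr_gt0// mulr_gt0.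
have Md : M%:R * d = 2 * B by rewrite mulrC divfK// gt_eqF.
have dm : d <= Num.min d0 (w / 2).
  rewrite ler_pdivrMr// [leRHS]mulrC -ler_pdivrMr// ltW//; exact: truncnS_gt.
have {dm} [dd0 dw] : d <= d0 /\ d <= w / 2 by move: dm; rewrite le_min => /andP.
have {de dd0} de : C * d <= e / 5 by rewrite (le_trans _ de)// ler_wpM2l.
clearbody d; clearbody M.
pose y (l : nat) := - B + l%:R * d.
(* By the grid estimate the Riemann sum of [f] is at most [1 + 2 * B * L * d]; dividing by this
   number makes the total weight at most 1. *)
pose c := 1 + 2 * B * L * d.
have c1 : 1 <= c by rewrite lerDl !mulr_ge0// ltW.
have c0 : 0 < c by rewrite (lt_le_trans ltr01).
pose N := (Num.truncn (M%:R / (h * (e / 5)))).+1.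
have NR0 : (0 : R) < N%:R by rewrite ltr0n.
have Ne : M%:R / (N%:R * h) <= e / 5.
  rewrite ler_pdivrMr ?mulr_gt0// mulrCA -ler_pdivrMr ?mulr_gt0// (mulrC _ h).
  exact/ltW/truncnS_gt.
have a0 (l : 'I_M) : 0 <= d * f (y l) / c by rewrite divr_ge0 ?mulr_ge0// ltW.
have a1 : \sum_(l < M) d * f (y l) / c <= 1.
  rewrite -mulr_suml ler_pdivrMr// mul1r.
  have := integral_grid_ge (- B) M mf f0 fL L0 (ltW dgt0).
  have h2 : (\int[mu]_(x in `](- B)%R, (- B + M%:R * d)%R]) (f x)%:E <= 1)%E.
    apply: le_trans f1; apply: ge0_subset_integral => //.
    - exact/measurable_EFinP.
    - by move=> x _; rewrite lee_fin.
  move=> /le_trans/(_ h2); rewrite lee_fin sumrB sumr_const card_ord lerBlDr.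
  rewrite -mulr_natl (_ : M%:R * (L * d ^+ 2) = 2 * B * L * d)//.
  by rewrite -Md; ring.
have [m mP] := @lmix_weights M _ (fun l => y l) h N h0 isT a0 a1.
exists N, m, (fun=> h); split => // x xA; apply: le_trans (mP x).
(* Exact mass of the kernel on cell [l]; these masses telescope, which gives their sum without any
   estimate of Riemann sums of the kernel. *)
pose D (l : 'I_M) := sigmoid ((x - y l) / h) - sigmoid ((x - y l - d) / h).
have xB : 1 <= x + B /\ x - B <= - 1.
  by move: xA; rewrite /B ler_norml => /andP[]; split; lra.
have sD : 1 - 2 * h <= \sum_l D l <= 1.
  pose g (k : nat) := - sigmoid ((x - y k) / h).
  have -> : \sum_l D l = g M - g 0.
    rewrite -telescope_sumr// big_mkord; apply: eq_bigr => l _.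
    have yS : y l.+1 = y l + d by rewrite /y -natr1; ring.
    by rewrite /D /g yS opprK [RHS]addrC (opprD (y l) d) (addrA x (- y l)).
  rewrite /g /y Md mul0r addr0 opprK.
  have ih1 : 0 < 1 / h by rewrite divr_gt0.
  have t1 := sigmoid_tail ih1.
  rewrite div1r invrK -div1r in t1.
  have smono u v : u <= v -> sigmoid (u / h) <= sigmoid (v / h).
    by move=> uv; apply: sigmoid_le; rewrite ler_wpM2r// invr_ge0 ltW.
  have /smono s1 : 1 <= x - - B by lra.
  have /smono s2 : x - (- B + 2 * B) <= - 1 by lra.
  have s3 : sigmoid (- 1 / h) = 1 - sigmoid (1 / h) by rewrite mulNr sigmoidN.
  have /andP[p1 p2] := sigmoid_01 ((x - - B) / h).
  have /andP[p3 p4] := sigmoid_01 ((x - (- B + 2 * B)) / h).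
  by apply/andP; split; lra.
(* Contribution of one cell. Near [x] the value [f (y l)] is at least [f x - L * w]; far from [x]
   the mass [D l] is itself small, so [F] times its bound covers the loss. *)
have key (l : 'I_M) : (f x - L * w) * D l - F * (16 * h * d / w ^+ 2) -
    F * (d ^+ 2 / h ^+ 2) <= d * f (y l) * logistic_kernel h (x - y l).
  have ll : x - y l - d < x - y l by rewrite gtrBl.
  have [t /andP[t1 t2] tE] := logistic_kernel_mvt h0 ll.
  have DE : D l = logistic_kernel h t * d by rewrite /D tE; congr (_ * _); ring.
  have D0 : 0 <= D l by rewrite DE mulr_ge0 ?logistic_kernel_ge0// ltW.
  have k1 : D l - d ^+ 2 / h ^+ 2 <= d * logistic_kernel h (x - y l).
    rewrite DE lerBlDr (_ : d * _ + _ = (logistic_kernel h (x - y l) + d / h ^+ 2) * d); last by ring.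
    rewrite ler_pM2r// (le_trans (logistic_kernel_lipschitz _ (x - y l) h0))//.
    rewrite lerD2l ler_pM2r ?invr_gt0 ?exprn_gt0// ler_norml.
    by apply/andP; split; lra.
  have k2 : (f x - L * w) * D l - F * (16 * h * d / w ^+ 2) <= f (y l) * D l.
    have [xy|xy] := leP `|x - y l| w.
      have h3 : f x - L * w <= f (y l).
        by rewrite lerBlDr (le_trans (fL x (y l)))// lerD2l ler_wpM2l.
      have h4 : 0 <= F * (16 * h * d / w ^+ 2).
        by rewrite !mulr_ge0 ?invr_ge0// ltW.
      by rewrite lerBlDr ler_wpDr// ler_wpM2r.
    have h5 : logistic_kernel h t <= 4 * h / (w / 2) ^+ 2.
      apply: logistic_kernel_tail => //; first by rewrite divr_gt0.
      have := ler_norm t; have := ler_norm (- t); rewrite normrN => n1 n2.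
      by move: xy; rewrite real_ltr_normr ?num_real// => /orP[] ?; lra.
    have h6 : D l <= 16 * h * d / w ^+ 2.
      rewrite DE (_ : 16 * h * d / w ^+ 2 = 4 * h / (w / 2) ^+ 2 * d).
        by rewrite ler_pM2r.
      by field; rewrite gt_eqF.
    have h7 : (f x - L * w) * D l <= F * D l.
      rewrite ler_wpM2r//; have := fF x; have : 0 <= L * w by rewrite mulr_ge0// ltW.
      lra.
    have h8 : F * D l <= F * (16 * h * d / w ^+ 2) by rewrite ler_wpM2l.
    have h9 : 0 <= f (y l) * D l by rewrite mulr_ge0.
    lra.
  have k3 : f (y l) * (D l - d ^+ 2 / h ^+ 2) <= f (y l) * (d * logistic_kernel h (x - y l)).
    by rewrite ler_wpM2l.
  have k4 : f (y l) * (d ^+ 2 / h ^+ 2) <= F * (d ^+ 2 / h ^+ 2).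
    by rewrite ler_wpM2r// divr_ge0 ?sqr_ge0.
  rewrite mulrBr in k3.
  have -> : d * f (y l) * logistic_kernel h (x - y l) = f (y l) * (d * logistic_kernel h (x - y l)) by ring.
  lra.
pose S := \sum_(l < M) d * f (y l) * logistic_kernel h (x - y l).
have SE : \sum_(l < M) d * f (y l) / c * logistic_kernel h (x - y l) = S / c.
  by rewrite /S mulr_suml; apply: eq_bigr => l _; rewrite mulrAC.
rewrite SE.
have S1 : (f x - L * w) * \sum_l D l - 32 * F * B / w ^+ 2 * h - 2 * B * F / h ^+ 2 * d <= S.
  apply: (@le_trans _ _ (\sum_l ((f x - L * w) * D l - F * (16 * h * d / w ^+ 2) -
    F * (d ^+ 2 / h ^+ 2)))); last by apply: ler_sum => l _; exact: key.
  have E1 : (F * (16 * h * d / w ^+ 2)) *+ M = 32 * F * B / w ^+ 2 * h.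
    rewrite -mulr_natr (_ : _ * M%:R = F * (16 * h / w ^+ 2) * (M%:R * d)); last by ring.
    by rewrite Md; ring.
  have E2 : (F * (d ^+ 2 / h ^+ 2)) *+ M = 2 * B * F / h ^+ 2 * d.
    rewrite -mulr_natr (_ : _ * M%:R = F * (d / h ^+ 2) * (M%:R * d)); last by ring.
    by rewrite Md; ring.
  by rewrite !sumrB -mulr_sumr !sumr_const card_ord E1 E2 -sumrB.
have S2 : f x - L * w - 2 * F * h <= (f x - L * w) * \sum_l D l.
  move/andP: sD => [sD1 sD2].
  have q1 : f x * (1 - 2 * h) <= f x * \sum_l D l by rewrite ler_wpM2l.
  have q2 : L * w * \sum_l D l <= L * w by rewrite ler_piMr// mulr_ge0// ltW.
  have q3 : f x * (2 * h) <= F * (2 * h) by rewrite ler_wpM2r// mulr_ge0// ltW.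
  lra.
pose E := L * w + 2 * F * h + 32 * F * B / w ^+ 2 * h + 2 * B * F / h ^+ 2 * d.
have S3 : f x - E <= S by rewrite /E; lra.
have E0 : 0 <= E.
  rewrite /E !addr_ge0//; first by rewrite mulr_ge0// ltW.
  - by rewrite !mulr_ge0// ltW.
  - by rewrite !mulr_ge0 ?invr_ge0// ltW.
  - by rewrite !mulr_ge0 ?invr_ge0 ?sqr_ge0// ltW.
have S4 : f x - E - F * (c - 1) <= S / c.
  rewrite ler_pdivlMr// (le_trans _ S3)//.
  have q1 : (c - 1) * (f x - E) <= (c - 1) * (F * c).
    rewrite ler_wpM2l ?subr_ge0//.
    have : F <= F * c by rewrite ler_peMr.
    have := fF x; lra.
  by nra.
have E4 : E + F * (c - 1) <= 3 * (e / 5).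
  have -> : E + F * (c - 1) = L * w + (2 * F + 32 * F * B / w ^+ 2) * h + C * d.
    by rewrite /E /c /C; ring.
  lra.
lra.
Qed.

End logistic_approximation.

Section log_approximation.
Context {R : realType}.
Notation phi := (@normal_pdf R 0 1).
Notation mu := (@lebesgue_measure R).

(** The class of test functions on the line: it gives [expR h * phi] an explicit Lipschitz constant,
    as [lmix_approx] requires, and it contains the cosines and cut-offs that Cramer-Wold uses. *)
Definition bounded_lipschitz (h : R -> R) :=
  exists M L, [/\ 0 <= L, forall x, `|h x| <= M & forall x y, `|h x - h y| <= L * `|x - y|].

Lemma bounded_lipschitz_continuous h : bounded_lipschitz h -> continuous h.
Proof.
move=> [M [L [L0 _ hL]]] x; apply/cvgrPdist_lt => e e0.
have d0 : 0 < e / (L + 1) by rewrite divr_gt0// ltr_wpDl.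
near=> y; rewrite (le_lt_trans (hL x y))//.
have : `|x - y| < e / (L + 1) by near: y; apply: cvgr_dist_lt.
rewrite ltr_pdivlMr ?ltr_wpDl//; apply: le_lt_trans.
by rewrite mulrC ler_wpM2l// lerDl.
Unshelve. all: by end_near. Qed.

Lemma expR_lipschitz (M a b : R) : a <= M -> b <= M ->
  expR a - expR b <= expR M * `|a - b|.
Proof.
move=> aM bM; have [ab|ba] := leP a b.
  by rewrite (@le_trans _ _ 0) ?mulr_ge0 ?expR_ge0// subr_le0 ler_expR.
have [c] := MVT ba (fun t _ => is_derive_expR t)
  (continuous_subspaceT (@continuous_expR R)).
rewrite in_itv/= => /andP[_ ca] ->; rewrite gtr0_norm ?subr_gt0//.
by rewrite ler_pM2r ?subr_gt0// ler_expR ltW// (lt_le_trans ca).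
Qed.


(** The derivative of [expR (- t ^+ 2 / 2)] is bounded by 1 because [|t| <= 1 + t ^+ 2 / 2 <= expR
    (t ^+ 2 / 2)]. *)
Lemma normal_pdf_lipschitz (x y : R) :
  phi x - phi y <= normal_peak 1 * `|x - y|.
Proof.
have dphi (t : R) : is_derive t 1 (fun t : R => expR (- t ^+ 2 / 2)) (- t * expR (- t ^+ 2 / 2)).
  have d1 : is_derive t 1 (fun t : R => - t ^+ 2 / 2) (- t).
    have := is_deriveZ (- (2^-1)) (is_deriveX 2 (is_derive_id t (1 : R))).
    congr is_derive.
      apply/funext => z; rewrite !fctE -[LHS]/(- 2^-1 * (z : R) ^+ 2).
      by rewrite mulNr mulrC -mulNr.
    by rewrite -[LHS]/(- 2^-1 * ((2 * t ^+ 1) * 1)) expr1 mulr1 mulNr mulKf ?pnatr_eq0.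
  have := @is_derive1_comp R expR (fun t : R => - t ^+ 2 / 2) t _ _
    (is_derive_expR (- t ^+ 2 / 2)) d1.
  by rewrite mulrC.
have d_le1 (t : R) : `|- t * expR (- t ^+ 2 / 2)| <= 1.
  rewrite normrM normrN (ger0_norm (expR_ge0 _)) mulNr expRN ler_pdivrMr ?expR_gt0//.
  rewrite mul1r (le_trans _ (expR_ge1Dx _))//.
  by rewrite -[t ^+ 2]real_normK ?num_real//; have := sqr_ge0 (`|t| - 1); nra.
have key (u v : R) : u < v -> `|expR (- v ^+ 2 / 2) - expR (- u ^+ 2 / 2)| <= v - u.
  move=> uv; have [|c _ ->] := MVT uv (fun t _ => dphi t).
    apply: continuous_subspaceT => t; apply: differentiable_continuous.
    by apply/derivable1_diffP; case: (dphi t).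
  by rewrite normrM (gtr0_norm (_ : 0 < v - u)) ?subr_gt0// ler_piMl// subr_ge0 ltW.
rewrite normal_pdfE ?oner_eq0// /normal_fun !subr0 expr1n -mulrBr.
rewrite ler_wpM2l ?normal_peak_ge0// (le_trans (ler_norm _))//.
have [xy|yx|->] := ltgtP x y; last by rewrite !subrr normr0.
  by rewrite distrC (distrC x) (gtr0_norm (_ : 0 < y - x)) ?subr_gt0//; exact: key.
by rewrite (gtr0_norm (_ : 0 < x - y)) ?subr_gt0//; exact: key.
Qed.

(** On [[- A, A]] the target [expR h * phi] is at least some [c > 0], so the additive error
    [c * (1 - expR (- e))] is at most a loss by the factor [expR (- e)], which the logarithm turns
    into [- e]. *)
Lemma lmix_log_approx (h : R -> R) (A e : R) : bounded_lipschitz h ->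
  (\int[mu]_x (expR (h x) * phi x)%:E <= 1)%E -> 0 <= A -> 0 < e ->
  exists N m s, [/\ (0 < N)%N, forall j : nat, 0 < s j &
    forall x, `|x| <= A -> h x - e <= ln (lmix_pdf N m s x / phi x)].
Proof.
move=> blh h1 A0 e0; have ch := bounded_lipschitz_continuous blh.
have [M [L [L0 hM hL]]] := blh.
have p0 : 0 < normal_peak (1 : R) by rewrite normal_peak_gt0 ?oner_eq0.
pose K := normal_peak (1 : R).
have phiK x : 0 <= phi x <= K by rewrite normal_pdf_ge0 normal_pdf_ub ?oner_eq0.
have hM' x : h x <= M by rewrite (le_trans (ler_norm _)).
have hMN x : - M <= h x by have := hM x; rewrite ler_norml => /andP[].
pose f x := expR (h x) * phi x.
have f0 x : 0 <= f x <= expR M * K.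
  have /andP[k0 k1] := phiK x.
  by rewrite mulr_ge0 ?expR_ge0//= ler_pM ?expR_ge0// ler_expR.
have fL x y : f x <= f y + (expR M * L * K + expR M * K) * `|x - y|.
  have -> : f x = f y + ((expR (h x) - expR (h y)) * phi x + expR (h y) * (phi x - phi y)).
    by rewrite /f; ring.
  have /andP[k0 k1] := phiK x.
  rewrite lerD2l [leRHS]mulrDl lerD//.
    have q : expR (h x) - expR (h y) <= expR M * L * `|x - y|.
      rewrite (le_trans (expR_lipschitz (hM' x) (hM' y)))// -mulrA.
      by rewrite ler_wpM2l ?expR_ge0.
    apply: (@le_trans _ _ (expR M * L * `|x - y| * phi x)); first by rewrite ler_wpM2r.
    by rewrite [leRHS]mulrAC ler_wpM2l ?mulr_ge0 ?expR_ge0.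
  apply: (@le_trans _ _ (expR (h y) * (K * `|x - y|))).
    by rewrite ler_wpM2l ?expR_ge0// normal_pdf_lipschitz.
  by rewrite -mulrA ler_wpM2r ?mulr_ge0// ?(ltW p0)// ler_expR.
have mf : measurable_fun setT f.
  apply: continuous_measurable_fun => x; apply: cvgM.
    by apply: (@continuous_comp _ _ _ h expR); [exact: ch|exact: continuous_expR].
  by apply: continuous_normal_pdf; rewrite oner_eq0.
pose c := expR (- M) * (K * expR (- A ^+ 2 / 2)).
have c0 : 0 < c by rewrite !mulr_gt0 ?expR_gt0.
have cf x : `|x| <= A -> c <= f x.
  move=> xA; rewrite ler_pM ?expR_ge0 ?mulr_ge0 ?expR_ge0 ?(ltW p0)// ?ler_expR//.
  rewrite normal_pdfE ?oner_eq0// ler_pM2l// ler_expR subr0 expr1n.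
  rewrite ler_pM2r ?invr_gt0// lerN2 -[leLHS]real_normK ?num_real//.
  by rewrite lerXn2r ?nnegrE.
have eV1 : expR (- e) < 1 by rewrite -[ltRHS]expR0 ltr_expR oppr_lt0.
have e'0 : 0 < c * (1 - expR (- e)) by rewrite mulr_gt0// subr_gt0.
have L'0 : 0 <= expR M * L * K + expR M * K.
  by rewrite addr_ge0 ?mulr_ge0 ?expR_ge0// ltW.
have [N [m [s [N0 s0 qP]]]] := lmix_approx f0 fL mf L'0 A0 e'0 h1.
exists N, m, s; split=> // x xA.
have fx0 : 0 < f x by rewrite (lt_le_trans c0) ?cf.
have q1 : expR (- e) * f x <= lmix_pdf N m s x.
  have := qP x xA; have := cf x xA => w1; apply: le_trans.
  have : c * (1 - expR (- e)) <= f x * (1 - expR (- e)).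
    by rewrite ler_wpM2r// subr_ge0 ltW.
  by lra.
have q2 : expR (h x - e) <= lmix_pdf N m s x / phi x.
  rewrite ler_pdivlMr ?phi_gt0// (le_trans _ q1)//.
  by rewrite expRD /f mulrA (mulrC (expR (- e))).
rewrite -(expRK (h x - e)) ler_ln ?posrE ?expR_gt0//.
by rewrite (lt_le_trans (expR_gt0 _) q2).
Qed.

End log_approximation.

(** * Entropy descent *)

Section continuity.
Context {R : realType} {T : topologicalType}.
Implicit Types f g : T -> R.

Lemma continuous_mulr f g : continuous f -> continuous g ->
  continuous (fun x => f x * g x).
Proof. by move=> cf cg x; apply: cvgM; [exact: cf|exact: cg]. Qed.

Lemma continuous_addr f g : continuous f -> continuous g ->
  continuous (fun x => f x + g x).
Proof. by move=> cf cg x; apply: cvgD; [exact: cf|exact: cg]. Qed.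

Lemma continuous_cstr (c : R) : continuous (fun _ : T => c).
Proof. by move=> x; exact: cvg_cst. Qed.

Lemma continuous_compr f (h : R -> R) : continuous f ->
  (forall x, {for f x, continuous h}) -> continuous (fun x => h (f x)).
Proof. by move=> cf ch x; exact: (continuous_comp (cf x) (ch x)). Qed.

End continuity.

Lemma compact_continuous_bounded (R : realType) (n : nat) (X : set 'cV[R]_n)
  (g : 'cV[R]_n -> R) : compact X -> {within X, continuous g} ->
  exists2 M, 0 <= M & forall x, X x -> `|g x| <= M.
Proof.
move=> cX cg; have /compact_bounded[M [_ MP]] := continuous_compact cg cX.
exists (`|M| + 1) => [|x Xx]; first by rewrite addr_ge0.
apply: (MP (`|M| + 1)); last by exists x.
by rewrite (le_lt_trans (ler_norm _))// ltrDl.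
Qed.

Lemma continuous_cV (R : realType) (T : topologicalType) n (F : T -> 'cV[R]_n) :
  (forall i, continuous (fun x => F x i 0)) -> continuous F.
Proof.
move=> cF x A [P nP PA]; apply: filterS PA _.
have : \forall y \near x, forall i : 'I_n, P i 0 (F y i 0).
  by apply: filter_forall => i; exact: (cF i x _ (nP i 0)).
by apply: filterS => y Py i j; rewrite (ord1 j).
Qed.

Lemma coord_cV_continuous (R : realType) n (i : 'I_n) :
  continuous (fun v : 'cV[R]_n => v i 0).
Proof. exact: coord_continuous. Qed.

Lemma mulmx_cV_continuous (R : realType) m n (Q : 'M[R]_(m, n)) :
  continuous (fun v : 'cV[R]_n => Q *m v).
Proof.
apply: continuous_cV => i; under eq_fun do rewrite mxE.
apply: (continuous_sumr (F := fun j (v : 'cV[R]_n) => Q i j * v j 0)) => j.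
by apply: continuous_mulr; [exact: continuous_cstr|exact: coord_cV_continuous].
Qed.

(** A step is stored as parameters, not as a map, so that its mixture densities, and with them its
    gain, can be computed from it. *)
Record gauss_step (R : realType) (D : nat) := GaussStep {
  step_rot : 'M[R]_D;
  step_size : 'I_D -> nat;
  step_loc : 'I_D -> nat -> R;
  step_scale : 'I_D -> nat -> R }.

Section gaussianization_step.
Context {R : realType} {D : nat}.
Notation phi := (@normal_pdf R 0 1).
Implicit Types (st : gauss_step R D) (v : 'cV[R]_D).

Definition step_cdf st i := lmix_cdf (step_size st i) (step_loc st i) (step_scale st i).
Definition step_pdf st i := lmix_pdf (step_size st i) (step_loc st i) (step_scale st i).

Definition step_layer st v : 'cV[R]_D := \col_i Phiinv (step_cdf st i (v i 0)).

Definition step_map st v := step_layer st (step_rot st *m v).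

Definition valid_step st := [/\ orthogonal_mx (step_rot st),
  gauss_invariant (step_rot st), forall i, (0 < step_size st i)%N &
  forall i j, 0 < step_scale st i j].

(** Its mean is the decrease of the relative entropy in one step. *)
Definition step_logratio st v := \sum_i ln (step_pdf st i (v i 0) / phi (v i 0)).

Lemma valid_step_cdf st i : valid_step st -> smooth_cdf (step_cdf st i) (step_pdf st i).
Proof. by move=> [_ _ N0 s0]; exact: smooth_cdf_lmix. Qed.

Lemma step_layerP st : valid_step st -> marginal_gaussianization_layer (step_layer st).
Proof.
move=> [_ _ N0 s0] i; exists (step_size st i); split => //.
exists (step_loc st i), (step_scale st i); split=> [j _|x]; first exact: s0.
by rewrite mxE.
Qed.

Lemma step_layer_continuous st : valid_step st -> continuous (step_layer st).
Proof.
move=> vst; apply: continuous_cV => i; under eq_fun do rewrite mxE.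
apply: (continuous_compr (h := fun x => Phiinv (step_cdf st i x))).
  exact: coord_cV_continuous.
by move=> v; exact: gaussianize_continuous (valid_step_cdf i vst) _.
Qed.

Lemma step_map_continuous st : valid_step st -> continuous (step_map st).
Proof.
move=> vst v; apply: (@continuous_comp _ _ _ (mulmx (step_rot st)) (step_layer st)).
  exact: mulmx_cV_continuous.
exact: step_layer_continuous.
Qed.

Lemma step_ratio_gt0 st i x : valid_step st -> 0 < step_pdf st i x / phi x.
Proof.
by move=> /(valid_step_cdf i)[_ _ q0 _ _]; rewrite divr_gt0 ?phi_gt0.
Qed.

Lemma step_ratio_continuous st i : valid_step st ->
  continuous (fun v : 'cV[R]_D => step_pdf st i (v i 0) / phi (v i 0)).
Proof.
move=> vst; have [_ cq _ _ _] := valid_step_cdf i vst.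
apply: (continuous_compr (h := fun x => step_pdf st i x / phi x)).
  exact: coord_cV_continuous.
move=> v; apply: cvgM; first exact: cq.
apply: cvgV; first by rewrite gt_eqF ?phi_gt0.
by apply: continuous_normal_pdf; rewrite oner_eq0.
Qed.

Lemma step_logratio_continuous st : valid_step st -> continuous (step_logratio st).
Proof.
move=> vst; apply: continuous_sumr => i.
apply: (continuous_compr (h := @ln R)); first exact: step_ratio_continuous.
by move=> v; apply: continuous_ln; exact: step_ratio_gt0.
Qed.

(** Invariance removes the rotation. Then [expR] of the log-ratio times the Gaussian density is the
    product of the mixture densities, which is the weight of the coordinatewise substitution. *)
Lemma gauss_step_density st (w : 'cV[R]_D -> R) : valid_step st -> continuous w ->
  (forall v, 0 <= w v) ->
  intRD (fun v => (w (step_map st v) * expR (step_logratio st (step_rot st *m v)) *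
    std_gauss_density v)%:E) =
  intRD (fun v => (w v * std_gauss_density v)%:E).
Proof.
move=> vst cw w0; have [_ iQ _ _] := vst.
pose f v := (w (step_layer st v) * expR (step_logratio st v))%:E.
have mf : vec_measurable f.
  apply: continuous_vec_measurable; apply: continuous_mulr => [v|].
    by apply: (@continuous_comp _ _ _ (step_layer st) w); [exact: step_layer_continuous|exact: cw].
  apply: (continuous_compr (h := expR)); first exact: step_logratio_continuous.
  by move=> v; exact: continuous_expR.
have f0 v : (0 <= f v)%E by rewrite lee_fin mulr_ge0 ?expR_ge0.
transitivity (intRD (fun v => f (step_rot st *m v) * (std_gauss_density v)%:E)%E).
  by apply: eq_intRD => v; rewrite -EFinM.
rewrite iQ//.
have mw : vec_measurable (EFin \o w) by exact: continuous_vec_measurable.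
transitivity (intRD (fun v => (EFin \o w) v * (std_gauss_density v)%:E)%E); last first.
  by apply: eq_intRD => v; rewrite -EFinM.
rewrite -(intRD_gaussianize (fun i => valid_step_cdf i vst) mw); last first.
  by move=> v; rewrite lee_fin.
apply: eq_intRD => v; rewrite /f -!EFinM; congr EFin; rewrite -mulrA; congr (_ * _).
rewrite /step_logratio expR_sum -big_split/=; apply: eq_bigr => i _.
by rewrite lnK ?posrE ?step_ratio_gt0// divfK// gt_eqF ?phi_gt0.
Qed.

End gaussianization_step.

Section entropy_descent.
Context {R : realType} {D : nat}.
Notation phi := (@normal_pdf R 0 1).
Implicit Types (st : gauss_step R D) (F : 'cV[R]_D -> 'cV[R]_D).

(** Expectation under the initial law, reduced to what the descent uses. Monotonicity only compares
    values on [X], so that approximations on compact images of [X] may be inserted under [E]. *)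
Definition mean_functional (X : set 'cV[R]_D) (E : ('cV[R]_D -> R) -> R) :=
  [/\ forall f g : 'cV[R]_D -> R, continuous f -> continuous g -> E (fun x => f x + g x) = E f + E g,
      forall (a : R) (f : 'cV[R]_D -> R), continuous f -> E (fun x => a * f x) = a * E f,
      forall f g : 'cV[R]_D -> R, continuous f -> continuous g ->
        (forall x, X x -> f x <= g x) -> E f <= E g
    & E (fun=> 1) = 1].

Variables (X : set 'cV[R]_D) (E : ('cV[R]_D -> R) -> R) (C : R).
Hypotheses (cX : compact X) (mE : mean_functional X E) (C0 : 0 < C).
Hypothesis EC : forall w : 'cV[R]_D -> R, continuous w -> (forall v, 0 <= w v) ->
  (intRD (fun v => (w v * std_gauss_density v)%:E) <= 1)%E -> E w <= C.

Lemma mean_cst (c : R) : E (fun=> c) = c.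
Proof.
case: mE => _ EZ _ E1; transitivity (E (fun=> c * 1)); first by rewrite mulr1.
by rewrite EZ ?E1 ?mulr1//; exact: continuous_cstr.
Qed.

Let continuous_ln_comp (w : 'cV[R]_D -> R) F : continuous w -> continuous F ->
  (forall v, 0 < w v) -> continuous (fun x => ln (w (F x))).
Proof.
move=> cw cF w0; apply: (continuous_compr (h := @ln R)); last first.
  by move=> x; exact: continuous_ln.
by move=> x; apply: (@continuous_comp _ _ _ F w); [exact: cF|exact: cw].
Qed.

(** Donsker-Varadhan form of "the relative entropy of the image by [F] with
    respect to the standard Gaussian is at most [B]". *)
Definition entropy_le F B := forall w : 'cV[R]_D -> R, continuous w ->
  (forall v, 0 < w v) -> (intRD (fun v => (w v * std_gauss_density v)%:E) <= 1)%E ->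
  E (fun x => ln (w (F x))) <= B.

Definition step_gain F st := E (fun x => step_logratio st (step_rot st *m F x)).

Lemma entropy_le_ge0 F B : entropy_le F B -> 0 <= B.
Proof.
move=> /(_ (fun=> 1)); rewrite ln1 mean_cst; apply => //.
  exact: continuous_cstr.
by under eq_intRD do rewrite mul1r; rewrite intRD_gdens.
Qed.

(** From [ln u <= u - 1] at [u = w / C], since [w / C] has mean at most 1 by [EC]. *)
Lemma entropy_le_id : entropy_le id (ln C).
Proof.
move=> w cw w0 w1; case: mE => ED EZ EM _.
have w0' v : 0 <= w v by exact: ltW.
apply: (@le_trans _ _ (E (fun x => (ln C - 1) + C^-1 * w x))).
  apply: EM.
  - by apply: (continuous_ln_comp (F := id)) => // x.
  - apply: continuous_addr; first exact: continuous_cstr.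
    by apply: continuous_mulr => //; exact: continuous_cstr.
  move=> x _; have wC : 0 < w x / C by rewrite divr_gt0.
  have : ln (1 + (w x / C - 1)) <= w x / C - 1 by apply: le_ln1Dx; lra.
  rewrite addrC subrK ln_div ?posrE// lerBlDr => /le_trans; apply.
  by rewrite mulrC; lra.
rewrite ED ?EZ ?mean_cst//; last 2 first.
- exact: continuous_cstr.
- by apply: continuous_mulr => //; exact: continuous_cstr.
have : C^-1 * E w <= 1 by rewrite ler_pdivrMl// mulr1; exact: EC.
by lra.
Qed.

Lemma step_gain_continuous F st : continuous F -> valid_step st ->
  continuous (fun x => step_logratio st (step_rot st *m F x)).
Proof.
move=> cF vst x.
apply: (@continuous_comp _ _ _ F (fun v => step_logratio st (step_rot st *m v))).
  exact: cF.
apply: (@continuous_comp _ _ _ (mulmx (step_rot st)) (step_logratio st)).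
  exact: mulmx_cV_continuous.
exact: step_logratio_continuous.
Qed.

Lemma entropy_le_step F B st : continuous F -> valid_step st -> entropy_le F B ->
  entropy_le (step_map st \o F) (B - step_gain F st).
Proof.
move=> cF vst FB w cw w0 w1; case: mE => ED _ _ _.
pose w' v := w (step_map st v) * expR (step_logratio st (step_rot st *m v)).
have cw' : continuous w'.
  apply: continuous_mulr => [x|].
    by apply: (@continuous_comp _ _ _ (step_map st) w); [exact: step_map_continuous|exact: cw].
  apply: (continuous_compr (h := expR)); last by move=> x; exact: continuous_expR.
  by apply: (step_gain_continuous (F := id)) => // x.
have w'0 v : 0 < w' v by rewrite mulr_gt0 ?expR_gt0.
have := FB w' cw' w'0; rewrite gauss_step_density//; last by move=> v; exact: ltW.
move=> /(_ w1); rewrite lerBrDr; apply: le_trans.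
rewrite -ED; last 2 first.
- apply: (continuous_ln_comp (F := step_map st \o F)) => // x.
  by apply: (@continuous_comp _ _ _ F (step_map st)); [exact: cF|exact: step_map_continuous].
- exact: step_gain_continuous.
under [in leRHS]eq_fun do rewrite lnM ?posrE ?expR_gt0// expRK.
by [].
Qed.

Lemma step_gain_le F B st : continuous F -> valid_step st -> entropy_le F B ->
  step_gain F st <= B.
Proof.
by move=> cF vst /(entropy_le_step cF vst)/entropy_le_ge0; rewrite subr_ge0.
Qed.

(** Each coordinate of [Q *m F x] is bounded on the compact set [X], so a mixture whose log-ratio is
    at least [h i] up to a small error is only required on a bounded interval, which may depend on
    [F]. *)
Lemma exists_gain_ge F (Q : 'M[R]_D) (h : 'I_D -> R -> R) e : continuous F ->
  orthogonal_mx Q -> gauss_invariant Q -> (forall i, bounded_lipschitz (h i)) ->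
  (forall i, \int[lebesgue_measure]_x (expR (h i x) * phi x)%:E <= 1)%E ->
  0 < e ->
  exists2 st, valid_step st &
    E (fun x => \sum_i h i ((Q *m F x) i 0)) - e <= step_gain F st.
Proof.
move=> cF oQ iQ bh h1 e0; case: mE => ED EZ EM _.
have cQF i : continuous (fun x => (Q *m F x) i 0).
  move=> x; apply: (@continuous_comp _ _ _ F (fun v => (Q *m v) i 0)); first exact: cF.
  apply: (@continuous_comp _ _ _ (mulmx Q) (fun v : 'cV[R]_D => v i 0)).
    exact: mulmx_cV_continuous.
  exact: coord_cV_continuous.
(* The error is shared among the [D] coordinates; [D.+1] avoids division by zero when [D] is 0. *)
pose d := e / D.+1%:R; have d0 : 0 < d by rewrite divr_gt0.
have /choice[p pP] : forall i, exists p : nat * (nat -> R) * (nat -> R),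
    [/\ (0 < p.1.1)%N, forall j, 0 < p.2 j & forall x, X x ->
      h i ((Q *m F x) i 0) - d <=
      ln (lmix_pdf p.1.1 p.1.2 p.2 ((Q *m F x) i 0) / phi ((Q *m F x) i 0))].
  move=> i.
  have [A A0 AP] := compact_continuous_bounded cX (continuous_subspaceT (cQF i)).
  have [N [m [s [N0 s0 q]]]] := lmix_log_approx (bh i) (h1 i) A0 d0.
  by exists (N, m, s); split => // x /AP /q.
pose st := GaussStep Q (fun i => (p i).1.1) (fun i => (p i).1.2) (fun i => (p i).2).
have vst : valid_step st by split=> // i; case: (pP i).
exists st => //.
have ch : continuous (fun x => \sum_i h i ((Q *m F x) i 0)).
  apply: continuous_sumr => i; apply: (continuous_compr (h := h i)) => // x.
  exact: bounded_lipschitz_continuous.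
have -> : E (fun x => \sum_i h i ((Q *m F x) i 0)) - e =
    E (fun x => \sum_i h i ((Q *m F x) i 0) + - e).
  by rewrite ED// ?mean_cst//; exact: continuous_cstr.
apply: EM.
- by apply: continuous_addr => //; exact: continuous_cstr.
- exact: step_gain_continuous.
move=> x Xx; apply: (@le_trans _ _ (\sum_i (h i ((Q *m F x) i 0) - d))).
  rewrite sumrB lerD2l lerN2 sumr_const card_ord -mulr_natr /d.
  by rewrite mulrAC ler_pdivrMr ?ltr0n// ler_wpM2l ?(ltW e0)// ler_nat.
by apply: ler_sum => i _; case: (pP i) => _ _; exact.
Qed.

Lemma bounded_lipschitz_cst (c : R) : bounded_lipschitz (fun=> c).
Proof.
exists `|c|, 0; split=> // x y; by rewrite subrr normr0 mul0r.
Qed.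

Lemma gauss_invariant1 : gauss_invariant (1%:M : 'M[R]_D).
Proof. by move=> f mf f0; apply: eq_intRD => v; rewrite mul1mx. Qed.

(** Mixtures close to [phi] itself, that is [h = 0]: a step can always be chosen that costs almost
    nothing. *)
Lemma exists_gain_ge0 F e : continuous F -> 0 < e ->
  exists2 st, valid_step st & - e <= step_gain F st.
Proof.
move=> cF e0.
have o1 : orthogonal_mx (1%:M : 'M[R]_D) by rewrite /orthogonal_mx trmx1 mulmx1.
have h1 (i : 'I_D) : (\int[lebesgue_measure]_x (expR 0 * phi x)%:E <= 1)%E.
  by under eq_integral do rewrite expR0 mul1r; rewrite integral_normal_pdf.
have [st vst] := exists_gain_ge cF o1 gauss_invariant1
  (fun=> bounded_lipschitz_cst 0) h1 e0.
under eq_fun do rewrite big1//.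
by rewrite mean_cst add0r; exists st.
Qed.

(** All gains are at most [B], so they have a finite supremum; it may not be attained, hence the
    slack [e]. *)
Lemma exists_near_optimal_step F B e : continuous F -> entropy_le F B -> 0 < e ->
  exists2 st, valid_step st & forall st', valid_step st' ->
    step_gain F st' <= step_gain F st + e.
Proof.
move=> cF FB e0; pose S := [set step_gain F st | st in [set st | valid_step st]].
have hS : has_sup S.
  split; first by have [st vst _] := exists_gain_ge0 cF ltr01; exists (step_gain F st), st.
  by exists B => _ [st vst <-]; exact: step_gain_le.
have [_ [st vst <-] stP] := sup_adherent e0 hS.
exists st => // st' vst'; rewrite -lerBlDr (le_trans _ (ltW stP))// lerD2r.
by apply: ub_le_sup; [exact: hS.2|exists st'].
Qed.

(** With tolerance [2^-k] at stage [k], the chosen gains [a k] sum to at most [ln C], because the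
    entropy bound stays nonnegative. So [a k + 2^-k], which bounds every gain at stage [k], is
    nonnegative and summable, and tends to 0. *)
Lemma exists_descent : exists st : nat -> gauss_step R D,
  let F k := flow (fun k => step_layer (st k)) (fun k => step_rot (st k)) k in
  [/\ forall k, valid_step (st k), forall k, continuous (F k) &
    forall e, 0 < e -> \forall k \near \oo,
      forall st', valid_step st' -> step_gain (F k) st' <= e].
Proof.
(* The choice is made once for all pairs of a map and a stage, its hypotheses kept as premises, so
   that the iterates can then be defined by plain recursion. *)
have /choice[pick pickP] : forall Fk : ('cV[R]_D -> 'cV[R]_D) * nat, exists st,
    continuous Fk.1 -> (exists B, entropy_le Fk.1 B) -> valid_step st /\
    forall st', valid_step st' -> step_gain Fk.1 st' <= step_gain Fk.1 st + 2^-1 ^+ Fk.2.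
  move=> [F k] /=; have [[cF [B FB]]|nF] := pselect (continuous F /\ exists B, entropy_le F B).
    have [|st vst stP] := @exists_near_optimal_step F B (2^-1 ^+ k) cF FB.
      by rewrite exprn_gt0// invr_gt0.
    by exists st.
  (* Dummy value for pairs that violate the premises. *)
  exists (GaussStep 1%:M (fun=> 0%N) (fun _ _ => 0) (fun _ _ => 0)) => cF eF.
  by exfalso; apply: nF.
pose G := fix G k := if k is k'.+1 then step_map (pick (G k', k')) \o G k' else id.
pose st k := pick (G k, k).
have flowE k : flow (fun k => step_layer (st k)) (fun k => step_rot (st k)) k = G k.
  by elim: k => [//|k IH]; apply/funext => x; rewrite /= IH.
pose a k := step_gain (G k) (st k).
have GP k : continuous (G k) /\ entropy_le (G k) (ln C - \sum_(j < k) a j).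
  elim: k => [|k [cG eG]].
    by rewrite big_ord0 subr0; split; [move=> x; exact: cvg_id|exact: entropy_le_id].
  have [vst _] := pickP (G k, k) cG (ex_intro _ _ eG).
  split=> [x|]; last first.
    by rewrite big_ord_recr/= opprD addrA; exact: entropy_le_step.
  by apply: (@continuous_comp _ _ _ (G k)); [exact: cG|exact: step_map_continuous].
have stP k := pickP (G k, k) (GP k).1 (ex_intro _ _ (GP k).2).
exists st => /=; split=> [k|k|e e0]; first by case: (stP k).
  by rewrite flowE; case: (GP k).
pose b k := a k + 2^-1 ^+ k.
have b0 k : 0 <= b k.
  (* Some step has gain at least [- d], and [b k] dominates all gains at stage [k]. *)
  apply/ler_addgt0Pr => d d0; have [st' vst' h] := exists_gain_ge0 (GP k).1 d0.
  by have := (stP k).2 _ vst'; rewrite -/(a k) -/(b k); lra.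
have sb n : series b n <= ln C + 2.
  rewrite /series/= big_mkord big_split/= lerD//.
    by rewrite -subr_ge0; exact: entropy_le_ge0 (GP n).2.
  have -> : \sum_(i < n) 2^-1 ^+ i = 2 - 2 * 2^-1 ^+ n :> R.
    elim: n => [|n IH]; first by rewrite big_ord0 expr0; lra.
    by rewrite big_ord_recr/= IH exprS; lra.
  by rewrite lerBlDr lerDl mulr_ge0// exprn_ge0// invr_ge0.
have cb : b k @[k --> \oo] --> 0.
  apply: cvg_series_cvg_0; apply: nondecreasing_is_cvgn.
    by apply/nondecreasing_seqP => n; rewrite seriesSr lerDl.
  by exists (ln C + 2) => _ [n _ <-].
near=> k => st' vst'; rewrite flowE (le_trans ((stP k).2 _ vst'))//.
by apply: ltW; near: k; exact: (cvgr_lt _ cb).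
Unshelve. all: by end_near. Qed.

End entropy_descent.

(** * Gaussian means of bounded continuous functions *)

Section gaussian_mean.
Context {R : realType}.
Notation phi := (@normal_pdf R 0 1).

Definition gauss_mean n (g : 'cV[R]_n -> R) := RintRD (fun v => g v * std_gauss_density v).

Lemma bounded_gauss_dominated n (g : 'cV[R]_n -> R) (M : R) : continuous g ->
  (forall v, `|g v| <= M) -> gauss_dominated M (fun v => g v * std_gauss_density v).
Proof.
move=> cg gM; split.
  apply: vec_measurableM; last exact: vec_measurable_gdens.
  exact: continuous_vec_measurable.
move=> v; rewrite normrM (gtr0_norm (gdens_gt0 v)).
by rewrite ler_wpM2r ?(ltW (gdens_gt0 v)).
Qed.

Lemma EFin_gauss_mean n (g : 'cV[R]_n -> R) (M : R) : continuous g ->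
  (forall v, `|g v| <= M) ->
  (gauss_mean g)%:E = intRD (fun v => (g v * std_gauss_density v)%:E).
Proof. by move=> cg gM; rewrite (EFin_RintRD (bounded_gauss_dominated cg gM)). Qed.

Lemma gauss_meanD n (f g : 'cV[R]_n -> R) (M N : R) : continuous f -> continuous g ->
  (forall v, `|f v| <= M) -> (forall v, `|g v| <= N) ->
  gauss_mean (fun v => f v + g v) = gauss_mean f + gauss_mean g.
Proof.
move=> cf cg fM gN.
rewrite /gauss_mean -(RintRDD (bounded_gauss_dominated cf fM) (bounded_gauss_dominated cg gN)).
by congr RintRD; apply/funext => v; rewrite mulrDl.
Qed.

Lemma gauss_meanZ n (f : 'cV[R]_n -> R) (a M : R) : continuous f ->
  (forall v, `|f v| <= M) -> gauss_mean (fun v => a * f v) = a * gauss_mean f.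
Proof.
move=> cf fM; rewrite /gauss_mean -(RintRDZ a (bounded_gauss_dominated cf fM)).
by congr RintRD; apply/funext => v; rewrite mulrA.
Qed.

Lemma le_gauss_mean n (f g : 'cV[R]_n -> R) (M N : R) : continuous f -> continuous g ->
  (forall v, `|f v| <= M) -> (forall v, `|g v| <= N) -> (forall v, f v <= g v) ->
  gauss_mean f <= gauss_mean g.
Proof.
move=> cf cg fM gN fg.
apply: (le_RintRD (bounded_gauss_dominated cf fM) (bounded_gauss_dominated cg gN)).
by move=> v; rewrite ler_wpM2r ?(ltW (gdens_gt0 v)).
Qed.

Lemma gauss_mean_cst n c : gauss_mean (fun _ : 'cV[R]_n => c) = c.
Proof.
by rewrite /gauss_mean (RintRDZ c (@gauss_dominated_gdens R n)) RintRD_gdens mulr1.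
Qed.

Lemma intRD_coord0 n (h : R -> R) :
  intRD (fun v : 'cV[R]_n.+1 => (h (v 0 0) * std_gauss_density v)%:E) =
  (\int[lebesgue_measure]_x (h x * phi x)%:E)%E.
Proof.
rewrite intRDS; apply: eq_integral => x _.
rewrite -[RHS]mule1 -(intRD_gdens n) -(intRDZ _ (gauss_dominated_gdens n)).
by apply: eq_intRD => v; rewrite /= vcons0 gdens_vcons mulrA.
Qed.

(** The line is encoded as column vectors of size 1, so that the properties of [gauss_mean] apply to
    it. *)
Definition gauss_mean1 (h : R -> R) := gauss_mean (fun v : 'cV[R]_1 => h (v 0 0)).

Lemma gauss_mean_coord0 n h : gauss_mean (fun v : 'cV[R]_n.+1 => h (v 0 0)) = gauss_mean1 h.
Proof. by rewrite /gauss_mean1 /gauss_mean /RintRD /comp !intRD_coord0. Qed.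

Lemma gauss_mean_invariant n (Q : 'M[R]_n) (g : 'cV[R]_n -> R) (M : R) : gauss_invariant Q ->
  continuous g -> (forall v, `|g v| <= M) ->
  gauss_mean (fun v => g (Q *m v)) = gauss_mean g.
Proof.
move=> iQ cg gM.
have cgQ : continuous (fun v => g (Q *m v)).
  move=> v; apply: (@continuous_comp _ _ _ (mulmx Q) g); last exact: cg.
  exact: mulmx_cV_continuous.
have gMQ v : `|g (Q *m v)| <= M by [].
have cM : continuous (fun _ : 'cV[R]_n => M) by exact: continuous_cstr.
have MM (_ : 'cV[R]_n) : `|M| <= `|M| by [].
(* Adding the bound [M] makes the integrand nonnegative, as [gauss_invariant] requires. *)
apply: (addIr M); rewrite -{1}(gauss_mean_cst n M) -{2}(gauss_mean_cst n M).
rewrite -(gauss_meanD cgQ cM gMQ MM) -(gauss_meanD cg cM gM MM).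
have g0 v : (0 <= (g v + M)%:E)%E.
  by rewrite lee_fin -lerBlDr sub0r; have := gM v; rewrite ler_norml => /andP[].
have mg : vec_measurable (EFin \o (fun v => g v + M)).
  by apply: continuous_vec_measurable; exact: continuous_addr.
have := iQ _ mg g0; rewrite /gauss_mean /RintRD => h; congr fine.
by transitivity (intRD (fun v => (g (Q *m v) + M)%:E * (std_gauss_density v)%:E)%E);
  [|rewrite [LHS]h]; apply: eq_intRD => v; rewrite /= EFinM.
Qed.

(** The row index is existential because ['I_D] may be empty; a unit vector rules out [D = 0]. *)
Lemma exists_invariant_direction D (t : 'cV[R]_D) : \sum_i t i 0 ^+ 2 = 1 ->
  exists Q (i : 'I_D), [/\ orthogonal_mx Q, gauss_invariant Q,
    forall v : 'cV[R]_D, (Q *m v) i 0 = \sum_j t j 0 * v j 0 &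
    forall h, gauss_mean (fun v : 'cV[R]_D => h (v i 0)) = gauss_mean1 h].
Proof.
case: D t => [|n] t t1; first by move: t1; rewrite big_ord0 => /esym/eqP; rewrite oner_eq0.
have [Q [oQ iQ rQ]] := exists_invariant_row t1.
by exists Q, 0; split=> // h; exact: gauss_mean_coord0.
Qed.

(** From [1 - t <= expR (- t)] and [(1 + t + 2 * t ^+ 2) * (1 - t) = 1 + t ^+ 2 * (1 - 2 * t) >=
    1]. *)
Lemma expR_le_quadratic (t : R) : `|t| <= 2^-1 -> expR t <= 1 + t + 2 * t ^+ 2.
Proof.
rewrite ler_norml => /andP[t1 t2].
have e1 : 1 - t <= expR (- t) by rewrite -[X in 1 + X]opprK opprK expR_ge1Dx.
have t0 : 0 < 1 - t by lra.
rewrite -[expR t]invrK -expRN -[leRHS]invrK lef_pV2 ?posrE ?invr_gt0 ?expR_gt0//; last nra.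
apply: le_trans e1; rewrite -[leRHS]invrK lef_pV2 ?posrE ?invr_gt0//; last nra.
by rewrite -div1r ler_pdivrMr//; nra.
Qed.

(** The quadratic bound on the exponential gives [expR (e * h)] a Gaussian mean of at most
    [1 + k <= expR k], where [k] is the subtracted constant. Thus [e * h] becomes admissible at a
    cost of second order in [e] beyond its mean. *)
Lemma gauss_mean_expR (h : R -> R) (M e : R) : bounded_lipschitz h ->
  (forall x, `|h x| <= M) -> 0 < e -> e * M <= 2^-1 ->
  (\int[lebesgue_measure]_x (expR (e * h x - (e * gauss_mean1 h + 2 * (e * M) ^+ 2)) *
     phi x)%:E <= 1)%E.
Proof.
move=> bh hM e0 eM; set k := e * gauss_mean1 h + _.
have ch := bounded_lipschitz_continuous bh.
have cv : continuous (fun v : 'cV[R]_1 => h (v 0 0)).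
  by apply: (continuous_compr (h := h)) => [|x]; [exact: coord_cV_continuous|exact: ch].
have eh x : `|e * h x| <= e * M by rewrite normrM (gtr0_norm e0) ler_pM2l.
have ce : continuous (fun v : 'cV[R]_1 => expR (e * h (v 0 0) - k)).
  apply: (continuous_compr (h := expR)); last by move=> x; exact: continuous_expR.
  apply: continuous_addr; last exact: continuous_cstr.
  by apply: continuous_mulr => //; exact: continuous_cstr.
have beM (v : 'cV[R]_1) : `|expR (e * h (v 0 0) - k)| <= expR (e * M - k).
  rewrite ger0_norm ?expR_ge0// ler_expR lerD2r.
  by rewrite (le_trans (ler_norm _)).
rewrite -(intRD_coord0 0 (fun x => expR (e * h x - k))) -(EFin_gauss_mean ce beM) lee_fin.
pose g (v : 'cV[R]_1) := expR (- k) * ((1 + 2 * (e * M) ^+ 2) + e * h (v 0 0)).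
have cst1 : continuous (fun _ : 'cV[R]_1 => 1 + 2 * (e * M) ^+ 2).
  exact: continuous_cstr.
have ceh : continuous (fun v : 'cV[R]_1 => e * h (v 0 0)).
  by apply: continuous_mulr => //; exact: continuous_cstr.
have b1 (_ : 'cV[R]_1) : `|1 + 2 * (e * M) ^+ 2| <= `|1 + 2 * (e * M) ^+ 2| by [].
have b2 (v : 'cV[R]_1) : `|e * h (v 0 0)| <= e * M by [].
have cs := continuous_addr cst1 ceh.
have bs (v : 'cV[R]_1) : `|(1 + 2 * (e * M) ^+ 2) + e * h (v 0 0)| <=
    `|1 + 2 * (e * M) ^+ 2| + e * M.
  by rewrite (le_trans (ler_normD _ _))// lerD2l.
have cg : continuous g by apply: continuous_mulr => //; exact: continuous_cstr.
have bg v : `|g v| <= expR (- k) * (`|1 + 2 * (e * M) ^+ 2| + e * M).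
  by rewrite normrM (ger0_norm (expR_ge0 _)) ler_wpM2l ?expR_ge0.
apply: (@le_trans _ _ (gauss_mean g)).
  apply: (le_gauss_mean ce cg beM bg) => v; rewrite addrC expRD ler_wpM2l ?expR_ge0//.
  have := eh (v 0 0) => h1; rewrite (le_trans (expR_le_quadratic _))//.
    by rewrite (le_trans h1).
  rewrite addrAC lerD2r lerD2l ler_pM2l// -[leLHS]real_normK ?num_real//.
  by rewrite lerXn2r ?nnegrE// (le_trans _ h1).
rewrite /g (gauss_meanZ _ cs bs) (gauss_meanD cst1 ceh b1 b2) gauss_mean_cst.
rewrite (gauss_meanZ _ cv (fun v => hM (v 0 0))) -/(gauss_mean1 h).
rewrite expRN ler_pdivrMl ?expR_gt0// mulr1 (le_trans _ (expR_ge1Dx k))//.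
by clear b1; rewrite /k; lra.
Qed.

End gaussian_mean.

(** * Convergence of one-dimensional projections *)

Section ridge_convergence.
Context {R : realType} {D : nat}.
Notation phi := (@normal_pdf R 0 1).
Variables (X : set 'cV[R]_D) (E : ('cV[R]_D -> R) -> R).
Hypotheses (cX : compact X) (mE : mean_functional X E).
Variable F : nat -> 'cV[R]_D -> 'cV[R]_D.
Hypothesis cF : forall k, continuous (F k).
Hypothesis gainF : forall e : R, 0 < e -> \forall k \near \oo,
  forall st, valid_step st -> step_gain E (F k) st <= e.

Let cQF (Q : 'M[R]_D) i (h : R -> R) k : continuous h ->
  continuous (fun x => h ((Q *m F k x) i 0)).
Proof.
move=> ch; apply: (continuous_compr (h := h)) => [x|x]; last exact: ch.
apply: (@continuous_comp _ _ _ (F k) (fun v => (Q *m v) i 0)); first exact: cF.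
apply: (@continuous_comp _ _ _ (mulmx Q) (fun v : 'cV[R]_D => v i 0)).
  exact: mulmx_cV_continuous.
exact: coord_cV_continuous.
Qed.

(** With [h] on coordinate [i] and 0 on the others, some step gains at least the mean of [h] minus
    [e / 2], while eventually every step gains at most [e / 2]. *)
Lemma ridge_mean_le0 (Q : 'M[R]_D) (i : 'I_D) h (e : R) : orthogonal_mx Q ->
  gauss_invariant Q -> bounded_lipschitz h ->
  (\int[lebesgue_measure]_x (expR (h x) * phi x)%:E <= 1)%E -> 0 < e ->
  \forall k \near \oo, E (fun x => h ((Q *m F k x) i 0)) <= e.
Proof.
move=> oQ iQ bh h1 e0; have e20 : 0 < e / 2 by rewrite divr_gt0.
pose hh (j : 'I_D) : R -> R := if j == i then h else fun=> 0.
have bhh j : bounded_lipschitz (hh j).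
  by rewrite /hh; case: ifP => // _; exact: bounded_lipschitz_cst.
have hh1 j : (\int[lebesgue_measure]_x (expR (hh j x) * phi x)%:E <= 1)%E.
  rewrite /hh; case: ifP => // _.
  by under eq_integral do rewrite expR0 mul1r; rewrite integral_normal_pdf.
near=> k.
have [st vst] := exists_gain_ge cX mE (@cF k) oQ iQ bhh hh1 e20.
have -> : (fun x => \sum_j hh j ((Q *m F k x) j 0)) = (fun x => h ((Q *m F k x) i 0)).
  apply/funext => x; rewrite (bigD1 i)//= /hh eqxx big1 ?addr0// => j /negbTE -> //.
have : step_gain E (F k) st <= e / 2 by move: st vst; near: k; exact: gainF.
lra.
Unshelve. all: by end_near. Qed.

(** The previous bound is linearised: applied to [d * h - c] with [c] the normalising constant and
    divided by [d], it leaves the error [2 * d * M ^+ 2 + e / 2]. *)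
Lemma ridge_mean_le (Q : 'M[R]_D) (i : 'I_D) h (e : R) : orthogonal_mx Q ->
  gauss_invariant Q -> bounded_lipschitz h -> 0 < e ->
  \forall k \near \oo, E (fun x => h ((Q *m F k x) i 0)) <= gauss_mean1 h + e.
Proof.
move=> oQ iQ bh e0; case: (mE) => ED EZ _ _.
have [M [L [L0 hM hL]]] := bh.
have M0 : 0 <= M by exact: le_trans (hM 0).
(* Chosen so that [d * M <= 2^-1], as the quadratic bound on the exponential demands, and
   [2 * d * M ^+ 2 <= e / 2]. *)
have [||d /andP[d0 d1] dP] := @exists_small R (2 * M + 4 * M ^+ 2) (Num.min 1 e).
- by rewrite addr_ge0 ?mulr_ge0.
- by rewrite lt_min ltr01.
have M2 : 0 <= M ^+ 2 by rewrite sqr_ge0.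
have {}dP : d * M <= 2^-1 /\ 2 * (d * M ^+ 2) <= e / 2.
  by move: dP; rewrite le_min => /andP[p1 p2]; split; nra.
have de0 : 0 < d * (e / 2) by rewrite mulr_gt0// divr_gt0.
set m := gauss_mean1 h.
pose c := d * m + 2 * (d * M) ^+ 2.
have bh' : bounded_lipschitz (fun x => d * h x - c).
  exists (d * M + `|c|), (d * L); split.
  - by rewrite mulr_ge0// ltW.
  - move=> x; rewrite (le_trans (ler_normB _ _))// lerD2r normrM (gtr0_norm d0).
    by rewrite ler_pM2l.
  - move=> x y; rewrite opprB addrA subrK -mulrBr normrM (gtr0_norm d0) -mulrA.
    by rewrite ler_pM2l.
have int1 := gauss_mean_expR bh hM d0 dP.1.
near=> k.
have : E (fun x => d * h ((Q *m F k x) i 0) - c) <= d * (e / 2).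
  by near: k; exact: (ridge_mean_le0 i oQ iQ bh' int1 de0).
have ch := bounded_lipschitz_continuous bh.
have c1 := @cQF Q i h k ch.
have c2 : continuous (fun x => d * h ((Q *m F k x) i 0)).
  by apply: continuous_mulr => //; exact: continuous_cstr.
have c3 : continuous (fun _ : 'cV[R]_D => - c) by exact: continuous_cstr.
rewrite (ED _ _ c2 c3) (EZ _ _ c1) (mean_cst mE).
set Eh := E _ => ineq.
rewrite -(ler_pM2l d0); have [_ dP2] := dP.
have : d * (2 * (d * M ^+ 2)) <= d * (e / 2) by rewrite ler_pM2l.
by rewrite /c -/m in ineq *; nra.
Unshelve. all: by end_near. Qed.

Lemma ridge_mean_cvg (Q : 'M[R]_D) (i : 'I_D) h : orthogonal_mx Q ->
  gauss_invariant Q -> bounded_lipschitz h ->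
  E (fun x => h ((Q *m F k x) i 0)) @[k --> \oo] --> gauss_mean1 h.
Proof.
move=> oQ iQ bh; case: (mE) => _ EZ _ _.
have ch := bounded_lipschitz_continuous bh.
have [M [L [L0 hM hL]]] := bh.
have bN : bounded_lipschitz (fun x => - 1 * h x).
  exists M, L; split=> // [x|x y]; first by rewrite mulN1r normrN.
  by rewrite -mulrBr mulN1r normrN.
have gN : gauss_mean1 (fun x => - 1 * h x) = - gauss_mean1 h.
  have cv : continuous (fun v : 'cV[R]_1 => h (v 0 0)).
    by apply: (continuous_compr (h := h)) => [|x]; [exact: coord_cV_continuous|exact: ch].
  by rewrite /gauss_mean1 (gauss_meanZ (- 1) cv (fun v => hM (v 0 0))) mulN1r.
apply/cvgrPdist_le => e e0; near=> k; rewrite ler_distlC; apply/andP; split; last first.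
  by near: k; exact: ridge_mean_le.
have : E (fun x => - 1 * h ((Q *m F k x) i 0)) <= gauss_mean1 (fun x => - 1 * h x) + e.
  by near: k; exact: ridge_mean_le.
by rewrite EZ ?gN; [lra|exact: cQF].
Unshelve. all: by end_near. Qed.

(** The length of [xi] is absorbed into [h] and its direction into a row of a rotation; [xi = 0]
    gives constants. *)
Lemma ridge_cvg (xi : 'cV[R]_D) h : bounded_lipschitz h ->
  E (fun x => h (\sum_i xi i 0 * F k x i 0)) @[k --> \oo] -->
  gauss_mean (fun v : 'cV[R]_D => h (\sum_i xi i 0 * v i 0)).
Proof.
move=> bh; have ch := bounded_lipschitz_continuous bh.
pose r := Num.sqrt (\sum_i xi i 0 ^+ 2).
have r2 : r ^+ 2 = \sum_i xi i 0 ^+ 2.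
  by rewrite sqr_sqrtr// sumr_ge0// => i _; rewrite sqr_ge0.
have [r0|r0] := eqVneq r 0.
  have xi0 i : xi i 0 = 0.
    move: r2; rewrite r0 expr0n => /esym/eqP.
    rewrite psumr_eq0 => [/allP/(_ i)|k _]; last exact: sqr_ge0.
    by rewrite mem_index_enum sqrf_eq0/= => /(_ isT)/eqP.
  have S0 (v : 'cV[R]_D) : \sum_i xi i 0 * v i 0 = 0.
    by rewrite big1// => i _; rewrite xi0 mul0r.
  have -> : (fun v : 'cV[R]_D => h (\sum_i xi i 0 * v i 0)) = fun=> h 0.
    by apply/funext => v; rewrite S0.
  rewrite gauss_mean_cst.
  have -> : (fun k => E (fun x => h (\sum_i xi i 0 * F k x i 0))) = fun=> h 0.
    by apply/funext => k; under eq_fun do rewrite S0; rewrite (mean_cst mE).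
  exact: cvg_cst.
pose t : 'cV[R]_D := r^-1 *: xi.
have t1 : \sum_i t i 0 ^+ 2 = 1.
  under eq_bigr do rewrite mxE exprMn.
  by rewrite -mulr_sumr -r2 -exprMn mulVf// expr1n.
have [Q [i [oQ iQ rQ gQ]]] := exists_invariant_direction t1.
have SE (v : 'cV[R]_D) : \sum_j xi j 0 * v j 0 = r * (Q *m v) i 0.
  rewrite rQ mulr_sumr; apply: eq_bigr => j _.
  by rewrite mxE !mulrA mulfV// mul1r.
have bh' : bounded_lipschitz (fun x => h (r * x)).
  have [M [L [L0 hM hL]]] := bh; exists M, (L * `|r|); split => //.
    by rewrite mulr_ge0.
  by move=> x y; rewrite (le_trans (hL _ _))// -mulrBr normrM mulrA.
have := ridge_mean_cvg i oQ iQ bh'.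
have -> : gauss_mean (fun v : 'cV[R]_D => h (\sum_i xi i 0 * v i 0)) =
    gauss_mean1 (fun x => h (r * x)).
  have [M [L [L0 hM hL]]] := bh.
  have cv : continuous (fun v : 'cV[R]_D => h (r * v i 0)).
    apply: (continuous_compr (h := fun x => h (r * x))) => [|x].
      exact: coord_cV_continuous.
    exact: bounded_lipschitz_continuous bh' _.
  rewrite -gQ -(gauss_mean_invariant iQ cv (fun v => hM (r * v i 0))).
  by congr gauss_mean; apply/funext => v; rewrite SE.
have -> // : (fun k => E (fun x => h (\sum_i xi i 0 * F k x i 0))) =
  fun k => E (fun x => h (r * (Q *m F k x) i 0)).
by apply/funext => k; congr E; apply/funext => x; rewrite SE.
Qed.

End ridge_convergence.

(** * Bernstein approximation *)

Section bernstein.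
Context {R : realType}.
Implicit Type f : nat -> R.

(** Law of the number of successes in [n] Bernoulli trials, by its recursion. *)
Fixpoint bernstein n k (t : R) : R :=
  if n is n'.+1 then
    (1 - t) * bernstein n' k t + (if k is k'.+1 then t * bernstein n' k' t else 0)
  else (k == 0)%:R.

Lemma bernstein_ge0 n k t : 0 <= t <= 1 -> 0 <= bernstein n k t.
Proof.
move=> /andP[t0 t1]; elim: n k => [|n IH] [|k] //=.
  by rewrite addr0 mulr_ge0 ?subr_ge0.
by rewrite addr_ge0// mulr_ge0 ?subr_ge0.
Qed.

Lemma bernstein_gt n k t : (n < k)%N -> bernstein n k t = 0.
Proof.
elim: n k => [|n IH] [|k]//= nk.
by rewrite !IH ?mulr0 ?addr0// ltnW.
Qed.

(** Conditioning on one of the [n.+1] trials: failure leaves the count unchanged, success raises it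
    by one. *)
Lemma bernstein_sumS n t f :
  \sum_(k < n.+2) bernstein n.+1 k t * f k =
  (1 - t) * \sum_(k < n.+1) bernstein n k t * f k +
  t * \sum_(k < n.+1) bernstein n k t * f k.+1.
Proof.
transitivity (\sum_(k < n.+2) (1 - t) * (bernstein n k t * f k) +
  \sum_(k < n.+2) (if k : nat is k'.+1 then t * bernstein n k' t else 0) * f k).
  by rewrite -big_split/=; apply: eq_bigr => k _; rewrite mulrDl mulrA.
congr (_ + _).
  by rewrite -mulr_sumr big_ord_recr/= bernstein_gt// mul0r addr0.
rewrite big_ord_recl/= mul0r add0r mulr_sumr; apply: eq_bigr => k _.
by rewrite mulrA.
Qed.

Lemma bernstein_sum n t : \sum_(k < n.+1) bernstein n k t = 1.
Proof.
have -> : \sum_(k < n.+1) bernstein n k t = \sum_(k < n.+1) bernstein n k t * (fun=> 1) k.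
  by apply: eq_bigr => k _; rewrite mulr1.
elim: n => [|n IH]; first by rewrite big_ord1 /= mulr1.
by rewrite (bernstein_sumS n t (fun=> 1)) IH !mulr1 subrK.
Qed.

Lemma bernstein_mean n t : \sum_(k < n.+1) bernstein n k t * (k%:R - n%:R * t) = 0.
Proof.
elim: n => [|n IH]; first by rewrite big_ord1/= mul0r subr0 mulr0.
rewrite (bernstein_sumS n t (fun k => k%:R - n.+1%:R * t)).
have S c : \sum_(k < n.+1) bernstein n k t * (k%:R - n%:R * t + c) = c.
  under eq_bigr do rewrite mulrDr.
  by rewrite big_split/= IH add0r -mulr_suml bernstein_sum mul1r.
rewrite (eq_bigr (fun k : 'I_n.+1 => bernstein n k t * (k%:R - n%:R * t + - t))); last first.
  by move=> k _; congr (_ * _); rewrite -[n.+1%:R]natr1; ring.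
rewrite S (eq_bigr (fun k : 'I_n.+1 => bernstein n k t * (k%:R - n%:R * t + (1 - t)))); last first.
  by move=> k _; congr (_ * _); rewrite -[n.+1%:R]natr1 -[k.+1%:R]natr1; ring.
by rewrite S; ring.
Qed.

(** One more trial shifts the centred count by [- t] or [1 - t]; since the old centred count has
    mean 0, the squares simply add. *)
Lemma bernstein_variance n t :
  \sum_(k < n.+1) bernstein n k t * (k%:R - n%:R * t) ^+ 2 = n%:R * (t * (1 - t)).
Proof.
elim: n => [|n IH]; first by rewrite big_ord1/= !mul0r subr0 expr0n mulr0.
rewrite (bernstein_sumS n t (fun k => (k%:R - n.+1%:R * t) ^+ 2)).
have S c : \sum_(k < n.+1) bernstein n k t * (k%:R - n%:R * t + c) ^+ 2 =
    n%:R * (t * (1 - t)) + c ^+ 2.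
  rewrite (eq_bigr (fun k : 'I_n.+1 => bernstein n k t * (k%:R - n%:R * t) ^+ 2 +
    (2 * c * (bernstein n k t * (k%:R - n%:R * t)) + bernstein n k t * c ^+ 2))); last first.
    by move=> k _; ring.
  rewrite !big_split/= IH -mulr_sumr bernstein_mean mulr0 add0r -mulr_suml.
  by rewrite bernstein_sum mul1r.
rewrite (eq_bigr (fun k : 'I_n.+1 => bernstein n k t * (k%:R - n%:R * t + - t) ^+ 2)); last first.
  by move=> k _; congr (_ * _ ^+ 2); rewrite -[n.+1%:R]natr1; ring.
rewrite S (eq_bigr (fun k : 'I_n.+1 => bernstein n k t * (k%:R - n%:R * t + (1 - t)) ^+ 2)); last first.
  by move=> k _; congr (_ * _ ^+ 2); rewrite -[n.+1%:R]natr1 -[k.+1%:R]natr1; ring.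
by rewrite S -[n.+1%:R]natr1; ring.
Qed.

Definition unit_cube D : set 'cV[R]_D := [set t | forall i, 0 <= t i 0 <= 1].

Lemma compact_unit_cube D : compact (@unit_cube D).
Proof.
pose A : set 'rV[R]_D := [set v | forall i, `[0 : R, 1]%classic (v 0 i)].
have cA : compact A.
  by apply: (@rV_compact R D (fun=> `[0 : R, 1]%classic)) => i; exact: segment_compact.
have ct : continuous (fun v : 'rV[R]_D => v^T : 'cV[R]_D).
  apply: continuous_cV => i; under eq_fun do rewrite mxE.
  exact: coord_continuous.
have := continuous_compact (continuous_subspaceT ct) cA.
congr compact; apply/seteqP; split=> [_ [v Av <-] i|t tP].
  by have := Av i; rewrite /= in_itv/= mxE.
exists t^T; last by rewrite trmxK.
by move=> i /=; rewrite in_itv/= mxE; exact: tP.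
Qed.

Lemma cube_unif_continuous D (G : 'cV[R]_D -> R) (e : R) : continuous G -> 0 < e ->
  exists2 d : R, 0 < d & forall s t : 'cV[R]_D, unit_cube s -> (forall i, `|s i 0 - t i 0| < d) ->
    `|G s - G t| <= e.
Proof.
move=> cG e0.
have /compact_near_coveringP := @compact_unit_cube D.
move=> /(_ _ (0 : R)^'+ (fun d (s : 'cV[R]_D) => forall t : 'cV[R]_D,
  (forall i, `|s i 0 - t i 0| < d) -> `|G s - G t| <= e)) h.
have {}h : \forall d \near 0^'+, forall s : 'cV[R]_D, unit_cube s -> forall t : 'cV[R]_D,
    (forall i, `|s i 0 - t i 0| < d) -> `|G s - G t| <= e.
  apply: h => x _.
  have e20 : 0 < e / 2 by rewrite divr_gt0.
  have /cvgrPdist_lt/(_ _ e20)/nbhs_ballP[r /= r0 rP] := cG x.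
  have r20 : 0 < r / 2 by rewrite divr_gt0.
  exists (ball x (r / 2), [set d | d < r / 2]).
    split => /=; first exact: nbhsx_ballx.
    by apply: nbhs_right_lt.
  move=> [x' d] [/= [_ xx'] dr] t x't.
  have h1 : `|G x - G x'| < e / 2.
    apply: rP; split => // i j; apply: le_ball (xx' i j); lra.
  have h2 : `|G x - G t| < e / 2.
    apply: rP; split => // i j; rewrite (ord1 j) /ball/=.
    rewrite (_ : x i 0 - t i 0 = (x i 0 - x' i 0) + (x' i 0 - t i 0)); last by ring.
    rewrite (le_lt_trans (ler_normD _ _))// (splitr r) ltrD//; first exact: xx'.
    by rewrite (lt_trans (x't i)).
  rewrite (_ : G x' - G t = (G x - G t) - (G x - G x')); last by ring.
  by rewrite (le_trans (ler_normB _ _))// (splitr e) lerD// ltW.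
near (0 : R)^'+ => d; exists d => // s t us.
by move: s us t; near: d.
Unshelve. all: by end_near. Qed.

(** When some coordinates differ by at least [d], the quadratic term with [K = 2 * M / d ^+ 2]
    already exceeds the trivial bound [2 * M]. In this form the modulus can be averaged using
    variances only. *)
Lemma cube_quadratic_modulus D (G : 'cV[R]_D -> R) (M e : R) : continuous G ->
  (forall v, `|G v| <= M) -> 0 < e ->
  exists2 K : R, 0 <= K & forall s t : 'cV[R]_D, unit_cube s -> unit_cube t ->
    `|G s - G t| <= e + K * \sum_i (s i 0 - t i 0) ^+ 2.
Proof.
move=> cG GM e0; have [d d0 dP] := cube_unif_continuous cG e0.
have M0 : 0 <= M by exact: le_trans (GM 0).
have K0 : 0 <= 2 * M / d ^+ 2 by rewrite divr_ge0 ?sqr_ge0// mulr_ge0.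
have S0 (s t : 'cV[R]_D) : 0 <= \sum_i (s i 0 - t i 0) ^+ 2.
  by rewrite sumr_ge0// => i _; exact: sqr_ge0.
exists (2 * M / d ^+ 2) => // s t us ut.
have [st|nst] := pselect (forall i, `|s i 0 - t i 0| < d).
  by rewrite (le_trans (dP s t us st))// lerDl mulr_ge0.
move/existsNP: nst => [i /negP]; rewrite -leNgt => di.
have : 2 * M <= 2 * M / d ^+ 2 * \sum_i (s i 0 - t i 0) ^+ 2.
  rewrite -mulrA ler_peMr ?mulr_ge0// ler_pdivlMl ?exprn_gt0// mulr1.
  rewrite (bigD1 i)//= ler_wpDr ?sumr_ge0// => [j _|]; first exact: sqr_ge0.
  by rewrite -[leRHS]real_normK ?num_real// lerXn2r ?nnegrE// ltW.
have : `|G s - G t| <= 2 * M.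
  by rewrite (le_trans (ler_normB _ _))// mulr_natl mulr2n lerD.
lra.
Qed.

Definition bernstein_weight D n (k : {ffun 'I_D -> 'I_n.+1}) (t : 'cV[R]_D) :=
  \prod_i bernstein n (k i) (t i 0).

Lemma bernstein_weight_ge0 D n (k : {ffun 'I_D -> 'I_n.+1}) (t : 'cV[R]_D) : unit_cube t ->
  0 <= bernstein_weight k t.
Proof. by move=> ut; apply: prodr_ge0 => i _; exact: bernstein_ge0. Qed.

Lemma bernstein_weight_sum D n (t : 'cV[R]_D) :
  \sum_(k : {ffun 'I_D -> 'I_n.+1}) bernstein_weight k t = 1.
Proof.
rewrite /bernstein_weight -(bigA_distr_bigA (fun i j => bernstein n (j : 'I_n.+1) (t i 0))).
by rewrite big1// => i _; exact: bernstein_sum.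
Qed.

Lemma bernstein_weight_variance D n (t : 'cV[R]_D) (i : 'I_D) : (0 < n)%N ->
  unit_cube t ->
  \sum_(k : {ffun 'I_D -> 'I_n.+1}) bernstein_weight k t * ((k i)%:R / n%:R - t i 0) ^+ 2
  <= n%:R^-1.
Proof.
move=> n0 ut; have nR0 : (0 : R) < n%:R by rewrite ltr0n.
(* Inserting the squared deviation in factor [i] only keeps the summand a product over coordinates,
   so the sum of products becomes a product of sums; all factors but one are then equal to 1. *)
pose q (j : 'I_D) (l : 'I_n.+1) : R :=
  if j == i then (l%:R / n%:R - t i 0) ^+ 2 else 1.
rewrite (eq_bigr (fun k : {ffun 'I_D -> 'I_n.+1} =>
  \prod_j (bernstein n (k j) (t j 0) * q j (k j)))); last first.
  move=> k _; rewrite big_split/= -/(bernstein_weight k t); congr (_ * _).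
  rewrite (bigD1 i)//= /q eqxx big1 ?mulr1// => j /negbTE -> //.
rewrite -(bigA_distr_bigA (fun j l => bernstein n (l : 'I_n.+1) (t j 0) * q j l)).
rewrite (bigD1 i)//= [X in _ * X]big1 ?mulr1; last first.
  move=> j /negbTE ji; rewrite -[RHS](bernstein_sum n (t j 0)).
  by apply: eq_bigr => l _; rewrite /q ji mulr1.
rewrite (eq_bigr (fun l : 'I_n.+1 =>
  n%:R^-1 ^+ 2 * (bernstein n l (t i 0) * (l%:R - n%:R * t i 0) ^+ 2))); last first.
  move=> l _; rewrite /q eqxx [RHS]mulrCA -exprMn; congr (_ * _ ^+ 2).
  by rewrite mulrBr mulKf ?gt_eqF// mulrC.
rewrite -mulr_sumr bernstein_variance expr2 -mulrA mulKf ?gt_eqF//.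
have /andP[t0 t1] := ut i; rewrite ler_piMr ?invr_ge0 ?(ltW nR0)//.
by rewrite mulr_ile1 ?subr_ge0// gerBl.
Qed.

(** Averaging the quadratic modulus against the weights gives [e / 2 + K * D / n], each coordinate
    having variance at most [1/n]. *)
Lemma bernstein_approx D (G : 'cV[R]_D -> R) (M e : R) : continuous G ->
  (forall v, `|G v| <= M) -> 0 < e ->
  exists n, forall t : 'cV[R]_D, unit_cube t ->
    `|G t - \sum_(k : {ffun 'I_D -> 'I_n.+1})
        bernstein_weight k t * G (\col_i ((k i)%:R / n%:R))| <= e.
Proof.
move=> cG GM e0; have e20 : 0 < e / 2 by rewrite divr_gt0.
have [K K0 KP] := cube_quadratic_modulus cG GM e20.
pose n := (Num.truncn (K * D%:R / (e / 2))).+1.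
have nR0 : (0 : R) < n%:R by rewrite ltr0n.
have nP : K * D%:R / n%:R <= e / 2.
  rewrite ler_pdivrMr// [leRHS]mulrC -ler_pdivrMr//; exact/ltW/truncnS_gt.
exists n => t ut.
pose z (k : {ffun 'I_D -> 'I_n.+1}) : 'cV[R]_D := \col_i ((k i)%:R / n%:R).
have uz k : unit_cube (z k).
  move=> i; rewrite mxE divr_ge0 ?ler0n//= ler_pdivrMr// mul1r ler_nat.
  by rewrite -ltnS.
have -> : G t = \sum_(k : {ffun 'I_D -> 'I_n.+1}) bernstein_weight k t * G t.
  by rewrite -mulr_suml bernstein_weight_sum mul1r.
rewrite -sumrB.
apply: (le_trans (ler_norm_sum _ _ _)).
apply: (@le_trans _ _ (\sum_(k : {ffun 'I_D -> 'I_n.+1}) (bernstein_weight k t * (e / 2) +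
  K * \sum_i bernstein_weight k t * ((k i)%:R / n%:R - t i 0) ^+ 2))).
  apply: ler_sum => k _; rewrite -mulrBr normrM ger0_norm ?bernstein_weight_ge0//.
  rewrite -mulr_sumr (mulrCA K) -mulrDr ler_wpM2l ?bernstein_weight_ge0//.
  have := KP _ _ (uz k) ut; rewrite distrC /z; under eq_bigr do rewrite mxE.
  exact.
rewrite big_split/= -mulr_suml bernstein_weight_sum mul1r -mulr_sumr exchange_big/=.
rewrite [leRHS](splitr e) lerD2l (le_trans _ nP)// -mulrA ler_wpM2l//.
rewrite (le_trans (ler_sum _ (fun i _ => bernstein_weight_variance i _ ut)))//.
by rewrite sumr_const card_ord mulr_natl.
Qed.

End bernstein.

(** * Cramer-Wold *)

Section cramer_wold.
Context {R : realType} {D : nat}.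
Notation phi := (@normal_pdf R 0 1).
Implicit Types f g : 'cV[R]_D -> R.

Definition bounded_continuous f := continuous f /\ exists M : R, forall v, `|f v| <= M.

Definition bounded_mean (L : ('cV[R]_D -> R) -> R) :=
  [/\ forall f g, bounded_continuous f -> bounded_continuous g ->
        L (fun v => f v + g v) = L f + L g,
      forall (a : R) f, bounded_continuous f -> L (fun v => a * f v) = a * L f,
      forall f g, bounded_continuous f -> bounded_continuous g ->
        (forall v, f v <= g v) -> L f <= L g
    & forall c : R, L (fun=> c) = c].

Lemma bounded_mean_gauss : bounded_mean (@gauss_mean R D).
Proof.
split.
- by move=> f g [cf [M fM]] [cg [N gN]]; exact: gauss_meanD fM gN.
- by move=> a f [cf [M fM]]; exact: gauss_meanZ fM.
- by move=> f g [cf [M fM]] [cg [N gN]]; exact: le_gauss_mean fM gN.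
- exact: gauss_mean_cst.
Qed.

Lemma bounded_continuousD f g : bounded_continuous f -> bounded_continuous g ->
  bounded_continuous (fun v => f v + g v).
Proof.
move=> [cf [M fM]] [cg [N gN]]; split; first exact: continuous_addr.
by exists (M + N) => v; rewrite (le_trans (ler_normD _ _))// lerD.
Qed.

Lemma bounded_continuousZ (a : R) f : bounded_continuous f ->
  bounded_continuous (fun v => a * f v).
Proof.
move=> [cf [M fM]]; split; first by apply: continuous_mulr => //; exact: continuous_cstr.
by exists (`|a| * M) => v; rewrite normrM ler_wpM2l.
Qed.

Lemma bounded_continuous_cst (c : R) : bounded_continuous (fun=> c).
Proof. by split; [exact: continuous_cstr|exists `|c|]. Qed.

Lemma bounded_continuous_sum (I : Type) (r : seq I) (f : I -> 'cV[R]_D -> R) :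
  (forall i, bounded_continuous (f i)) ->
  bounded_continuous (fun v => \sum_(i <- r) f i v).
Proof.
move=> bf; elim: r => [|i r IH].
  by under eq_fun do rewrite big_nil; exact: bounded_continuous_cst.
by under eq_fun do rewrite big_cons; exact: bounded_continuousD.
Qed.

Lemma bounded_continuous_ridge (xi : 'cV[R]_D) (h : R -> R) : bounded_lipschitz h ->
  bounded_continuous (fun v => h (\sum_i xi i 0 * v i 0)).
Proof.
move=> bh; split; last by have [M [L [_ hM _]]] := bh; exists M.
apply: (continuous_compr (h := h)) => [|v]; last exact: bounded_lipschitz_continuous.
apply: continuous_sumr => i; apply: continuous_mulr; first exact: continuous_cstr.
exact: coord_cV_continuous.
Qed.

(** Each generator is a bounded Lipschitz function of one linear form, so convergence of means is
    known on the whole span. The phase [c] provides sines, and product-to-sum formulas make the span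
    an algebra. *)
Inductive trig_span : ('cV[R]_D -> R) -> Prop :=
| trig_cos (xi : 'cV[R]_D) (c : R) : trig_span (fun v => cos (\sum_i xi i 0 * v i 0 + c))
| trig_add f g : trig_span f -> trig_span g -> trig_span (fun v => f v + g v)
| trig_scale (a : R) f : trig_span f -> trig_span (fun v => a * f v).

Lemma eq_trig_span f g : f =1 g -> trig_span f -> trig_span g.
Proof. by move=> /funext ->. Qed.

Lemma trig_mul f g : trig_span f -> trig_span g -> trig_span (fun v => f v * g v).
Proof.
move=> tf; elim: tf g => {f} [xi c|f1 f2 _ IH1 _ IH2|a f _ IH] g tg.
- elim: tg => {g} [xj d|g1 g2 _ IH1 _ IH2|a g _ IH].
  + apply: (@eq_trig_span (fun v => 2^-1 *
        (cos (\sum_i (xi + xj) i 0 * v i 0 + (c + d)) +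
         cos (\sum_i (xi - xj) i 0 * v i 0 + (c - d))))); last first.
      by apply: trig_scale; apply: trig_add; exact: trig_cos.
    move=> v.
    set A := \sum_i xi i 0 * v i 0 + c; set B := \sum_i xj i 0 * v i 0 + d.
    have -> : \sum_i (xi + xj) i 0 * v i 0 + (c + d) = A + B.
      rewrite /A /B addrACA -big_split/=; congr (_ + _).
      by apply: eq_bigr => i _; rewrite mxE mulrDl.
    have -> : \sum_i (xi - xj) i 0 * v i 0 + (c - d) = A - B.
      rewrite /A /B opprD addrACA -sumrB; congr (_ + _).
      by apply: eq_bigr => i _; rewrite !mxE mulrBl.
    by rewrite cosD cosB; field.
  + by apply: eq_trig_span (trig_add IH1 IH2) => v; rewrite mulrDr.
  + by apply: eq_trig_span (trig_scale a IH) => v; rewrite mulrCA.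
- by apply: eq_trig_span (trig_add (IH1 _ tg) (IH2 _ tg)) => v; rewrite mulrDl.
- by apply: eq_trig_span (trig_scale a (IH _ tg)) => v; rewrite mulrA.
Qed.

Lemma trig_cst (c : R) : trig_span (fun=> c).
Proof.
have := trig_scale c (trig_cos 0 0); congr trig_span; apply/funext => v.
by rewrite addr0 big1 ?cos0 ?mulr1// => i _; rewrite mxE mul0r.
Qed.

Lemma trig_sum (I : Type) (r : seq I) (f : I -> 'cV[R]_D -> R) :
  (forall i, trig_span (f i)) -> trig_span (fun v => \sum_(i <- r) f i v).
Proof.
move=> tf; elim: r => [|i r IH].
  by under eq_fun do rewrite big_nil; exact: trig_cst.
by under eq_fun do rewrite big_cons; exact: trig_add.
Qed.

Lemma trig_prod (I : Type) (r : seq I) (f : I -> 'cV[R]_D -> R) :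
  (forall i, trig_span (f i)) -> trig_span (fun v => \prod_(i <- r) f i v).
Proof.
move=> tf; elim: r => [|i r IH].
  by under eq_fun do rewrite big_nil; exact: trig_cst.
by under eq_fun do rewrite big_cons; exact: trig_mul.
Qed.

Lemma sum_delta_cV (i : 'I_D) (a : R) (v : 'cV[R]_D) :
  \sum_j (a *: delta_mx i 0 : 'cV[R]_D) j 0 * v j 0 = a * v i 0.
Proof.
rewrite (bigD1 i)//= !mxE !eqxx mulr1 big1 ?addr0// => j /negbTE ji.
by rewrite !mxE ji mulr0 mul0r.
Qed.

Lemma trig_sin_coord (i : 'I_D) (w : R) : trig_span (fun v => sin (w * v i 0)).
Proof.
have := trig_cos (w *: delta_mx i 0) (- (pi / 2)); congr trig_span; apply/funext => v.
by rewrite sum_delta_cV cosBpihalf.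
Qed.

Lemma trig_bernstein n k f : trig_span f -> trig_span (fun v => bernstein n k (f v)).
Proof.
move=> tf; elim: n k => [|n IH] k /=; first exact: trig_cst.
have t1 : trig_span (fun v => 1 - f v).
  by apply: eq_trig_span (trig_add (trig_cst 1) (trig_scale (- 1) tf)) => v; rewrite mulN1r.
apply: trig_add; first exact: trig_mul.
by case: k => [|k]; [exact: trig_cst|exact: trig_mul].
Qed.

Lemma cos_lipschitz (x y : R) : `|cos x - cos y| <= `|x - y|.
Proof.
wlog xy : x y / y < x.
  move=> wl; have [|yx|->] := ltgtP y x; first exact: wl.
    by rewrite distrC (distrC x); exact: wl.
  by rewrite !subrr.
have [d _ ->] := MVT xy (fun t _ => is_derive_cos t) (continuous_subspaceT (@continuous_cos R)).
by rewrite normrM normrN ler_piMl// ler_norml sin_geN1 sin_le1.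
Qed.

Lemma normr_sin_le (x : R) : `|sin x| <= `|x|.
Proof.
have := cos_lipschitz (x - pi / 2) (0 - pi / 2).
by rewrite !cosBpihalf sin0 subr0 sub0r opprK subrK.
Qed.

Lemma cos_bounded_lipschitz (c : R) : bounded_lipschitz (fun x => cos (x + c)).
Proof.
exists 1, 1; split => // [x|x y]; first by rewrite ler_norml cos_geN1 cos_le1.
by rewrite mul1r (le_trans (cos_lipschitz _ _))// opprD addrACA subrr addr0.
Qed.

(** A Lipschitz substitute for the indicator of [|x| > A], so that the mass of tails is itself
    controlled by convergence of projections. *)
Definition tail_fun (A x : R) := Num.min 1 (Num.max 0 (`|x| - A)).

Lemma tail_fun_ge0 A x : 0 <= tail_fun A x.
Proof. by rewrite /tail_fun le_min ler01 le_max lexx. Qed.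

Lemma tail_fun_le1 A x : tail_fun A x <= 1.
Proof. by rewrite /tail_fun ge_min lexx. Qed.

Lemma tail_fun_eq1 A x : A + 1 <= `|x| -> tail_fun A x = 1.
Proof.
by move=> Ax; rewrite /tail_fun min_l// le_max lerBrDl Ax orbT.
Qed.

Lemma tail_fun_eq0 A x : `|x| <= A -> tail_fun A x = 0.
Proof. by move=> Ax; rewrite /tail_fun max_l ?min_r// subr_le0. Qed.

Lemma tail_fun_bounded_lipschitz A : bounded_lipschitz (tail_fun A).
Proof.
exists 1, 1; split => // [x|x y]; first by rewrite ger0_norm ?tail_fun_ge0 ?tail_fun_le1.
rewrite mul1r (le_trans _ (ler_dist_dist x y))// /tail_fun.
have mE (u : R) : Num.min 1 (Num.max 0 u) = if u <= 0 then 0 else if u <= 1 then u else 1.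
  have [u0|u0] := leP u 0; first by rewrite min_r.
  by case: (leP u 1).
rewrite !mE; set a := `|x|; set b := `|y|.
have h1 := ler_norm (a - b); have h2 := ler_norm (b - a).
rewrite (distrC b a) in h2.
rewrite ler_norml; apply/andP; split;
  case: (leP (a - A) 0) => ?; case: (leP (b - A) 0) => ?;
  case: (leP (a - A) 1) => ?; case: (leP (b - A) 1) => ?; lra.
Qed.

(** The cut-off lies below the indicator of the complement of []- A, A]], whose normal mass is made
    small by two quantiles. *)
Lemma gauss_mean1_tail (e : R) : 0 < e ->
  exists2 A : R, 0 <= A & gauss_mean1 (tail_fun A) <= e.
Proof.
move=> e0; have e20 : 0 < e / 2 by rewrite divr_gt0.
have [|t1 t1P] := @Phi_gt R (1 - e / 2); first by rewrite gtrBl.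
have [t2 t2P] := Phi_lt_ex e20.
pose A := Num.max `|t1| `|t2|.
have A0 : 0 <= A by rewrite le_max normr_ge0.
exists A => //.
have bA : forall v : 'cV[R]_1, `|tail_fun A (v 0 0)| <= 1.
  by move=> v; rewrite ger0_norm ?tail_fun_ge0 ?tail_fun_le1.
have cA : continuous (fun v : 'cV[R]_1 => tail_fun A (v 0 0)).
  apply: (continuous_compr (h := tail_fun A)) => [|x]; first exact: coord_cV_continuous.
  exact: bounded_lipschitz_continuous (tail_fun_bounded_lipschitz A) _.
rewrite -lee_fin (EFin_gauss_mean cA bA) intRD_coord0.
apply: (@le_trans _ _ (normal_prob 0 1 (~` `]- A, A]))).
  rewrite /normal_prob [leRHS]integral_mkcond; apply: ge0_le_integral => //.
  - by move=> x _; rewrite lee_fin mulr_ge0 ?tail_fun_ge0 ?normal_pdf_ge0.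
  - apply/measurable_EFinP; apply: measurable_funM; last exact: measurable_normal_pdf.
    apply: continuous_measurable_fun.
    exact: bounded_lipschitz_continuous (tail_fun_bounded_lipschitz A).
  - have mC : measurable (~` `]- A, A]%classic : set (measurableTypeR R)).
      exact: measurableC.
    apply/(measurable_restrictT _ mC).
    by apply: measurable_funTS; apply/measurable_EFinP; exact: measurable_normal_pdf.
  - move=> x _; rewrite patchE; case: ifPn => [_|].
      by rewrite lee_fin ler_piMl ?normal_pdf_ge0 ?tail_fun_le1.
    rewrite notin_setE/= => /contrapT; rewrite in_itv/= => /andP[xA1 xA2].
    by rewrite tail_fun_eq0 ?mul0r// ler_norml xA2 ltW.
rewrite probability_setC// [X in (1 - X)%E](_ : _ = (Phi A - Phi (- A))%:E); last first.
  by apply: Phi_sub; rewrite ge0_cp.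
rewrite -EFinB lee_fin.
have h1 : Phi t1 <= Phi A by rewrite Phi_mono le_max ler_norm.
have h2 : Phi (- A) <= Phi t2.
  have t2N : - t2 <= `|t2| by rewrite -normrN ler_norm.
  by rewrite Phi_mono lerNl le_max t2N orbT.
lra.
Qed.

Lemma gauss_mean_coord (i : 'I_D) (h : R -> R) : bounded_lipschitz h ->
  gauss_mean (fun v : 'cV[R]_D => h (v i 0)) = gauss_mean1 h.
Proof.
move=> bh; have [M [_ [_ hM _]]] := bh.
have t1 : \sum_j (1 *: delta_mx i 0 : 'cV[R]_D) j 0 ^+ 2 = 1.
  under eq_bigr do rewrite expr2.
  by rewrite sum_delta_cV !mxE !eqxx !mulr1.
have [Q [j [oQ iQ rQ gQ]]] := exists_invariant_direction t1.
have cj : continuous (fun v : 'cV[R]_D => h (v j 0)).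
  apply: (continuous_compr (h := h)) => [|x]; first exact: coord_cV_continuous.
  exact: bounded_lipschitz_continuous.
rewrite -gQ -(gauss_mean_invariant iQ cj (fun v => hM (v j 0))).
by congr gauss_mean; apply/funext => v; rewrite rQ sum_delta_cV mul1r.
Qed.

(** Keeps the argument of [asin] away from -1 and 1, so that the inverse sine becomes continuous on
    the whole line. *)
Definition clamp_half (x : R) : R := Num.max (- 2^-1) (Num.min 2^-1 x).

Lemma clamp_half_bounded_lipschitz : bounded_lipschitz clamp_half.
Proof.
have cE (u : R) : clamp_half u =
    if u <= - 2^-1 then - 2^-1 else if u <= 2^-1 then u else 2^-1.
  rewrite /clamp_half; have [u0|u0] := leP u (- 2^-1).
    by rewrite min_r ?max_l//; lra.
  by case: (leP u 2^-1) => u1; rewrite max_r//; lra.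
exists 1, 1; split => // [x|x y].
  rewrite cE ler_norml; case: (leP x (- 2^-1)) => ?; first lra.
  by case: (leP x 2^-1) => ?; lra.
rewrite mul1r !cE.
have h1 := ler_norm (x - y); have h2 := ler_norm (y - x); rewrite distrC in h2.
rewrite ler_norml; apply/andP; split;
  case: (leP x (- 2^-1)) => ?; case: (leP y (- 2^-1)) => ?;
  case: (leP x 2^-1) => ?; case: (leP y 2^-1) => ?; lra.
Qed.

Lemma asin_clamp_continuous : continuous (fun x : R => asin (clamp_half (2 * x - 1))).
Proof.
apply: (continuous_compr (h := @asin R)); last first.
  move=> x; apply: continuous_asin; rewrite /clamp_half lt_max gt_max gt_min.
  by apply/andP; split; [apply/orP; left; lra|apply/andP; split; [lra|apply/orP; left; lra]].
apply: (continuous_compr (h := clamp_half)) => [x|x]; last first.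
  exact: bounded_lipschitz_continuous clamp_half_bounded_lipschitz _.
by apply: cvgB; [apply: cvgM; [exact: cvg_cst|exact: cvg_id]|exact: cvg_cst].
Qed.

Lemma asin_clamp_sin (x : R) : `|x| <= 2^-1 ->
  asin (clamp_half (2 * ((1 + sin x) / 2) - 1)) = x.
Proof.
move=> x2; have := le_trans (normr_sin_le x) x2; rewrite ler_norml => /andP[s1 s2].
have -> : 2 * ((1 + sin x) / 2) - 1 = sin x by field.
rewrite /clamp_half min_r// max_r//; apply: sinK; rewrite in_itv/=.
move: x2; rewrite ler_norml => /andP[x1 x2]; have := pihalf_ge1 R.
by move=> ?; apply/andP; split; lra.
Qed.

(** Bernstein approximation in the variables [(1 + sin (w v_i)) / 2]: a
    trigonometric polynomial close to [g] on a large box and bounded outside. *)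
Lemma trig_approx g (M A e : R) : continuous g -> (forall v, `|g v| <= M) ->
  0 <= A -> 0 < e ->
  exists2 P, trig_span P & forall v,
    `|g v - P v| <= e + 2 * M * \sum_i tail_fun A (v i 0).
Proof.
move=> cg gM A0 e0; have M0 : 0 <= M by exact: le_trans (gM 0).
have A10 : 0 < A + 1 by rewrite ltr_wpDl.
(* With this frequency [|w * v i 0| <= 2^-1] on the box [|v i 0| <= A + 1], where the clamp is
   inactive. *)
pose w := (2 * (A + 1))^-1; have w0 : 0 < w by rewrite invr_gt0 mulr_gt0.
(* A continuous left inverse, on that box, of the change of variables [tv] below. *)
pose inv (t : 'cV[R]_D) : 'cV[R]_D := \col_i (asin (clamp_half (2 * t i 0 - 1)) / w).
have cinv : continuous inv.
  apply: continuous_cV => i; under eq_fun do rewrite mxE.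
  apply: continuous_mulr; last exact: continuous_cstr.
  apply: (continuous_compr (h := fun x => asin (clamp_half (2 * x - 1)))) => [|x].
    exact: coord_cV_continuous.
  exact: asin_clamp_continuous.
have cG : continuous (g \o inv).
  by move=> t; apply: (@continuous_comp _ _ _ inv g); [exact: cinv|exact: cg].
have GM t : `|(g \o inv) t| <= M by exact: gM.
have [n nP] := bernstein_approx cG GM e0.
pose tv (v : 'cV[R]_D) : 'cV[R]_D := \col_i ((1 + sin (w * v i 0)) / 2).
have utv v : unit_cube (tv v).
  move=> i; rewrite mxE; have := sin_le1 (w * v i 0); have := sin_geN1 (w * v i 0).
  by move=> ? ?; apply/andP; split; lra.
pose P v := \sum_(k : {ffun 'I_D -> 'I_n.+1})
  bernstein_weight k (tv v) * (g \o inv) (\col_i ((k i)%:R / n%:R)).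
exists P.
  apply: trig_sum => k; apply: trig_mul; last exact: trig_cst.
  apply: trig_prod => i; apply: trig_bernstein.
  apply: eq_trig_span (trig_scale 2^-1 (trig_add (trig_cst 1) (trig_sin_coord i w))) => v.
  by rewrite mxE mulrC.
move=> v; have S0 : 0 <= \sum_i tail_fun A (v i 0).
  by apply: sumr_ge0 => i _; exact: tail_fun_ge0.
have tP := nP _ (utv v); rewrite -/(P v) in tP.
have [vA|/existsNP[i /negP vi]] := pselect (forall i, `|v i 0| <= A + 1).
  have E : (g \o inv) (tv v) = g v.
    rewrite /=; congr g; apply/matrixP => i j; rewrite (ord1 j) !mxE asin_clamp_sin.
      by rewrite mulrAC mulfV ?mul1r// gt_eqF.
    rewrite normrM (gtr0_norm w0) /w ler_pdivrMl ?mulr_gt0//.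
    by rewrite mulrAC divff ?mul1r.
  by rewrite E in tP; rewrite (le_trans tP)// lerDl !mulr_ge0.
(* Outside the box some cut-off equals 1, so the term [2 * M] absorbs both [g v] and the value of
   [g] at the wrong preimage. *)
have S1 : 1 <= \sum_i tail_fun A (v i 0).
  rewrite (bigD1 i)//= tail_fun_eq1; last by move: vi; rewrite -ltNge => /ltW.
  by rewrite lerDl sumr_ge0// => j _; exact: tail_fun_ge0.
have h1 : `|g v - P v| <= `|g v| + `|(g \o inv) (tv v)| + `|(g \o inv) (tv v) - P v|.
  rewrite (_ : g v - P v = g v - (g \o inv) (tv v) + ((g \o inv) (tv v) - P v)); last by ring.
  by rewrite (le_trans (ler_normD _ _))// lerD2r ler_normB.
have h2 : 2 * M <= 2 * M * \sum_i tail_fun A (v i 0) by rewrite ler_peMr// mulr_ge0.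
have h3 := gM v; have h4 := GM (tv v).
lra.
Qed.

Variable Lam : nat -> ('cV[R]_D -> R) -> R.
Hypothesis mLam : forall k, bounded_mean (Lam k).
Hypothesis ridgeLam : forall (xi : 'cV[R]_D) (h : R -> R), bounded_lipschitz h ->
  Lam k (fun v => h (\sum_i xi i 0 * v i 0)) @[k --> \oo] -->
  gauss_mean (fun v : 'cV[R]_D => h (\sum_i xi i 0 * v i 0)).

Let good f := bounded_continuous f /\ Lam k f @[k --> \oo] --> gauss_mean f.

Let good_add f g : good f -> good g -> good (fun v => f v + g v).
Proof.
move=> [bf cf] [bg cg]; split; first exact: bounded_continuousD.
have [GD _ _ _] := bounded_mean_gauss; rewrite GD//.
have -> : (fun k => Lam k (fun v => f v + g v)) = (fun k => Lam k f + Lam k g).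
  by apply/funext => k; have [LD _ _ _] := mLam k; rewrite LD.
exact: cvgD.
Qed.

Let good_scale (a : R) f : good f -> good (fun v => a * f v).
Proof.
move=> [bf cf]; split; first exact: bounded_continuousZ.
have [_ GZ _ _] := bounded_mean_gauss; rewrite GZ//.
have -> : (fun k => Lam k (fun v => a * f v)) = (fun k => a * Lam k f).
  by apply/funext => k; have [_ LZ _ _] := mLam k; rewrite LZ.
by apply: cvgM => //; exact: cvg_cst.
Qed.

Let good_cst (c : R) : good (fun=> c).
Proof.
split; first exact: bounded_continuous_cst.
have [_ _ _ Gc] := bounded_mean_gauss; rewrite Gc.
have -> : (fun k => Lam k (fun=> c)) = fun=> c.
  by apply/funext => k; have [_ _ _ Lc] := mLam k; rewrite Lc.
exact: cvg_cst.
Qed.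

Let good_trig f : trig_span f -> good f.
Proof.
elim=> {f} [xi c|f g _ IH1 _ IH2|a f _ IH]; last 2 first.
- exact: good_add.
- exact: good_scale.
split; last exact: (@ridgeLam xi _ (cos_bounded_lipschitz c)).
exact: (bounded_continuous_ridge xi (cos_bounded_lipschitz c)).
Qed.

Let good_coord (i : 'I_D) h : bounded_lipschitz h -> good (fun v => h (v i 0)).
Proof.
move=> bh.
have E : (fun v : 'cV[R]_D => h (v i 0)) =
    fun v => h (\sum_j (1 *: delta_mx i 0 : 'cV[R]_D) j 0 * v j 0).
  by apply/funext => v; rewrite sum_delta_cV mul1r.
by rewrite E; split; [exact: bounded_continuous_ridge|exact: ridgeLam].
Qed.

Let good_sum (I : Type) (r : seq I) (f : I -> 'cV[R]_D -> R) :
  (forall i, good (f i)) -> good (fun v => \sum_(i <- r) f i v).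
Proof.
move=> gf; elim: r => [|i r IH].
  by under eq_fun do rewrite big_nil; exact: good_cst.
by under eq_fun do rewrite big_cons; exact: good_add.
Qed.

(** The error between [g] and its trigonometric approximation [P] is dominated by [b], a sum of
    cut-offs in single coordinates, whose means also converge. Hence one Gaussian tail bound
    controls the tails of all late laws. *)
Lemma cramer_wold g : bounded_continuous g -> Lam k g @[k --> \oo] --> gauss_mean g.
Proof.
move=> bg; have [cg [M gM]] := bg.
have M0 : 0 <= M by exact: le_trans (gM 0).
have [GD GZ GM Gc] := bounded_mean_gauss.
(* The total error is [6 * d]: at most [2 * d] for the Gaussian mean of [b], [3 * d] for its mean
   under a late law, and [d] for [P]. *)
apply/cvgrPdist_le => e e0; pose d : R := e / 8; have d0 : 0 < d by rewrite divr_gt0.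
have [|c /andP[c0 _] cP] := @exists_small R (2 * M * D%:R) d _ d0.
  by rewrite !mulr_ge0.
have [A A0 AP] := gauss_mean1_tail c0.
have [P tP gP] := trig_approx cg gM A0 d0.
pose b (v : 'cV[R]_D) : R := d + 2 * M * \sum_i tail_fun A (v i 0).
have [bP cP'] := good_trig tP.
have gS : good (fun v => \sum_i tail_fun A (v i 0)).
  by apply: good_sum => i; exact/good_coord/tail_fun_bounded_lipschitz.
have [bb cb] : good b by apply: good_add; [exact: good_cst|exact: good_scale].
have Gb : gauss_mean b <= 2 * d.
  rewrite /b GD; last 2 first.
  - exact: bounded_continuous_cst.
  - by apply: bounded_continuousZ; exact: gS.1.
  rewrite Gc GZ; last exact: gS.1.
  have -> : gauss_mean (fun v : 'cV[R]_D => \sum_i tail_fun A (v i 0)) =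
      D%:R * gauss_mean1 (tail_fun A).
    have GS (r : seq 'I_D) : gauss_mean (fun v : 'cV[R]_D => \sum_(i <- r) tail_fun A (v i 0)) =
        (size r)%:R * gauss_mean1 (tail_fun A).
      elim: r => [|i r IH].
        by under eq_fun do rewrite big_nil; rewrite Gc mul0r.
      under eq_fun do rewrite big_cons.
      have bc j := (good_coord j (tail_fun_bounded_lipschitz A)).1.
      rewrite GD// ?IH ?(gauss_mean_coord i (tail_fun_bounded_lipschitz A)).
        by rewrite /= -natr1 mulrDl mul1r addrC.
      exact: bounded_continuous_sum.
    by rewrite GS -[index_enum _]enumT size_enum_ord.
  have : 2 * M * (D%:R * gauss_mean1 (tail_fun A)) <= 2 * M * (D%:R * c).
    by rewrite !ler_wpM2l// mulr_ge0.
  by rewrite mulrA in cP *; move: cP; rewrite mulrA; lra.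
have up v : g v <= P v + b v /\ P v <= g v + b v.
  have := gP v; rewrite -/(b v) ler_norml => /andP[]; split; lra.
have bPb := bounded_continuousD bP bb; have bgb := bounded_continuousD bg bb.
have Gup : gauss_mean g <= gauss_mean P + gauss_mean b.
  by rewrite -GD//; apply: GM => // v; case: (up v).
have Glo : gauss_mean P <= gauss_mean g + gauss_mean b.
  by rewrite -GD//; apply: GM => // v; case: (up v).
near=> k; have [LD _ LM _] := mLam k.
have Lup : Lam k g <= Lam k P + Lam k b.
  by rewrite -LD//; apply: LM => // v; case: (up v).
have Llo : Lam k P <= Lam k g + Lam k b.
  by rewrite -LD//; apply: LM => // v; case: (up v).
have k1 : `|gauss_mean P - Lam k P| <= d.
  by near: k; move/cvgrPdist_le : cP'; exact.
have k2 : `|gauss_mean b - Lam k b| <= d.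
  by near: k; move/cvgrPdist_le : cb; exact.
move: k1 k2; rewrite !ler_norml => /andP[k1 k2] /andP[k3 k4].
have ed : e = 8 * d by rewrite /d; field.
by apply/andP; split; lra.
Unshelve. all: by end_near. Qed.

End cramer_wold.

(** * Convergence of the flow *)

Section law_of_density.
Context {R : realType} {D : nat}.
Variables (p : 'cV[R]_D -> R) (X : set 'cV[R]_D).
Hypotheses (cX : compact X) (p0 : forall x, 0 <= p x).
Hypotheses (pX : forall x, ~ X x -> p x = 0) (cp : {within X, continuous p}).
Hypothesis p1 : intRD (fun x => (p x)%:E) = 1%E.

Lemma density_vec_measurable : vec_measurable (EFin \o p).
Proof.
have clX : closed X by apply: compact_closed cX; exact: norm_hausdorff.
apply: usc_vec_measurable => a; rewrite openE => x; rewrite /= in_itv/= => pxa.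
(* Since [0 <= p x < a], the value 0 taken off [X] is also below [a]; only the behaviour of [p]
   within [X] remains to be examined. *)
have a0 : 0 < a by exact: le_lt_trans pxa.
have out y : ~ X y -> p y < a by move=> /pX ->.
have [Xx|nXx] := pselect (X x); last first.
  have : nbhs x (~` X) by apply: open_nbhs_nbhs; split => //; exact: closed_openC.
  by apply: filterS => y nXy; rewrite /= in_itv/=; exact: out.
have /subspace_continuousP/(_ x Xx) cpx := cp.
have : \forall y \near within X (nbhs x), p y < a by exact: (cvgr_lt _ cpx).
rewrite near_withinE; apply: filterS => y /= ya; rewrite in_itv/=.
by have [/ya|/out] := pselect (X y).
Qed.

(** On the compact set [X] both [p] and the inverse of the Gaussian density are bounded, by [M] and
    [K]; the added 1 makes the constant positive. *)
Lemma density_le_gauss : exists2 C, 0 < C & forall x, p x <= C * std_gauss_density x.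
Proof.
have cg : continuous (fun v : 'cV[R]_D => (std_gauss_density v)^-1).
  apply: (continuous_compr (h := fun x : R => x^-1)) => [|v]; last first.
    by apply: cvgV; [rewrite gt_eqF ?gdens_gt0|exact: cvg_id].
  apply: (continuous_prodr (F := fun i (v : 'cV[R]_D) => normal_pdf 0 1 (v i 0))) => i.
  apply: (continuous_compr (h := normal_pdf 0 1)) => [|x]; first exact: coord_cV_continuous.
  by apply: continuous_normal_pdf; rewrite oner_eq0.
have [M M0 pM] := compact_continuous_bounded cX cp.
have [K K0 gK] := compact_continuous_bounded cX (continuous_subspaceT cg).
exists (M * K + 1) => [|x]; first by rewrite ltr_wpDl ?mulr_ge0.
have g0 := gdens_gt0 x.
have [Xx|/pX ->] := pselect (X x); last by rewrite mulr_ge0 ?addr_ge0 ?mulr_ge0// ltW.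
have := pM x Xx; rewrite ger0_norm// => h1.
have := gK x Xx; rewrite ger0_norm ?invr_ge0 ?(ltW g0)// -div1r ler_pdivrMr// => h2.
apply: (le_trans h1); rewrite mulrDl mul1r -mulrA (le_trans (_ : _ <= M * (K * std_gauss_density x)))//.
  by rewrite ler_peMr.
by rewrite lerDl ltW.
Qed.

Definition density_mean (g : 'cV[R]_D -> R) := RintRD (fun x => g x * p x).

Lemma density_dominated (g : 'cV[R]_D -> R) : continuous g ->
  exists c, gauss_dominated c (fun x => g x * p x).
Proof.
move=> cg; have [C C0 pC] := density_le_gauss.
have [M M0 gM] := compact_continuous_bounded cX (continuous_subspaceT cg).
exists (M * C); split.
  by apply: vec_measurableM; [exact: continuous_vec_measurable|exact: density_vec_measurable].
move=> x; have [Xx|/pX ->] := pselect (X x); last first.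
  by rewrite mulr0 normr0 !mulr_ge0// ltW// gdens_gt0.
by rewrite normrM (ger0_norm (p0 x)) -mulrA ler_pM// gM.
Qed.

Lemma EFin_density_mean (g : 'cV[R]_D -> R) : continuous g ->
  (density_mean g)%:E = intRD (fun x => (g x * p x)%:E).
Proof. by move=> /density_dominated[c dc]; rewrite (EFin_RintRD dc). Qed.

Lemma density_mean_functional : mean_functional X density_mean.
Proof.
split.
- move=> f g /density_dominated[c df] /density_dominated[d dg].
  rewrite /density_mean -(RintRDD df dg); congr RintRD.
  by apply/funext => x; rewrite mulrDl.
- move=> a f /density_dominated[c df]; rewrite /density_mean -(RintRDZ a df).
  by congr RintRD; apply/funext => x; rewrite mulrA.
- move=> f g /density_dominated[c df] /density_dominated[d dg] fg.
  apply: (le_RintRD df dg) => x.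
  have [Xx|/pX ->] := pselect (X x); last by rewrite !mulr0.
  by rewrite ler_wpM2r// fg.
- rewrite /density_mean /RintRD /comp; under eq_intRD do rewrite mul1r.
  by rewrite p1.
Qed.

Lemma density_mean_le (C : R) (w : 'cV[R]_D -> R) : 0 < C -> (forall x, p x <= C * std_gauss_density x) ->
  continuous w -> (forall v, 0 <= w v) ->
  (intRD (fun v => (w v * std_gauss_density v)%:E) <= 1)%E -> density_mean w <= C.
Proof.
move=> C0 pC cw w0 w1; rewrite -lee_fin EFin_density_mean//.
have mw : vec_measurable (EFin \o w) by exact: continuous_vec_measurable.
have mwg : vec_measurable (fun v => (w v * std_gauss_density v)%:E).
  exact: (vec_measurableM mw (@vec_measurable_gdens R D)).
have wg0 v : (0 <= (w v * std_gauss_density v)%:E)%E.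
  by rewrite lee_fin mulr_ge0// ltW// gdens_gt0.
apply: (@le_trans _ _ (intRD (fun v => (w v * std_gauss_density v)%:E * C%:E)%E)).
  apply: le_intRD.
  - exact: (vec_measurableM mw density_vec_measurable).
  - by apply: vec_measurableMe mwg _; exact: vec_measurable_cst.
  - by move=> v; rewrite lee_fin mulr_ge0.
  - move=> v; rewrite -EFinM lee_fin -mulrA ler_wpM2l// mulrC; exact: pC.
rewrite ge0_intRDZr//; last exact: ltW.
by rewrite -[leRHS]mul1e lee_wpmul2r// lee_fin ltW.
Qed.

End law_of_density.

Theorem theorem1 (R : realType) (D : nat) (p : 'cV[R]_D -> R)
    (X : set 'cV[R]_D) (delta : R) :
  compact X ->
  0 < delta ->
  (forall x, 0 <= p x) ->
  (forall x, ~ X x -> p x = 0) ->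
  (forall x, X x -> delta <= p x) ->
  {within X, continuous p} ->
  intRD (fun x => (p x)%:E) = 1%E ->
  exists (Psi : nat -> 'cV[R]_D -> 'cV[R]_D) (Q : nat -> 'M[R]_D),
    (forall k, marginal_gaussianization_layer (Psi k)) /\
    (forall k, orthogonal_mx (Q k)) /\
    (forall g : 'cV[R]_D -> R, continuous g ->
       (exists M : R, forall z, `|g z| <= M) ->
       (fun k => intRD (fun x => (g (flow Psi Q k x) * p x)%:E)) @ \oo
         --> intRD (fun z => (g z * std_gauss_density z)%:E)).
Proof.
move=> cX _ p0 pX _ cp p1.
have [C C0 pC] := density_le_gauss cX p0 pX cp.
have mE := density_mean_functional cX p0 pX cp p1.
have EC w := @density_mean_le R D p X cX p0 pX cp C w C0 pC.
have [st [vst cF gF]] := exists_descent cX mE C0 EC.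
exists (fun k => step_layer (st k)), (fun k => step_rot (st k)).
split=> [k|]; first exact: step_layerP.
split=> [k|g cg bg]; first by case: (vst k).
set F := flow _ _ in cF gF *.
have cgF (f : 'cV[R]_D -> R) k : continuous f -> continuous (fun x => f (F k x)).
  by move=> cf x; apply: (@continuous_comp _ _ _ (F k) f); [exact: cF|exact: cf].
(* The law of the [k]-th iterate, as a functional on test functions. *)
pose Lam k (f : 'cV[R]_D -> R) := density_mean p (fun x => f (F k x)).
have mLam k : bounded_mean (Lam k).
  have [ED EZ EM _] := mE; split.
  - by move=> f f' [cf _] [cf' _]; apply: ED; exact: cgF.
  - by move=> a f [cf _]; apply: EZ; exact: cgF.
  - by move=> f f' [cf _] [cf' _] ff'; apply: EM => [||x _]; [exact: cgF|exact: cgF|].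
  - by move=> c; exact: mean_cst mE c.
have ridge := ridge_cvg cX mE cF gF.
have := cramer_wold mLam ridge (conj cg bg).
have [M gM] := bg.
have -> : (fun k => intRD (fun x => (g (F k x) * p x)%:E)) = (fun k => (Lam k g)%:E).
  by apply/funext => k; rewrite (EFin_density_mean cX p0 pX cp)//; exact: cgF.
by rewrite -(EFin_gauss_mean cg gM) => h; apply: cvg_EFin => //; exact: nearW.
Qed.
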